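(* Let $1\le k\le d$, let $M\subset\mathbb P^d_{\mathbb R}$ be a submanifold of dimension $k$, and suppose that for some $D\in\mathbb N$ every point of $M$ is $D$-nondegenerate. Then $\mathrm{BA}_M(\psi_{c(k,d)})$ is hyperplane winning relative to $M$.
   Context: $\mathbb P^d_{\mathbb R}$ is real projective space, $\pi:\mathbb R^{d+1}\setminus\{0\}\to\mathbb P^d_{\mathbb R}$, $\pi(\mathbf x)=[\mathbf x]$, $\mathbb P^d_{\mathbb Q}=\{[\mathbf p]:\mathbf p\in\mathbb Q^{d+1}\setminus\{0\}\}$. Fix a Riemannian metric $\mathrm{dist}$ on $\mathbb P^d_{\mathbb R}$; $\|\cdot\|$ is the max norm; $H_{\mathrm{std}}([\mathbf p])=\|\mathbf p\|$ for $\mathbf p$ a primitive integer representative; $\psi_c(q)=q^{-c}$. Submanifolds are $C^\infty$, embedded, not necessarily closed or connected. $\mathrm{BA}_M(\psi)$ is the set of $[\mathbf x]\in M$ for which there is $\varepsilon>0$ with $\mathrm{dist}([\mathbf r],[\mathbf x])\ge\varepsilon\psi(H_{\mathrm{std}}([\mathbf r]))$ for all $[\mathbf r]\in\mathbb P^d_{\mathbb Q}\cap M$. $D$-nondegenerate: if $\Phi:U\to\mathbb R^{d+1}\setminus\{0\}$ ($U\subset\mathbb R^k$ open) is smooth with $\pi\circ\Phi$ a local parameterization of $M$ and $\pi\circ\Phi(\mathbf v)=[\mathbf x]$, then $[\mathbf x]$ is $D$-nondegenerate if $\{\partial^\alpha\Phi(\mathbf v):\alpha\in\mathbb N^k,|\alpha|\le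 D\}$ spans $\mathbb R^{d+1}$. $c(k,d)$: with $[n,m]=\binom{n+m}{m}$, let $n_{k,d}$ be the largest positive integer $n$ with $d=k+\sum_{j=2}^n[k-1,j]+m$ for some integer $m\ge0$, $m_{k,d}$ that $m$, $N_{k,d}=k+\sum_{j=2}^{n_{k,d}}j[k-1,j]+(n_{k,d}+1)m_{k,d}$, $c(k,d)=(d+1)/N_{k,d}$. Hyperplane game: for $\beta>0$, the $\beta$-hyperplane game on $\mathbb R^k$ is played by Alice and Bob. Bob chooses a ball $B_0=B(\mathbf x_0,\rho_0)$. After Bob's move $B_n=B(\mathbf x_n,\rho_n)$, Alice chooses an affine hyperplane $A_n\subset\mathbb R^k$; then Bob must choose a ball $B_{n+1}=B(\mathbf x_{n+1},\rho_{n+1})$ with $B_{n+1}\subset B_n\setminus A_n^{(\beta\rho_n)}$ and $\rho_{n+1}\ge\beta\rho_n$ ($S^{(\epsilon)}$ is the closed $\epsilon$-neighbourhood of $S$); if he cannot, he loses. $S\subset\mathbb R^k$ is $\beta$-hyperplane winning if Alice has a strategy guaranteeing that either Bob loses or $\bigcap_n B_n\cap S\neq\emptyset$. $S$ is hyperplane winning if it is $\beta$-hyperplane winning for every $\beta>0$. A subset $S$ of a $k$-dimensional manifold $M$ is hyperplane winning relative to $M$ if for every local parameterization $\Psi:U\to M$ ($U\subset\mathbb R^k$ open) and every compact $K\subset U$, the set $\Psi^{-1}(S)\cup(\mathbb R^k\setminus K)$ is hyperplane winning. *)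

(* Defs.v *)
From HB Require Import structures.
From mathcomp Require Export all_boot all_order all_algebra.
From mathcomp Require Export all_classical all_reals all_analysis.
Export Order.TTheory GRing.Theory Num.Theory numFieldNormedType.Exports.

Set Implicit Arguments.
Unset Strict Implicit.
Unset Printing Implicit Defensive.

Local Open Scope classical_set_scope.
Local Open Scope ring_scope.

(** * Smooth maps *)

Definition partial {R : realType} {k : nat} {W : normedModType R} (i : 'I_k)
    (f : 'rV[R]_k -> W) : 'rV[R]_k -> W :=
  fun x => 'D_(delta_mx 0 i) f x.

Definition partials {R : realType} {k : nat} {W : normedModType R}
    (s : seq 'I_k) (f : 'rV[R]_k -> W) : 'rV[R]_k -> W :=
  foldr partial f s.

(* Meant for open [U]; [f] is total, but only its values on [U] matter. *)
Definition smooth_on {R : realType} {k : nat} {W : normedModType R}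
    (U : set 'rV[R]_k) (f : 'rV[R]_k -> W) : Prop :=
  forall (s : seq 'I_k) (x : 'rV[R]_k), U x ->
    (forall i : 'I_k, derivable (partials s f) x (delta_mx 0 i)) /\
    {for x, continuous (partials s f)}.

(* The multi-index derivative: coordinate [i] occurs [alpha i] times. *)
Definition mpartial {R : realType} {k : nat} {W : normedModType R}
    (alpha : 'I_k -> nat) (f : 'rV[R]_k -> W) : 'rV[R]_k -> W :=
  partials (flatten [seq nseq (alpha i) i | i <- enum 'I_k]) f.

(** * Real projective space *)

(* Points are the lines through the origin of R^(d+1). *)
Definition proj_space (R : realType) (d : nat) : Type :=
  {L : {vspace 'rV[R]_d.+1} | \dim L == 1%N}.

(* [p = [x]]. Since [p] has dimension 1, this forces [x != 0]. *)
Definition represents {R : realType} {d : nat}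
    (x : 'rV[R]_d.+1) (p : proj_space R d) : Prop :=
  sval p = <[x]>%VS.

(* The quotient topology. *)
Definition proj_open {R : realType} {d : nat} (O : set (proj_space R d)) : Prop :=
  open [set x : 'rV[R]_d.+1 | exists2 p, O p & represents x p].

Definition rational_points {R : realType} {d : nat} : set (proj_space R d) :=
  [set p | exists q : 'rV[rat]_d.+1, represents (map_mx ratr q) p].

Definition primitive {d : nat} (z : 'rV[int]_d.+1) : bool :=
  \big[gcdn/0%N]_i absz (z 0 i) == 1%N.

(* The norm of ['rV[R]_d.+1] is the max norm. A rational point has exactly two
   primitive representatives, [z] and [- z]; the junk value at irrational
   points is 0. *)
Definition H_std {R : realType} {d : nat} (p : proj_space R d) : R :=
  xget 0 [set h | exists z : 'rV[int]_d.+1,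
    let zR : 'rV[R]_d.+1 := map_mx intr z in
    [/\ primitive z, represents zR p & h = `|zR|]].

(** * Riemannian metrics on projective space *)

(* A Riemannian metric on P^d is given by its pullback along the submersion
   x |-> [x]. The pullback is a smooth symmetric 2-tensor [g] on
   R^(d+1) \ {0}; a tensor is such a pullback iff it is invariant under all
   dilations x |-> a x and, at each [x], is positive semidefinite with radical
   the line R x, the kernel of the differential of x |-> [x]. *)
Record riemannian {R : realType} {d : nat}
    (g : 'rV[R]_d.+1 -> 'M[R]_d.+1) : Prop := Riemannian {
  riemannian_smooth : smooth_on [set x | x != 0] g;
  riemannian_sym : forall x, x != 0 -> (g x)^T = g x;
  riemannian_dilation : forall x (a : R), x != 0 -> a != 0 ->
    a ^+ 2 *: g (a *: x) = g x;
  riemannian_radical : forall x, x != 0 -> x *m g x = 0;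
  riemannian_pos : forall x u : 'rV[R]_d.+1, x != 0 -> u \notin <[x]>%VS ->
    0 < (u *m g x *m u^T) 0 0
}.

Definition C1_curve {R : realType} {d : nat} (gamma : R -> 'rV[R]_d.+1) : Prop :=
  (forall t, derivable gamma t 1) /\ continuous (derive1 gamma).

Definition curve_length {R : realType} {d : nat}
    (g : 'rV[R]_d.+1 -> 'M[R]_d.+1) (gamma : R -> 'rV[R]_d.+1) : R :=
  \int[lebesgue_measure]_(t in `[0, 1])
    Num.sqrt ((derive1 gamma t *m g (gamma t) *m (derive1 gamma t)^T) 0 0).

(* The infimum of the lengths of C^1 curves from [p] to [q]. Every such curve
   lifts to R^(d+1) \ {0}, and the length does not depend on the lift. Piecewise
   C^1 curves give the same infimum, as they become C^1 when reparameterized to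
   stop at the corners. *)
Definition riemannian_dist {R : realType} {d : nat}
    (g : 'rV[R]_d.+1 -> 'M[R]_d.+1) (p q : proj_space R d) : R :=
  inf [set l | exists gamma : R -> 'rV[R]_d.+1,
    [/\ C1_curve gamma,
        forall t : R, t \in `[0, 1] -> gamma t != 0,
        represents (gamma 0) p,
        represents (gamma 1) q
      & l = curve_length g gamma]].

(** * Submanifolds of projective space *)

(* [Psi] is [[Phi]] on [U]. In particular [Phi] does not vanish on [U]. *)
Definition lifts {R : realType} {k d : nat} (U : set 'rV[R]_k)
    (Phi : 'rV[R]_k -> 'rV[R]_d.+1) (Psi : 'rV[R]_k -> proj_space R d) : Prop :=
  forall v, U v -> represents (Phi v) (Psi v).

(* A map into P^d is smooth iff it has smooth lifts locally; a global lift need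
   not exist. The differential of [[Phi]] at [v] is injective iff [Phi v] and
   the first partial derivatives of [Phi] at [v] are linearly independent. *)
Definition smooth_immersion {R : realType} {k d : nat} (U : set 'rV[R]_k)
    (Psi : 'rV[R]_k -> proj_space R d) : Prop :=
  forall v, U v -> exists (V : set 'rV[R]_k) (Phi : 'rV[R]_k -> 'rV[R]_d.+1),
    [/\ open V, V v, V `<=` U, smooth_on V Phi & lifts V Phi Psi] /\
    free (Phi v :: [seq partial i Phi v | i <- enum 'I_k]).

(* A smooth immersion of [U] that is a homeomorphism onto an open subset of [M]
   with the subspace topology. *)
Definition local_parameterization {R : realType} {k d : nat}
    (M : set (proj_space R d)) (U : set 'rV[R]_k)
    (Psi : 'rV[R]_k -> proj_space R d) : Prop :=
  [/\ open U,
      Psi @` U `<=` M,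
      smooth_immersion U Psi,
      set_inj U Psi
    & forall V : set 'rV[R]_k, open V -> V `<=` U ->
        exists2 O, proj_open O & Psi @` V = M `&` O].

Definition submanifold {R : realType} {d : nat} (k : nat)
    (M : set (proj_space R d)) : Prop :=
  forall p, M p -> exists (U : set 'rV[R]_k) (Psi : 'rV[R]_k -> proj_space R d),
    local_parameterization M U Psi /\ (Psi @` U) p.

(* All partial derivatives of order at most [D]. Such a multi-index has entries
   at most [D], hence the finite type of functions into ['I_D.+1]. *)
Definition jet {R : realType} {k d : nat} (D : nat)
    (Phi : 'rV[R]_k -> 'rV[R]_d.+1) (v : 'rV[R]_k) : seq 'rV[R]_d.+1 :=
  [seq mpartial (fun i => nat_of_ord (alpha i)) Phi v |
    alpha : {ffun 'I_k -> 'I_D.+1} <- enum {ffun 'I_k -> 'I_D.+1}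
    & (\sum_(i < k) alpha i <= D)%N].

Definition nondegenerate {R : realType} {d : nat} (k D : nat)
    (M : set (proj_space R d)) (p : proj_space R d) : Prop :=
  exists (U : set 'rV[R]_k) (Phi : 'rV[R]_k -> 'rV[R]_d.+1)
         (Psi : 'rV[R]_k -> proj_space R d) (v : 'rV[R]_k),
    [/\ local_parameterization M U Psi, smooth_on U Phi, lifts U Phi Psi,
        U v & Psi v = p] /\
    <<jet D Phi v>>%VS = fullv.

(** * Intrinsically badly approximable points *)

Definition psi {R : realType} (c : R) : R -> R := fun q => q `^ (- c).

Definition BA {R : realType} {d : nat}
    (dist : proj_space R d -> proj_space R d -> R)
    (M : set (proj_space R d)) (f : R -> R) : set (proj_space R d) :=
  [set x | M x /\ exists2 eps : R, 0 < eps &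
    forall r, rational_points r -> M r -> eps * f (H_std r) <= dist r x].

(** * The exponent c(k, d) *)

Definition bracket (n m : nat) : nat := 'C(n + m, m).

Definition dim_upto (k n : nat) : nat :=
  (k + \sum_(2 <= j < n.+1) bracket k.-1 j)%N.

(* Admissible [n] satisfy [n <= d], as [1 <= k] and all brackets are positive. *)
Definition n_kd (k d : nat) : nat :=
  \max_(n < d.+1 | (0 < n)%N && (dim_upto k n <= d)%N) n.

Definition m_kd (k d : nat) : nat := (d - dim_upto k (n_kd k d))%N.

Definition N_kd (k d : nat) : nat :=
  (k + \sum_(2 <= j < (n_kd k d).+1) j * bracket k.-1 j
     + (n_kd k d).+1 * m_kd k d)%N.

Definition c_kd (R : realType) (k d : nat) : R := d.+1%:R / (N_kd k d)%:R.

(** * The hyperplane game *)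

Definition affine_hyperplane {R : realType} {k : nat} (A : set 'rV[R]_k) : Prop :=
  exists (a : 'cV[R]_k) (b : R), a != 0 /\ A = [set x | (x *m a) 0 0 = b].

(* Closed balls, for the max norm. *)
Definition cball {R : realType} {k : nat} (b : 'rV[R]_k * R) : set 'rV[R]_k :=
  closed_ball_ (fun x => `|x|) b.1 b.2.

Definition closed_nbhd {R : realType} {k : nat} (A : set 'rV[R]_k) (e : R) :
    set 'rV[R]_k :=
  [set x | (edist_inf A x <= e%:E)%E].

(* Alice's strategy [sigma] sees the balls (center, radius) that Bob has played
   so far; her own past moves are determined by them. Finite plays, in which Bob
   gets stuck and loses, impose no condition on [sigma]. *)
Definition beta_hyperplane_winning {R : realType} {k : nat} (beta : R)
    (S : set 'rV[R]_k) : Prop :=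
  exists sigma : seq ('rV[R]_k * R) -> set 'rV[R]_k,
    (forall h, affine_hyperplane (sigma h)) /\
    forall B : nat -> 'rV[R]_k * R,
      (forall n, 0 < (B n).2) ->
      (forall n,
        cball (B n.+1) `<=`
          cball (B n) `\` closed_nbhd (sigma (mkseq B n.+1)) (beta * (B n).2) /\
        beta * (B n).2 <= (B n.+1).2) ->
      (\bigcap_n cball (B n)) `&` S !=set0.

Definition hyperplane_winning {R : realType} {k : nat} (S : set 'rV[R]_k) : Prop :=
  forall beta : R, 0 < beta -> beta_hyperplane_winning beta S.

Definition hyperplane_winning_rel {R : realType} {d : nat} (k : nat)
    (M S : set (proj_space R d)) : Prop :=
  forall (U : set 'rV[R]_k) (Psi : 'rV[R]_k -> proj_space R d)
         (K : set 'rV[R]_k),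
    local_parameterization M U Psi -> compact K -> K `<=` U ->
    hyperplane_winning ((U `&` Psi @^-1` S) `|` ~` K).

(* Main.v *)
Require Import Defs.
From mathcomp Require Import perm ring lra zify.

(** Let [N = N_kd k d]. Alice plays in stages; in stage [t] the balls have radius comparable
to [eta t = theta ^ t * rho0], and she disposes of the rational points of [M] of height [H]
with [H ^ (d+1) * eta t ^ N <= kappa].
- In a chart [Psi = [Phi]] on a ball of radius [rho], Taylor expansion of the rows shows that
a determinant [det (Phi (w_i))] of size [d + 1] is [O(rho ^ N)]: in each nonzero term of the
multilinear expansion the monomials are distinct, and [N] is the least total degree of
[d + 1] distinct ones. Integer representatives have determinant at least 1 if they are
independent, so the rational points of stage [t] in the ball lie on one hyperplane
[f = <Phi, a> = 0].
- By nondegeneracy some derivative of [f] of order at most [D] dominates at the scale [rho].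
Integrating one derivative at a time, the zero set of each primitive is close to an affine
hyperplane in a slightly smaller ball; Alice deletes it, and after boundedly many moves Bob's
ball is at distance at least a constant times [rho] from [f = 0].
- Nondegeneracy is given in some chart only. It passes to every chart because it says that
[f] vanishes to order at most [D] along [M], and charts are bi-Lipschitz.
- Distances in a chart are bounded by the Riemannian distance, because the entries of the
orthogonal projector onto a line are Lipschitz functions on projective space. *)

Set Implicit Arguments.
Unset Strict Implicit.
Unset Printing Implicit Defensive.

Local Open Scope classical_set_scope.
Local Open Scope ring_scope.

(** The exponent (d + 1) / N is the one for which [H ^ (d+1) * eta ^ N = 1] at [eta = psi c H]. So a
    rational point is disposed of when Bob's radius is comparable to the distance that bad
    approximability requires, and a margin proportional to the radius is enough. The obstacle is
    uniformity: the covector [a] changes at every stage and nothing is known about it. Derivatives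
    are therefore compared in the scale-free form [r ^ |s| * |f_s|]. Nondegeneracy bounds [|a|]
    through the largest of them of order at most D; those of order D + 1 carry one more factor [r],
    so on small balls they cannot exceed that maximum. The constants of a stage then depend on
    [beta], [k], [D] and the chart only. The admissible initial radius depends on the point of [K]
    that Bob approaches, which Alice does not know in advance, and the rules do not make Bob's radii
    shrink. Hyperplanes through the centres force halving, and a bar argument lets her wait until
    the ball is small for some point or misses [K]. *)

Lemma mxnormP (R : realType) m n (A : 'M[R]_(m, n)) (e : R) : 0 <= e ->
  `|A| <= e <-> forall i j, `|A i j| <= e.
Proof.
move=> e0; rewrite {1}/Num.Def.normr /= mx_normrE; split.
  by move=> /bigmax_leP[_ h] i j; exact: (h (i, j)).
by move=> h; apply/bigmax_leP; split => // -[i j] _; exact: h.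
Qed.

Lemma coord_norm (R : realType) m n (A : 'M[R]_(m, n)) i j : `|A i j| <= `|A|.
Proof. exact: (mxnormP A (normr_ge0 A)).1 (lexx _) i j. Qed.

Lemma mulmx_norm (R : realType) m n p (A : 'M[R]_(m, n)) (B : 'M[R]_(n, p)) :
  `|A *m B| <= n%:R * `|A| * `|B|.
Proof.
apply/mxnormP => [|i j]; first by rewrite !mulr_ge0.
rewrite mxE (le_trans (ler_norm_sum _ _ _))//.
rewrite -mulrA mulr_natl -[X in _ *+ X]card_ord -sumr_const; apply: ler_sum => l _.
by rewrite normrM ler_pM // coord_norm.
Qed.

Lemma sub_mxE (W : zmodType) m n (A B : 'M[W]_(m, n)) i j : (A - B) i j = A i j - B i j.
Proof. by rewrite !mxE. Qed.

(** * The hyperplane game *)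

Lemma choice_ex (X Y : Type) (P : X -> Y -> Prop) :
  (forall x, exists y, P x y) -> exists f, forall x, P x (f x).
Proof. by move=> /choice [f]; exists f. Qed.

Section Game.
Variables (R : realType) (k : nat) (beta : R).
Hypothesis beta_gt0 : 0 < beta.
Local Notation V := 'rV[R]_k.
Local Notation ballT := (V * R)%type.

Lemma cballP (b : ballT) (u : V) : cball b u <-> `|b.1 - u| <= b.2.
Proof. by []. Qed.

Definition legal (b : ballT) (A : set V) (b' : ballT) : Prop :=
  cball b' `<=` cball b `\` closed_nbhd A (beta * b.2) /\ beta * b.2 <= b'.2.

Lemma legal_sub b A b' : legal b A b' -> cball b' `<=` cball b.
Proof. by move=> [h _] u /h []. Qed.

Lemma legal_far b A b' (u a : V) : 0 < b.2 ->
  legal b A b' -> cball b' u -> A a -> beta * b.2 < `|u - a|.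
Proof.
move=> b0 [h _] /h [_ hu] Aa; rewrite ltNge; apply/negP => le; apply: hu.
rewrite /closed_nbhd /=.
(* [edist_fin] works with open balls, hence with radii strictly above the distance; the closed bound
   is reached as an infimum. *)
have -> : (beta * b.2)%:E = ereal_inf [set x | exists e : R, beta * b.2 < e /\ x = e%:E].
  apply/eqP; rewrite eq_le; apply/andP; split.
    by apply: le_ereal_inf_tmp => _ [e [he ->]]; rewrite lee_fin ltW.
  apply/lee_addgt0Pr => e e0; apply: ereal_inf_lbound; exists (beta * b.2 + e).
  by rewrite ltrDl.
apply: le_ereal_inf_tmp => _ [e [he ->]].
apply: (@le_trans _ _ (edist (u, a))); first by apply: ereal_inf_lbound; exists a.
apply: edist_fin; first exact: lt_trans (mulr_gt0 _ _) he.
by rewrite /= -ball_normE /ball_ /= (le_lt_trans le).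
Qed.

Lemma cball_center (b : ballT) : 0 < b.2 -> cball b b.1.
Proof. by move=> /ltW ?; rewrite cballP subrr normr0. Qed.

(* Well-founded rather than bounded: the number of moves may depend on Bob's play. *)
Inductive force (Q : ballT -> Prop) : ballT -> Prop :=
| force_now b : Q b -> force Q b
| force_move b A : affine_hyperplane A ->
    (forall b', 0 < b'.2 -> legal b A b' -> force Q b') -> force Q b.

Lemma force_bind (P Q : ballT -> Prop) b :
  force P b -> (forall b', P b' -> force Q b') -> force Q b.
Proof.
move=> + h; elim=> {b} [b /h //|b A hA _ IH].
exact: (force_move hA IH).
Qed.

Definition follows (sigma : seq ballT -> set V) (B : nat -> ballT) : Prop :=
  (forall n, 0 < (B n).2) /\
  forall n, legal (B n) (sigma (mkseq B n.+1)) (B n.+1).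

Definition guarantees (G : set (nat -> ballT)) (b : ballT) : Prop :=
  exists sigma, (forall h, affine_hyperplane (sigma h)) /\
    forall B, B 0%N = b -> follows sigma B -> G B.

Lemma mkseqS_shift (B : nat -> ballT) n :
  mkseq B n.+1 = B 0%N :: mkseq (fun i => B i.+1) n.
Proof. by rewrite /mkseq /= (iotaDl 1%N 0%N n) -map_comp. Qed.

(** After the move [A], Alice looks up the strategy attached to Bob's reply and feeds it the history
    without its first ball. The goal has to hold for the play with that ball put back in front,
    whence the quantifier over [b0]. *)
Lemma guarantees_step (G : set (nat -> ballT)) b A : affine_hyperplane A ->
  (forall b', 0 < b'.2 -> legal b A b' ->
     guarantees [set B | forall b0, G (fun n => if n is n'.+1 then B n' else b0)] b') ->
  guarantees G b.
Proof.
move=> hA h.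
have [tau htau] : exists tau : ballT -> seq ballT -> set V, forall b',
    (forall h, affine_hyperplane (tau b' h)) /\ (0 < b'.2 -> legal b A b' ->
    forall B, B 0%N = b' -> follows (tau b') B ->
     forall b0, G (fun n => if n is n'.+1 then B n' else b0)).
  apply: (@choice_ex _ _ (fun b' (t : seq ballT -> set V) =>
   (forall h, affine_hyperplane (t h)) /\ (0 < b'.2 -> legal b A b' ->
    forall B, B 0%N = b' -> follows t B ->
     forall b0, G (fun n => if n is n'.+1 then B n' else b0)))) => b'.
  have [[h0 hl]|no] := pselect (0 < b'.2 /\ legal b A b').
    by have [s [s1 s2]] := h _ h0 hl; exists s.
  by exists (fun=> A); split=> // h0 hl; exfalso; apply: no.
exists (fun l => if l is _ :: ((b' :: _) as t) then tau b' t else A); split.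
  by case=> [|x [|y l]] //; exact: (htau _).1.
move=> B B0 [Bpos Bleg].
have -> : B = (fun n => if n is n'.+1 then B n'.+1 else B 0%N).
  by apply: funext; case.
apply: ((htau (B 1%N)).2 (Bpos _) _ (fun n => B n.+1) erefl).
  by have := Bleg 0%N; rewrite /= B0.
split=> n; first exact: Bpos.
rewrite (mkseqS_shift (fun i => B i.+1)).
by have := Bleg n.+1; rewrite mkseqS_shift (mkseqS_shift (fun i => B i.+1)).
Qed.

Lemma force_guarantees (Q : ballT -> Prop) (G : set (nat -> ballT)) b :
  force Q b ->
  (forall B b0, G B -> G (fun n => if n is n'.+1 then B n' else b0)) ->
  (forall b', Q b' -> guarantees G b') -> guarantees G b.
Proof.
move=> + hG hQ; elim=> {b} [b /hQ //|b A hA _ IH].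
apply: (guarantees_step hA) => b' b'0 /IH - /(_ b'0) [s [s1 s2]].
by exists s; split=> // B B0 Bf b0; apply: hG; exact: s2.
Qed.

Hypothesis k_gt0 : (0 < k)%N.

Definition central (x : V) : set V :=
  [set u | (u *m (const_mx 1 : 'cV[R]_k)) 0 0 = (x *m (const_mx 1 : 'cV[R]_k)) 0 0].

Lemma central_hyperplane x : affine_hyperplane (central x).
Proof.
exists (const_mx 1), ((x *m (const_mx 1 : 'cV[R]_k)) 0 0); split=> //.
apply/eqP => /matrixP /(_ (Ordinal k_gt0) 0) /eqP.
by rewrite !mxE oner_eq0.
Qed.

(** The centre of [b] is outside [b'], so the two centres are more than [b'.2] apart; the point of
    [b'] farthest from the centre of [b] is then at distance more than [2 * b'.2] from it, and still
    in [b]. *)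
Lemma legal_central b b' : 0 < b.2 -> 0 < b'.2 -> legal b (central b.1) b' ->
  b'.2 <= b.2 / 2.
Proof.
move=> b0 b'0 hl.
have hc : ~ cball b' b.1.
  move=> hb; have := legal_far b0 hl hb (erefl : central b.1 b.1).
  by rewrite subrr normr0 ltNge mulr_ge0 // ltW.
have hlt : b'.2 < `|b'.1 - b.1| by rewrite ltNge; apply/negP => /cballP /hc.
set e := b'.1 - b.1 in hlt; have e0 : 0 < `|e| by exact: lt_trans hlt.
have : cball b' (b'.1 + (b'.2 / `|e|) *: e).
  rewrite cballP opprD addNKr normrN normrZ normrM normfV normr_id.
  by rewrite divfK ?gt_eqF // gtr0_norm.
move=> /(legal_sub hl); rewrite cballP => h.
have : `|e| + b'.2 <= b.2.
  apply: le_trans h; rewrite [leRHS]distrC addrAC -/e -{2}[e]scale1r -scalerDl normrZ.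
  rewrite gtr0_norm ?addr_gt0 // ?divr_gt0 // mulrDl mul1r divfK ?gt_eqF //.
lra.
Qed.

(** Hyperplanes through the centres halve the radius until it is at most [e]. The radius before the
    last move exceeded [e], so Bob's rule keeps the last one above [beta * e]; the minimum covers
    the case where no move is made. *)
Lemma force_shrink (b : ballT) (e : R) : 0 < e -> 0 < b.2 ->
  force (fun b' => [/\ cball b' `<=` cball b, 0 < b'.2, b'.2 <= e &
    Num.min b.2 (beta * e) <= b'.2]) b.
Proof.
move=> e0 b0; have [n hn] : exists n, b.2 <= 2 ^+ n * e.
  have := archi_boundP (divr_ge0 (ltW b0) (ltW e0)).
  set n := Num.bound _ => hn; exists n; rewrite -ler_pdivrMr // (le_trans (ltW hn)) //.
  by rewrite -natrX ler_nat ltnW // ltn_expl.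
elim: n b b0 hn => [|n IH] b b0 hn.
  by apply: force_now; split=> //; rewrite ?ge_min ?lexx // -[e]mul1r -(expr0 2).
have [le|gt] := leP b.2 e.
  by apply: force_now; split=> //; rewrite ge_min lexx.
apply: (force_move (central_hyperplane b.1)) => b' b'0 hl.
have hh := legal_central b0 b'0 hl.
have : b'.2 <= 2 ^+ n * e.
  apply: le_trans hh _; rewrite ler_pdivrMr // (le_trans hn) //.
  by rewrite exprS -mulrA [leRHS]mulrC.
move=> /(IH _ b'0) hf; apply: (force_bind hf) => b'' [h1 h2 h3 h4].
apply: force_now; split=> //; first by move=> u /h1 /(legal_sub hl).
apply: le_trans h4; rewrite le_min; apply/andP; split.
  rewrite ge_min; apply/orP; right; apply: le_trans hl.2.
  by rewrite ler_pM2l // ltW.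
by rewrite ge_min lexx orbT.
Qed.

(** Bar induction by contradiction: from a ball where [Q] cannot be forced, some legal reply to the
    central hyperplane is again such a ball. Dependent choice gives an infinite play with halving
    radii that never meets [Q]. *)
Lemma force_bar (Q : ballT -> Prop) (b : ballT) : 0 < b.2 ->
  (forall B, B 0%N = b -> (forall n, 0 < (B n).2) ->
    (forall n, cball (B n.+1) `<=` cball (B n)) ->
    (forall n, (B n).2 <= b.2 / 2 ^+ n) -> exists n, Q (B n)) ->
  force Q b.
Proof.
move=> b0 hQ; apply: contrapT => nf.
pose bad := {b' : ballT | 0 < b'.2 /\ ~ force Q b'}.
have [next hnext] : exists next : bad -> bad, forall c,
    legal (sval c) (central (sval c).1) (sval (next c)).
  apply: (@choice_ex _ _ (fun c c' : bad => legal (sval c) (central (sval c).1) (sval c'))).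
  move=> [c [c0 nc]] /=; apply: contrapT => no; apply: nc.
  apply: (force_move (central_hyperplane c.1)) => b' b'0 hl.
  by apply: contrapT => nb; apply: no; exists (exist _ b' (conj b'0 nb)).
pose B n := sval (iter n next (exist _ b (conj b0 nf))).
have Bpos n : 0 < (B n).2 by rewrite /B; case: (iter _ _ _) => ? [].
have Bleg n : legal (B n) (central (B n).1) (B n.+1) by exact: hnext.
have [|n|n|n] := hQ B erefl => //; first exact: legal_sub (Bleg n).
  elim: n => [|n IH]; first by rewrite expr0 divr1.
  apply: le_trans (legal_central (Bpos n) (Bpos _) (Bleg n)) _.
  by rewrite exprS invfM mulrCA [_^-1 * _]mulrC ler_pM2r // invr_gt0.
move: (proj2_sig (iter n next (exist _ b (conj b0 nf)))) => [_ nfn] hq.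
exact/nfn/force_now.
Qed.

(** * Infinitely many stages played in succession *)

Section Stages.
Variable P : nat -> ballT -> Prop.
Hypothesis P_force : forall t b, P t b -> force (P t.+1) b.
Hypothesis P_excl : forall t b, P t b -> ~ P t.+1 b.

(** Each stage has a strategy for every ball at which it may begin. The combined strategy recomputes
    from the history the ball at which the last stage ended, and gives the strategy chosen for it
    the balls played since. *)
Lemma stages b : P 0 b ->
  guarantees [set B | forall t, exists n, P t (B n)] b.
Proof.
move=> P0.
have [tau htau] : exists tau : nat * ballT -> seq ballT -> set V, forall tb,
    (forall h, affine_hyperplane (tau tb h)) /\
    (P tb.1 tb.2 -> forall B, B 0%N = tb.2 -> follows (tau tb) B ->
       exists n, P tb.1.+1 (B n)).
  apply: (@choice_ex _ _ (fun tb (s : seq ballT -> set V) =>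
    (forall h, affine_hyperplane (s h)) /\
    (P tb.1 tb.2 -> forall B, B 0%N = tb.2 -> follows s B ->
       exists n, P tb.1.+1 (B n)))) => -[t c] /=.
  have [Pt|] := pselect (P t c); last first.
    by exists (fun=> central 0); split=> // h; exact: central_hyperplane.
  have [s [s1 s2]] : guarantees [set B | exists n, P t.+1 (B n)] c.
    apply: (force_guarantees (P_force Pt)).
      by move=> B b0 [n Pn]; exists n.+1.
    move=> b' Pb'; exists (fun=> central 0); split; first by move=> ?; exact: central_hyperplane.
    by move=> B B0 _; exists 0%N; rewrite B0.
  by exists s; split=> // _ B B0 /(s2 _ B0).
(* State: the last completed stage and the balls played since its completion. *)
pose upd (st : nat * seq ballT) c :=
  if `[< P st.1.+1 c >] then (st.1.+1, [:: c]) else (st.1, rcons st.2 c).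
pose state (h : seq ballT) := if h is c :: h' then foldl upd (0%N, [:: c]) h'
  else (0%N, [::]).
exists (fun h => tau ((state h).1, head b (state h).2) (state h).2); split.
  by move=> h; exact: (htau _).1.
move=> B B0 [Bpos Bleg].
have stS n : state (mkseq B n.+2) = upd (state (mkseq B n.+1)) (B n.+1).
  by rewrite /state mkseqS_shift (mkseqS_shift B n) mkseqS -cats1 foldl_cat.
suff H t : exists n, P t (B n) /\ state (mkseq B n.+1) = (t, [:: B n]).
  by move=> t; have [n [Pn _]] := H t; exists n.
elim: t => [|t [n [Pn sn]]]; first by exists 0%N; rewrite /= B0.
pose C i := B (n + i)%N.
have C0 : C 0%N = B n by rewrite /C addn0.
have [[m [Pm hm]]|no] := pselect (exists m, P t.+1 (C m) /\ forall i, (i < m)%N -> ~ P t.+1 (C i)).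
  have st i : (i < m)%N -> state (mkseq B (n + i).+1) = (t, mkseq C i.+1).
    elim: i => [|i IH] im; first by rewrite addn0 sn -C0.
    rewrite addnS stS IH ?(ltnW im) // /upd /= -addnS asboolF; last exact: hm im.
    by rewrite [in RHS]mkseqS.
  exists (n + m)%N; split=> //; case: m Pm hm st => [|m] Pm hm st.
    (* The state tests each ball for one stage only, so a ball completing two stages at once would
       be missed; [P_excl] excludes it. *)
    by exfalso; apply: (P_excl Pn); rewrite -C0.
  by rewrite addnS stS st // /upd /= -addnS asboolT.
have nP i : ~ P t.+1 (C i).
  move=> Pi; apply: no;
  have [m Pm hm] := @ex_minnP (fun i => `[< P t.+1 (C i) >]) (ex_intro _ i (asboolT Pi)).
  exists m; split; first exact/asboolP.
  by move=> j jm /asboolP /hm; rewrite leqNgt jm.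
have st i : state (mkseq B (n + i).+1) = (t, mkseq C i.+1).
  elim: i => [|i IH]; first by rewrite addn0 sn -C0.
  rewrite addnS stS IH /upd /= -addnS asboolF; last exact: nP.
  by rewrite [in RHS]mkseqS.
(* If the next stage were never completed, the whole tail [C] would follow the strategy that
   guarantees its completion. *)
have [//|i] := (htau (t, B n)).2 Pn C C0; last by move=> /nP.
split=> i; first exact: Bpos.
by have := Bleg (n + i)%N; rewrite st /= C0 -addnS.
Qed.

End Stages.

(** Balls of the max norm are products of intervals, so the suprema of the left endpoints give a
    common point coordinate by coordinate, whether or not the radii tend to 0. *)
Lemma nested_balls (B : nat -> ballT) : (forall n, 0 < (B n).2) ->
  (forall n, cball (B n.+1) `<=` cball (B n)) ->
  exists u, forall n, cball (B n) u.
Proof.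
move=> Bpos Bsub.
have sub n m : cball (B (n + m)%N) `<=` cball (B n).
  by elim: m => [|m IH]; rewrite ?addn0 // addnS => u /Bsub /IH.
have meet n m : exists u, cball (B n) u /\ cball (B m) u.
  exists (B (maxn n m)).1; split;
    [apply: (sub n (maxn n m - n)%N)|apply: (sub m (maxn n m - m)%N)];
    rewrite subnKC ?leq_maxl ?leq_maxr //; exact: cball_center.
pose L j := [set (B n).1 0 j - (B n).2 | n in setT].
have up j m : ubound (L j) ((B m).1 0 j + (B m).2).
  move=> _ [n _ <-]; have [u [/cballP hn /cballP hm]] := meet n m.
  have := le_trans (coord_norm _ 0 j) hn; have := le_trans (coord_norm _ 0 j) hm.
  rewrite !mxE !ler_norml => /andP[] ? ? /andP[] ? ?; lra.
exists (\row_j sup (L j)) => n; apply/cballP.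
apply/mxnormP => [|i j]; first exact: ltW.
rewrite ord1 !mxE ler_norml.
have h1 : sup (L j) <= (B n).1 0 j + (B n).2.
  by apply: ge_sup; [exists ((B 0%N).1 0 j - (B 0%N).2), 0%N|exact: up].
have h2 : (B n).1 0 j - (B n).2 <= sup (L j).
  by apply: ub_le_sup; [exists ((B 0%N).1 0 j + (B 0%N).2); exact: up|exists n].
apply/andP; split; lra.
Qed.

End Game.

Lemma hyperplane_winning_guarantees (R : realType) (k : nat) (beta : R) (S : set 'rV[R]_k) :
  (0 < k)%N ->
  (forall b, 0 < b.2 -> guarantees beta [set B | (\bigcap_n cball (B n)) `&` S !=set0] b) ->
  beta_hyperplane_winning beta S.
Proof.
move=> k0 h.
have [tau htau] : exists tau : 'rV[R]_k * R -> seq ('rV[R]_k * R) -> set 'rV[R]_k,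
   forall b, (forall h, affine_hyperplane (tau b h)) /\ (0 < b.2 ->
   forall B, B 0%N = b -> follows beta (tau b) B -> (\bigcap_n cball (B n)) `&` S !=set0).
  apply: (@choice_ex _ _ (fun b (s : seq ('rV[R]_k * R) -> set 'rV[R]_k) =>
    (forall h, affine_hyperplane (s h)) /\ (0 < b.2 ->
     forall B, B 0%N = b -> follows beta s B -> (\bigcap_n cball (B n)) `&` S !=set0))) => b.
  have [/h [s [s1 s2]]|nb] := pselect (0 < b.2); first by exists s.
  by exists (fun=> central 0); split=> // ?; exact: central_hyperplane.
exists (fun l => tau (head (0, 0) l) l); split; first by move=> l; exact: (htau _).1.
move=> B Bpos Bleg; apply: ((htau (B 0%N)).2 (Bpos _) B erefl).
by split=> // n; exact: Bleg.
Qed.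

(** * Families of iterated partial derivatives *)

Lemma is_deriveP (R : realType) (V W : normedModType R) (f : V -> W) a v l :
  is_derive a v f l <-> h^-1 *: (f (h *: v + a) - f a) @[h --> 0^'] --> l.
Proof.
split; first by case=> [d <-]; exact: d.
by move=> c; split; [exact: cvgP c|exact: cvg_lim].
Qed.

Lemma is_derive_line (R : realType) (V W : normedModType R) (f : V -> W) x w t l :
  is_derive (x + t *: w) w f l -> is_derive t 1 (fun t => f (x + t *: w)) l.
Proof.
move=> /is_deriveP h; apply/is_deriveP.
rewrite (_ : (fun d => _) = fun d => d^-1 *: (f (d *: w + (x + t *: w)) - f (x + t *: w))) //.
by apply: funext => d; rewrite [d *: 1]mulr1 scalerDl addrCA.
Qed.

Lemma is_derive_shifted (R : realType) (V W : normedModType R) (f : V -> W) c x w l :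
  is_derive (x + c) w f l -> is_derive x w (fun y => f (y + c)) l.
Proof.
move=> /is_deriveP h; apply/is_deriveP.
rewrite (_ : (fun d => _) = fun d => d^-1 *: (f (d *: w + (x + c)) - f (x + c))) //.
by apply: funext => d; rewrite addrA.
Qed.

Lemma is_derive_affine (R : realType) (V W : normedModType R) (f : V -> W) x w l :
  (forall h : R, f (h *: w + x) - f x = h *: l) -> is_derive x w f l.
Proof.
move=> hf; apply/is_deriveP; apply: cvg_near_cst; near=> h.
rewrite hf scalerA mulVf ?scale1r //; near: h; exact: nbhs_dnbhs_neq.
Unshelve. all: by end_near. Qed.

(** A quadratic remainder divided by the increment tends to 0. This turns [jet_quad] into a chain
    rule along lines, starting from partial derivatives alone. *)
Lemma is_derive_quad (R : realType) (f : R -> R) (t l C e : R) : 0 < e ->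
  (forall d, `|d| < e -> `|f (t + d) - f t - d * l| <= C * d ^+ 2) ->
  is_derive t 1 f l.
Proof.
move=> e0 hf; apply/is_deriveP; apply/cvgrPdist_le => eps eps0.
have C1 : 0 < `|C| + 1 by rewrite ltr_wpDl.
near=> h.
have h0 : h != 0 by near: h; exact: nbhs_dnbhs_neq.
have he : `|h| < e by near: h; exact: dnbhs0_lt.
have he' : `|h| <= eps / (`|C| + 1).
  by near: h; apply: dnbhs0_le; exact: divr_gt0.
rewrite [h *: 1]mulr1 [h + t]addrC -[_ *: _]/(_ * _).
have -> : l - h^-1 * (f (t + h) - f t) = - (h^-1 * (f (t + h) - f t - h * l)).
  by rewrite [in RHS]mulrBr mulKf // opprB.
rewrite normrN normrM normfV ler_pdivrMl ?normr_gt0 //.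
apply: le_trans (hf _ he) _; rewrite -[h ^+ 2]real_normK ?num_real //.
rewrite expr2 mulrCA ler_pM2l ?normr_gt0 //.
apply: le_trans (_ : (`|C| + 1) * `|h| <= _); last by rewrite mulrC -ler_pdivlMr.
by rewrite ler_wpM2r // (le_trans (ler_norm _)) // lerDl.
Unshelve. all: by end_near. Qed.

Lemma is_derive_bigsum (R : realType) (V W : normedModType R) (I : Type) (r : seq I)
    (F : I -> V -> W) (dF : I -> W) x w :
  (forall i, is_derive x w (F i) (dF i)) ->
  is_derive x w (fun y => \sum_(i <- r) F i y) (\sum_(i <- r) dF i).
Proof.
move=> h; elim: r => [|i r IH].
  under eq_fun do rewrite big_nil; rewrite big_nil; exact: is_derive_cst.
under eq_fun do rewrite big_cons; rewrite big_cons.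
exact: (@is_deriveD _ _ _ (F i) (fun y => \sum_(j <- r) F j y)).
Qed.

Lemma is_derive_cmul (R : realType) (V : normedModType R) (f : V -> R) (c l : R) x v :
  is_derive x v f l -> is_derive x v (fun y => c * f y) (c * l).
Proof. exact: is_deriveZ. Qed.

Lemma is_derive_pow (R : realType) j (t : R) :
  is_derive t 1 (fun x : R => x ^+ j) (j%:R * t ^+ j.-1).
Proof.
split; first exact: exprn_derivable.
by rewrite exp_derive -[_ *: _]/(_ * _ * 1) mulr1.
Qed.

Lemma mvt_bound (R : realType) (f df : R -> R) (a b C : R) : a <= b ->
  (forall x, a <= x <= b -> is_derive x 1 f (df x)) ->
  (forall x, a <= x <= b -> `|df x| <= C) ->
  `|f b - f a| <= C * (b - a).
Proof.
move=> ab hd hC.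
have [x|x|c] := @MVT_segment R f df a b ab.
- by rewrite in_itv /= => /andP[/ltW ? /ltW ?]; apply: hd; apply/andP.
- apply: derivable_within_continuous => y; rewrite in_itv /= => /hd; case; done.
rewrite in_itv /= => hc ->; rewrite normrM [`|b - a|]ger0_norm ?subr_ge0 //.
by rewrite ler_wpM2r ?subr_ge0 // hC.
Qed.

Lemma mvt_bound_sym (R : realType) (f df : R -> R) (a b C : R) :
  (forall x, Num.min a b <= x <= Num.max a b -> is_derive x 1 f (df x)) ->
  (forall x, Num.min a b <= x <= Num.max a b -> `|df x| <= C) ->
  `|f b - f a| <= C * `|b - a|.
Proof.
have [ab|/ltW ba] := leP a b => hd hC.
  by rewrite [`|b - a|]ger0_norm ?subr_ge0 //; exact: mvt_bound hd hC.
by rewrite distrC [`|b - a|]distrC [`|a - b|]ger0_norm ?subr_ge0 //; exact: mvt_bound hd hC.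
Qed.

Section Families.
Variables (R : realType) (k : nat).
Local Notation V := 'rV[R]_k.
Local Notation e_ i := (delta_mx 0 i : V).

Definition in_box (u v w : V) :=
  forall j, Num.min (v 0 j) (u 0 j) <= w 0 j <= Num.max (v 0 j) (u 0 j).

Lemma in_box_dist (u v w c : V) r : in_box u v w ->
  `|c - u| <= r -> `|c - v| <= r -> `|c - w| <= r.
Proof.
move=> hb hu hv; apply/mxnormP => [|i j]; first exact: le_trans hu.
rewrite ord1 !mxE.
have := le_trans (coord_norm _ 0 j) hu; have := le_trans (coord_norm _ 0 j) hv.
rewrite !mxE !ler_norml; have := hb j.
by rewrite ge_min le_max => /andP[/orP[] ? /orP[] ?] /andP[? ?] /andP[? ?]; apply/andP; split; lra.
Qed.

(** The path from [v] to [u] changes one coordinate at a time, so each piece is a one-variable mean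
    value theorem for one partial derivative. It stays in the box spanned by [u] and [v], and a ball
    of the max norm containing both contains that box. *)
Lemma box_mvt (g : V -> R) (dg : 'I_k -> V -> R) (C : R) (u v : V) : 0 <= C ->
  (forall w i, in_box u v w -> is_derive w (e_ i) g (dg i w)) ->
  (forall w i, in_box u v w -> `|dg i w| <= C) ->
  `|g u - g v| <= k%:R * C * `|u - v|.
Proof.
move=> C0 hd hC.
pose z m : V := \row_j (if (j < m)%N then u 0 j else v 0 j).
have H m : (m <= k)%N -> `|g (z m) - g v| <= m%:R * C * `|u - v|.
  elim: m => [_|m IH mk].
    suff -> : z 0%N = v by rewrite subrr normr0 !mul0r.
    by apply/rowP => j; rewrite mxE.
  pose i := Ordinal mk.
  pose x : V := z m - v 0 i *: e_ i.
  have xE t j : (x + t *: e_ i) 0 j = if j == i then t else z m 0 j.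
    rewrite !mxE eqxx /=; case: eqP => [->|_]; last by rewrite !mulr0 subr0 addr0.
    by rewrite /= ltnn !mulr1 subrr add0r.
  have xm : x + v 0 i *: e_ i = z m by rewrite subrK.
  have xm1 : x + u 0 i *: e_ i = z m.+1.
    apply/rowP => j; rewrite xE !mxE ltnS [in RHS]leq_eqVlt -[(j == i)]/((j : nat) == m).
    by case: eqP => [jm|//] /=; congr (u 0 _); exact/val_inj.
  have xbox t : Num.min (v 0 i) (u 0 i) <= t <= Num.max (v 0 i) (u 0 i) ->
      in_box u v (x + t *: e_ i).
    move=> ht j; rewrite xE; case: eqP => [->|_] //; rewrite mxE.
    by case: ifP => _; rewrite ge_min le_max !lexx ?orbT.
  have step : `|g (z m.+1) - g (z m)| <= C * `|u - v|.
    rewrite -xm -xm1.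
    apply: le_trans (_ : C * `|u 0 i - v 0 i| <= _).
      apply: (@mvt_bound_sym _ (fun t => g (x + t *: e_ i)) (fun t => dg i (x + t *: e_ i))).
        by move=> t /xbox /(hd _ i) /is_derive_line.
      by move=> t /xbox /(hC _ i).
    rewrite ler_wpM2l //; have := coord_norm (u - v) 0 i; by rewrite !mxE.
  rewrite -(subrKA (g (z m))) (le_trans (ler_normD _ _)) // -natr1 !mulrDl mul1r addrC.
  by rewrite lerD // IH // ltnW.
have := H k (leqnn _); suff -> : z k = u by [].
by apply/rowP => j; rewrite mxE ltn_ord.
Qed.

(* [h s] is the iterated partial derivative of [h [::]] along the word [s]. Symmetry of mixed
   partials is neither assumed nor needed. *)
Definition jet_family (X : set V) (h : seq 'I_k -> V -> R) :=
  forall s u i, X u -> is_derive u (e_ i) (h s) (h (i :: s) u).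

Section OnBall.
Variables (c : V) (r : R) (h : seq 'I_k -> V -> R).
Let X := [set u : V | `|c - u| <= r].
Hypothesis hh : jet_family X h.

Lemma jet_lipschitz s C u v : 0 <= C -> X u -> X v ->
  (forall i w, X w -> `|h (i :: s) w| <= C) ->
  `|h s u - h s v| <= k%:R * C * `|u - v|.
Proof.
move=> C0 Xu Xv hC.
apply: (@box_mvt (h s) (fun i w => h (i :: s) w)) => // w i hb; have Xw := in_box_dist hb Xu Xv.
  exact: hh.
exact: hC.
Qed.

(** [box_mvt] applied to [h s] minus its linear part at [v]: the partial derivatives of the
    difference are increments of first derivatives, which [jet_lipschitz] bounds by the second
    ones. *)
Lemma jet_quad s C u v : 0 <= C -> X u -> X v ->
  (forall i j w, X w -> `|h (i :: j :: s) w| <= C) ->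
  `|h s u - h s v - \sum_i (u 0 i - v 0 i) * h (i :: s) v| <= k%:R ^+ 2 * C * `|u - v| ^+ 2.
Proof.
move=> C0 Xu Xv hC.
pose lin (w : V) := \sum_i w 0 i * h (i :: s) v.
have linE : \sum_i (u 0 i - v 0 i) * h (i :: s) v = lin u - lin v.
  by rewrite -sumrB; apply: eq_bigr => i _; rewrite mulrBl.
rewrite linE.
have -> : h s u - h s v - (lin u - lin v) = (h s u - lin u) - (h s v - lin v).
  by ring.
have -> : k%:R ^+ 2 * C * `|u - v| ^+ 2 = k%:R * (k%:R * C * `|u - v|) * `|u - v| by ring.
apply: (@box_mvt (fun w => h s w - lin w) (fun i w => h (i :: s) w - h (i :: s) v)).
- by rewrite !mulr_ge0.
- move=> w i hb; apply: is_deriveB; first exact/hh/(in_box_dist hb).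
  apply: is_derive_affine => d; rewrite -sumrB (bigD1 i) //= big1 => [|j ji].
    by rewrite !mxE !eqxx mulr1 addr0 -mulrBl addrK.
  by rewrite !mxE (negbTE ji) andbF mulr0 add0r subrr.
move=> w i hb; have Xw := in_box_dist hb Xu Xv.
apply: le_trans (_ : k%:R * C * `|w - v| <= _).
  by apply: jet_lipschitz => // j y; exact: hC.
rewrite ler_wpM2l ?mulr_ge0 // distrC; apply: (in_box_dist hb); rewrite distrC // subrr normr0 //.
Qed.

Lemma jet_line s C x w t : 0 <= C ->
  (forall i j y, X y -> `|h (i :: j :: s) y| <= C) ->
  `|c - (x + t *: w)| < r ->
  is_derive t 1 (fun t => h s (x + t *: w)) (\sum_i w 0 i * h (i :: s) (x + t *: w)).
Proof.
move=> C0 hC hx.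
set y := x + t *: w in hx *.
have w1 : 0 < `|w| + 1 by rewrite ltr_wpDl.
apply: (@is_derive_quad _ _ _ _ (k%:R ^+ 2 * C * `|w| ^+ 2) ((r - `|c - y|) / (`|w| + 1))).
  by rewrite divr_gt0 // subr_gt0.
move=> d; rewrite ltr_pdivlMr // => hd.
have -> : x + (t + d) *: w = y + d *: w by rewrite scalerDl addrA.
have Xd : X (y + d *: w).
  rewrite /X /= opprD addrA (le_trans (ler_normB _ _)) // normrZ.
  have := normr_ge0 d; move: hd; rewrite mulrDr mulr1; lra.
have := jet_quad (s := s) C0 Xd (ltW hx : X y) hC.
have -> : y + d *: w - y = d *: w by rewrite addrAC subrr add0r.
rewrite normrZ exprMn -normrX [`|d ^+ 2|]ger0_norm ?sqr_ge0 // => H.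
have -> : k%:R ^+ 2 * C * `|w| ^+ 2 * d ^+ 2 = k%:R ^+ 2 * C * (d ^+ 2 * `|w| ^+ 2) by ring.
apply: le_trans H; rewrite mulr_sumr le_eqVlt; apply/orP; left; apply/eqP; congr (`|_ - _|).
apply: eq_bigr => i _; rewrite !mxE; ring.
Qed.

End OnBall.

(** The derivative of the remainder is the remainder of the shifted sequence, which is at most [M]
    by induction; the mean value inequality on a segment of length at most 1 keeps the bound [M]. *)
Lemma taylor1 n : forall (phi : nat -> R -> R) (M : R),
  (forall j (t : R), (j < n)%N -> 0 <= t <= 1 -> is_derive t 1 (phi j) (phi j.+1 t)) ->
  (forall t : R, 0 <= t <= 1 -> `|phi n t| <= M) ->
  forall t : R, 0 <= t <= 1 -> `|phi 0%N t - \sum_(j < n) phi j 0 * (t ^+ j / j`!%:R)| <= M.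
Proof.
elim: n => [|n IH] phi M hd hM t ht; first by rewrite big_ord0 subr0; exact: hM.
pose F t := phi 0%N t - \sum_(j < n.+1) phi j 0 * (t ^+ j / j`!%:R).
pose dF t := phi 1%N t - \sum_(j < n) phi j.+1 0 * (t ^+ j / j`!%:R).
have F0 : F 0 = 0.
  rewrite /F big_ord_recl big1 => [|j _]; last by rewrite expr0n /= mul0r mulr0.
  by rewrite addr0 expr0 fact0 divr1 mulr1 subrr.
have M0 : 0 <= M by apply: le_trans (hM 0 _); rewrite ?lexx ?ler01.
move: (ht) => /andP[t0 t1].
have : `|F t - F 0| <= M * (t - 0).
  apply: (@mvt_bound _ F dF) => // y /andP[y0 yt]; have y1 : 0 <= y <= 1 by rewrite y0 (le_trans yt).
    apply: is_deriveB; first exact: hd.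
    have -> : \sum_(j < n) phi j.+1 0 * (y ^+ j / j`!%:R) =
      \sum_(j < n.+1) phi j 0 * ((j%:R * y ^+ j.-1) / j`!%:R).
      rewrite big_ord_recl /= !mul0r mulr0 add0r; apply: eq_bigr => j _.
      rewrite /bump /= add1n factS natrM; congr (_ * _).
      by rewrite invfM mulrACA mulfV ?pnatr_eq0 // mul1r.
    apply: is_derive_bigsum => j.
    apply: is_derive_cmul; rewrite mulrC.
    under eq_fun do rewrite mulrC.
    exact/is_derive_cmul/is_derive_pow.
  by apply: (IH (fun j => phi j.+1)) => // j x jn hx; exact: hd.
rewrite F0 !subr0 => /le_trans; apply; rewrite -[leRHS]mulr1; exact: ler_wpM2l.
Qed.

End Families.

(** * Taylor expansion *)

Lemma big_tupleS (W : nmodType) (T : finType) j (F : seq T -> W) :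
  \sum_(s : j.+1.-tuple T) F s = \sum_i \sum_(s : j.-tuple T) F (i :: s).
Proof.
rewrite pair_bigA /=.
rewrite (reindex (fun p : T * j.-tuple T => cons_tuple p.1 p.2)) //=.
exists (fun s => (thead s, behead_tuple s)) => [[i s] _|s _] /=.
  by congr pair; apply: val_inj.
by rewrite [RHS]tuple_eta; apply: val_inj.
Qed.

Section Taylor.
Variables (R : realType) (k : nat).
Local Notation V := 'rV[R]_k.
Local Notation e_ i := (delta_mx 0 i : V).
Variables (c : V) (r : R) (h : seq 'I_k -> V -> R).
Let X := [set u : V | `|c - u| <= r].
Hypothesis hh : jet_family X h.

Lemma segment_ball (x w : V) t : 0 <= t <= 1 ->
  `|c - x| < r -> `|c - (x + w)| < r -> `|c - (x + t *: w)| < r.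
Proof.
move=> /andP[t0 t1] hx hu.
have -> : c - (x + t *: w) = (1 - t) *: (c - x) + t *: (c - (x + w)).
  by apply/rowP => j; rewrite !mxE; ring.
apply: le_lt_trans (ler_normD _ _) _; rewrite !normrZ ger0_norm ?subr_ge0 // ger0_norm //.
have [->|tn] := eqVneq t 0; first by rewrite subr0 mul1r mul0r addr0.
have t0' : 0 < t by rewrite lt_def tn.
apply: (@lt_le_trans _ _ ((1 - t) * r + t * r)); last by rewrite -mulrDl subrK mul1r.
by rewrite ler_ltD ?ltr_pM2l // ler_wpM2l ?subr_ge0 // ltW.
Qed.

Lemma prod_coord_le (w : V) (s : seq 'I_k) : `|\prod_(i <- s) w 0 i| <= `|w| ^+ size s.
Proof.
elim: s => [|i s IH]; first by rewrite big_nil normr1 expr0.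
by rewrite big_cons normrM exprS ler_pM // coord_norm.
Qed.

(** [taylor1] along the segment from [x] to [u], with sums over words instead of multi-indices;
    there are [k ^ n] words in the remainder. Bounds up to order [n.+1] are required because
    [jet_line], applied to words of length at most n - 1, uses two more derivatives. *)
Lemma taylor n C x u : 0 <= C ->
  (forall s y, (size s <= n.+1)%N -> X y -> `|h s y| <= C) ->
  `|c - x| < r -> `|c - u| < r ->
  `|h [::] u - \sum_(j < n) (\sum_(s : j.-tuple 'I_k)
      h s x * \prod_(i <- s) (u - x) 0 i) / j`!%:R|
    <= k%:R ^+ n * C * `|u - x| ^+ n.
Proof.
move=> C0 hC hx hu; set w := u - x.
have uE : u = x + w by rewrite addrC subrK.
have Xt t : 0 <= t <= 1 -> `|c - (x + t *: w)| < r.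
  by move=> ht; apply: segment_ball => //; rewrite -uE.
pose phi j t := \sum_(s : j.-tuple 'I_k) (\prod_(i <- s) w 0 i) * h s (x + t *: w).
have H : `|phi 0%N 1 - \sum_(j < n) phi j 0 * (1 ^+ j / j`!%:R)| <= k%:R ^+ n * C * `|w| ^+ n.
  apply: (@taylor1 _ n phi); last by rewrite ler01 lexx.
    move=> j t jn ht.
    rewrite (_ : phi j.+1 t = \sum_(s : j.-tuple 'I_k) \sum_i
      (\prod_(i0 <- i :: s) w 0 i0) * h (i :: s) (x + t *: w)); last first.
      rewrite exchange_big /=.
      exact: (big_tupleS j (fun s => (\prod_(i <- s) w 0 i) * h s (x + t *: w))).
    apply: is_derive_bigsum => s.
    have -> : \sum_(i < k) (\prod_(i0 <- i :: s) w 0 i0) * h (i :: s) (x + t *: w) =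
      (\prod_(i <- s) w 0 i) * \sum_(i < k) w 0 i * h (i :: s) (x + t *: w).
      by rewrite mulr_sumr; apply: eq_bigr => i _; rewrite big_cons mulrCA mulrA.
    apply: is_derive_cmul; apply: (jet_line hh C0 _ (Xt t ht)) => i i' y.
    by apply: hC; rewrite /= size_tuple ltnS.
  move=> t ht; apply: le_trans (ler_norm_sum _ _ _) _.
  apply: le_trans (_ : \sum_(s : n.-tuple 'I_k) `|w| ^+ n * C <= _).
    apply: ler_sum => s _; rewrite normrM ler_pM //.
      by rewrite -[X in _ ^+ X](size_tuple s) prod_coord_le.
    by apply: hC; [rewrite size_tuple|exact/ltW/Xt].
  rewrite sumr_const card_tuple card_ord -[leLHS]mulr_natl natrX.
  by rewrite le_eqVlt; apply/orP; left; apply/eqP; ring.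
have p0 : phi 0%N 1 = h [::] u.
  rewrite /phi (big_pred1 [tuple]) => [|s]; last exact/esym/eqP/tuple0.
  by rewrite big_nil mul1r scale1r -uE.
rewrite p0 in H; congr (`|_ - _| <= _) : H; apply: eq_bigr => j _.
rewrite expr1n mul1r /phi scale0r addr0; congr (_ / _).
by apply: eq_bigr => s _; rewrite mulrC.
Qed.

Fixpoint iter_diff (d : R) (s : seq 'I_k) (f : V -> R) (x : V) : R :=
  if s is i :: s' then iter_diff d s' f (x + d *: e_ i) - iter_diff d s' f x else f x.

Lemma norm_shift (d : R) i : `|d *: e_ i| <= `|d|.
Proof.
apply/mxnormP => [//|a b]; rewrite !mxE normrM ler_piMr //.
by rewrite normr_nat lern1 leq_b1.
Qed.

Lemma dist_shift (x : V) (d : R) i : `|c - (x + d *: e_ i)| <= `|c - x| + `|d|.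
Proof.
rewrite opprD addrA; apply: le_trans (ler_normB _ _) _.
by rewrite lerD2l norm_shift.
Qed.

Lemma iter_diff_derive d s t x i : 0 <= d -> `|c - x| + (size s)%:R * d <= r ->
  is_derive x (e_ i) (iter_diff d s (h t)) (iter_diff d s (h (i :: t)) x).
Proof.
move=> d0; elim: s x => [|j s IH] x hx /=.
  by apply: hh; move: hx; rewrite mul0r addr0.
move: hx; rewrite /= -natr1 mulrDl mul1r => hx.
apply: is_deriveB; last by apply: IH; lra.
apply: is_derive_shifted; apply: IH.
apply: le_trans (lerD (dist_shift x d j) (lexx _)) _; rewrite ger0_norm //; lra.
Qed.

Lemma iter_diff_mvt d s t x : 0 < d -> `|c - x| + (size s)%:R * d <= r ->
  exists xi, `|xi - x| <= (size s)%:R * d /\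
    iter_diff d s (h t) x = d ^+ size s * h (rev s ++ t) xi.
Proof.
move=> d0; elim: s t x => [|i s IH] t x hx /=.
  by exists x; rewrite subrr normr0 mul0r expr0 mul1r.
move: hx; rewrite /= -natr1 mulrDl mul1r => hx.
have hz z : 0 <= z <= d -> `|c - (x + z *: e_ i)| + (size s)%:R * d <= r.
  move=> /andP[z0 zd]; apply: le_trans (lerD (dist_shift x z i) (lexx _)) _.
  rewrite ger0_norm //; lra.
pose f z := iter_diff d s (h t) (x + z *: e_ i).
have [z|z hz'|z] := @MVT_segment R f (fun z => iter_diff d s (h (i :: t)) (x + z *: e_ i)) 0 d (ltW d0).
- rewrite in_itv /= => /andP[/ltW z0 /ltW zd].
  by apply: is_derive_line; apply: iter_diff_derive; [exact: ltW|apply: hz; rewrite z0].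
- apply: derivable_within_continuous z hz' => z; rewrite in_itv /= => hzz.
  have : is_derive z 1 f (iter_diff d s (h (i :: t)) (x + z *: e_ i)).
    by apply: is_derive_line; apply: iter_diff_derive; [exact: ltW|exact: hz].
  by case.
rewrite in_itv /= => hzz; rewrite /f scale0r addr0 subr0 => ->.
have [xi [h1 ->]] := IH (i :: t) _ (hz z hzz).
exists xi; split; last first.
  by rewrite rev_cons cat_rcons exprS [d * _]mulrC mulrAC.
have -> : xi - x = (xi - (x + z *: e_ i)) + z *: e_ i by rewrite opprD addrA subrK.
by rewrite (le_trans (ler_normD _ _)) // lerD // (le_trans (norm_shift _ _)) // ger0_norm; case/andP: hzz.
Qed.

Lemma iter_diff_bound d s (f : V -> R) x M q : 0 <= d ->
  (forall y, `|y - x| <= q + (size s)%:R * d -> `|f y| <= M) ->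
  forall y, `|y - x| <= q -> `|iter_diff d s f y| <= 2 ^+ size s * M.
Proof.
move=> d0; elim: s q => [|i s IH] q hM y hy /=.
  by rewrite expr0 mul1r hM // mul0r addr0.
have IH' : forall y, `|y - x| <= q + d -> `|iter_diff d s f y| <= 2 ^+ size s * M.
  apply: IH => z hz; apply: hM; apply: le_trans hz _.
  by rewrite -natr1 mulrDl mul1r -addrA [d + _]addrC.
rewrite (le_trans (ler_normB _ _)) // exprS -mulrA mulr_natl mulr2n lerD // IH' //.
  rewrite addrAC (le_trans (ler_normD _ _)) // lerD //.
  by rewrite (le_trans (norm_shift _ _)) // ger0_norm.
by apply: le_trans hy _; rewrite lerDl.
Qed.

(* An iterated difference of step [d] of [h [::]] at [c] is [O(d ^ (D + 1))], and it is
   [d ^ |s|] times a value of [h s] near [c]. *)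
Lemma flat_jet0 D C L : 0 < r -> 0 <= C -> 0 <= L ->
  (forall s y, (size s <= D.+1)%N -> X y -> `|h s y| <= L) ->
  (forall u, X u -> `|h [::] u| <= C * `|u - c| ^+ D.+1) ->
  forall s, (size s <= D)%N -> h s c = 0.
Proof.
move=> r0 C0 L0 hL hC s sD; apply/eqP; rewrite -normr_le0.
set m := size s in sD.
pose K := 2 ^+ m * (C * m%:R ^+ D.+1) + k%:R * L * m%:R.
have K0 : 0 <= K by rewrite /K !(addr_ge0, mulr_ge0, exprn_ge0).
apply/ler_addgt0Pr => e e0; rewrite add0r.
(* At most 1, so that [d ^ (D+1) <= d ^ m * d] as [m <= D]; at most [r / (m + 1)], so that the
   m-fold difference stays in the ball; at most [e / (K + 1)] for the final estimate. *)
pose d := Num.min 1 (Num.min (r / (m%:R + 1)) (e / (K + 1))).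
have d0 : 0 < d by rewrite !lt_min ltr01 !divr_gt0 // ltr_wpDl.
have d1 : d <= 1 by rewrite ge_min lexx.
have dr : m%:R * d <= r.
  apply: le_trans (_ : (m%:R + 1) * d <= _); first by rewrite ler_wpM2r ?lerDl // ltW.
  by rewrite mulrC -ler_pdivlMr ?ltr_wpDl // !ge_min lexx orbT.
have de : K * d <= e.
  apply: le_trans (_ : (K + 1) * d <= _); first by rewrite ler_wpM2r ?lerDl // ltW.
  by rewrite mulrC -ler_pdivlMr ?ltr_wpDl // !ge_min lexx !orbT.
have [|xi [hxi E]] := @iter_diff_mvt d (rev s) [::] c d0.
  by rewrite size_rev subrr normr0 add0r.
rewrite revK cats0 size_rev -/m in hxi E.
have Xc : X c by rewrite /X /= subrr normr0 ltW.
have Xxi : X xi by rewrite /X /= distrC (le_trans hxi).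
have h1 : `|h s xi| <= 2 ^+ m * (C * m%:R ^+ D.+1) * d.
  rewrite -(ler_pM2l (exprn_gt0 m d0)) -{1}[d ^+ m]ger0_norm ?exprn_ge0 ?(ltW d0) // -normrM -E.
  have := @iter_diff_bound d (rev s) (h [::]) c (C * (m%:R * d) ^+ D.+1) 0 (ltW d0).
  rewrite size_rev -/m add0r => /(_ _ c).
  rewrite subrr normr0 lexx => H.
  apply: le_trans (H _ isT) _ => [y hy|].
    apply: le_trans (hC _ _) _; first by rewrite /X /= distrC (le_trans hy).
    by rewrite ler_wpM2l // lerXn2r ?nnegrE // mulr_ge0 // ltW.
  rewrite exprMn [C * (_ * _)]mulrA mulrA [leRHS]mulrC -[leRHS]mulrA -exprS.
  rewrite ler_wpM2l ?mulr_ge0 ?exprn_ge0 // ?ler0n //.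
  by rewrite ler_wiXn2l // ltW.
have h2 : `|h s c - h s xi| <= k%:R * L * (m%:R * d).
  apply: le_trans (jet_lipschitz hh L0 Xc Xxi _) _; first by move=> i y; exact: hL.
  by rewrite ler_wpM2l ?mulr_ge0 // distrC.
rewrite -(subrK (h s xi) (h s c)) (le_trans (ler_normD _ _)) // (le_trans _ de) //.
by rewrite /K mulrDl addrC lerD // -mulrA.
Qed.

End Taylor.

(** * Determinants of Taylor expansions *)

Lemma det_norm_le (R : realType) n (A : 'M[R]_n) (C : R) :
  (forall i j, `|A i j| <= C) -> `|\det A| <= n`!%:R * C ^+ n.
Proof.
move=> hA; rewrite /determinant (le_trans (ler_norm_sum _ _ _)) //.
apply: le_trans (_ : \sum_(s : 'S_n) C ^+ n <= _); last first.
  by rewrite sumr_const card_Sn mulr_natl.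
apply: ler_sum => s _; rewrite normrM normrX normrN1 expr1n mul1r normr_prod.
by rewrite -[X in C ^+ X]card_ord -prodr_const; apply: ler_prod => i _; rewrite normr_ge0 /=.
Qed.

(** Multilinearity in the rows: [f] chooses one term for each row. A choice that repeats a term
    gives two equal rows, so only injective choices survive. *)
Lemma det_sum_expand (R : realType) n (T : finType) (A : 'M[R]_n)
    (c : T -> 'I_n -> R) (r : T -> 'I_n -> R) :
  (forall i j, A i j = \sum_t c t i * r t j) ->
  \det A = \sum_(f : {ffun 'I_n -> T} | injectiveb f)
     (\prod_i c (f i) i) * \det (\matrix_(i, j) r (f i) j).
Proof.
move=> hA.
transitivity (\sum_(f : {ffun 'I_n -> T})
     (\prod_i c (f i) i) * \det (\matrix_(i, j) r (f i) j)).
  rewrite /determinant.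
  under eq_bigr => s _ do under eq_bigr => i _ do rewrite hA.
  under eq_bigr => s _ do rewrite bigA_distr_bigA /= mulr_sumr.
  rewrite exchange_big /=; apply: eq_bigr => f _.
  rewrite mulr_sumr; apply: eq_bigr => s _.
  by rewrite big_split /= mulrCA; do 2![congr (_ * _)]; apply: eq_bigr => i _; rewrite mxE.
rewrite (bigID (fun f : {ffun 'I_n -> T} => injectiveb f)) /= [X in _ + X]big1 ?addr0 //.
move=> f /injectivePn [i1 [i2 ne e]].
by rewrite (determinant_alternate ne) ?mulr0 // => j; rewrite !mxE e.
Qed.

Lemma det_small (R : realType) n (T : finType) (A : 'M[R]_n)
    (c : T -> 'I_n -> R) (r : T -> 'I_n -> R) (wt : T -> nat) (Q rho : R) N :
  0 <= Q -> 0 <= rho <= 1 ->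
  (forall i j, A i j = \sum_t c t i * r t j) ->
  (forall t i, `|c t i| <= Q * rho ^+ wt t) ->
  (forall t j, `|r t j| <= Q) ->
  (forall f : {ffun 'I_n -> T}, injective f -> (N <= \sum_i wt (f i))%N) ->
  `|\det A| <= (#|{ffun 'I_n -> T}|%:R * (Q ^+ n * (n`!%:R * Q ^+ n))) * rho ^+ N.
Proof.
move=> Q0 /andP[rho0 rho1] hA hc hr hN; rewrite (det_sum_expand hA).
apply: le_trans (ler_norm_sum _ _ _) _.
apply: le_trans (_ : \sum_(f : {ffun 'I_n -> T} | injectiveb f)
   Q ^+ n * rho ^+ N * (n`!%:R * Q ^+ n) <= _).
  apply: ler_sum => f /injectiveP finj; rewrite normrM ler_pM //.
    apply: le_trans (_ : Q ^+ n * rho ^+ (\sum_i wt (f i))%N <= _).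
      rewrite normr_prod -[X in Q ^+ X]card_ord -prodr_const expr_sum -big_split /=.
      by apply: ler_prod => i _; rewrite normr_ge0 /=.
    by rewrite ler_wpM2l ?exprn_ge0 // ler_wiXn2l // hN.
  by apply: det_norm_le => i j; rewrite mxE.
apply: le_trans (_ : \sum_(f : {ffun 'I_n -> T})
   Q ^+ n * rho ^+ N * (n`!%:R * Q ^+ n) <= _).
  rewrite [leRHS](bigID (fun f : {ffun 'I_n -> T} => injectiveb f)) /= lerDl.
  by apply: sumr_ge0 => f _; rewrite !mulr_ge0 ?exprn_ge0 ?ler0n.
by rewrite sumr_const -mulr_natl le_eqVlt; apply/orP; left; apply/eqP; ring.
Qed.

(** * Counting monomials: the least total weight of distinct columns *)

Lemma bracket0 k : bracket k 0 = 1%N. Proof. by rewrite /bracket bin0. Qed.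
Lemma bracket1 k : (0 < k)%N -> bracket k.-1 1 = k.
Proof. by move=> k0; rewrite /bracket bin1 addn1 prednK. Qed.

Lemma n_kdP k d : (0 < k)%N -> (k <= d)%N ->
  (0 < n_kd k d)%N /\ (dim_upto k (n_kd k d) <= d)%N.
Proof.
move=> k0 kd; have d1 : (1 < d.+1)%N by rewrite ltnS (leq_trans k0).
have P1 : (0 < Ordinal d1)%N && (dim_upto k (Ordinal d1) <= d)%N.
  by rewrite /= /dim_upto big_geq // addn0.
rewrite /n_kd (@bigop.bigmax_eq_arg _ (Ordinal d1)
  (fun n : 'I_d.+1 => (0 < n)%N && (dim_upto k n <= d)%N) (fun n => nat_of_ord n) P1).
by case: arg_maxnP => //= i /andP[].
Qed.

(* A monomial of degree [j] is the sorted word of its variables. *)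
Definition monomial k j := {t : j.-tuple 'I_k | sorted leq (map val t)}.

Lemma card_monomial k j : (0 < k)%N -> #|{: monomial k j}| = bracket k.-1 j.
Proof.
case: k => // k _; rewrite card_sig /bracket addnC -card_sorted_tuples.
by apply: eq_card => t; rewrite !inE.
Qed.

(* Terms of the Taylor expansion of a row: the monomials of degree at most [n], and one
   remainder per coordinate. *)
Definition column k d n := ({j : 'I_n.+1 & monomial k j} + 'I_d.+1)%type.

Definition weight k d n (t : column k d n) : nat :=
  match t with inl p => tag p | inr _ => n.+1 end.

Lemma sum_inj_codom (I T : finType) (f : I -> T) (G : T -> nat) : injective f ->
  (\sum_i G (f i) = \sum_(t in codom f) G t)%N.
Proof.
move=> finj; have u : uniq (codom f) by rewrite map_inj_uniq ?enum_uniq.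
rewrite -big_uniq //=.
by rewrite /codom big_image.
Qed.

(** Count the deficits [n.+1 - weight] instead of the weights. Remainders have deficit 0, so the
    deficits of distinct columns add up to at most that of all monomials of degree at most [n],
    however many remainders are chosen. Subtracting this from (d + 1)(n + 1) leaves exactly
    [N_kd k d]. *)
Lemma weight_inj_sum k d (f : 'I_d.+1 -> column k d (n_kd k d)) :
  (0 < k)%N -> (k <= d)%N -> injective f ->
  (N_kd k d <= \sum_i weight (f i))%N.
Proof.
move=> k0 kd finj; have [n0 nd] := n_kdP k0 kd.
set n := n_kd k d in f finj n0 nd *.
have wle t : (@weight k d n t <= n.+1)%N by case: t => [p|e] //=; rewrite ltnW.
have H1 : (\sum_i (n.+1 - weight (f i)) <= \sum_(j < n.+1) (n.+1 - j) * bracket k.-1 j)%N.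
  rewrite (sum_inj_codom (fun t => n.+1 - weight t)%N finj).
  apply: leq_trans (_ : \sum_(t : column k d n) (n.+1 - weight t) <= _)%N.
    by rewrite [leqRHS](bigID (fun t => t \in codom f)) /= leq_addr.
  rewrite big_sumType /= [X in (_ + X)%N]big1 => [|e _]; last by rewrite subnn.
  rewrite addn0 -(sig_big_dep xpredT (fun=> xpredT) (fun (j : 'I_n.+1) (_ : monomial k j) => n.+1 - j)%N) /=.
  apply: leq_sum => j _; rewrite sum_nat_const mulnC leq_mul2l.
  by rewrite -(card_monomial j k0) leqnn orbT.
have H2 : (\sum_i weight (f i) + \sum_i (n.+1 - weight (f i)) = d.+1 * n.+1)%N.
  rewrite -big_split /= (eq_bigr (fun=> n.+1)) ?sum_nat_const ?card_ord // => i _.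
  by rewrite subnKC.
have H3 : (\sum_(j < n.+1) (n.+1 - j) * bracket k.-1 j + \sum_(j < n.+1) j * bracket k.-1 j
   = n.+1 * \sum_(j < n.+1) bracket k.-1 j)%N.
  rewrite -big_split /= big_distrr /=; apply: eq_bigr => j _.
  by rewrite -mulnDl subnK // ltnW.
have split_sum (F : nat -> nat) : (\sum_(j < n.+1) F j = F 0 + F 1 + \sum_(2 <= j < n.+1) F j)%N.
  rewrite -(big_mkord xpredT) big_ltn // big_ltn // addnA //.
have B : (\sum_(j < n.+1) bracket k.-1 j = (dim_upto k n).+1)%N.
  by rewrite split_sum bracket0 bracket1 // /dim_upto -addnA add1n.
have W : (\sum_(j < n.+1) j * bracket k.-1 j = k + \sum_(2 <= j < n.+1) j * bracket k.-1 j)%N.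
  by rewrite (split_sum (fun j => j * bracket k.-1 j)%N) mul0n mul1n bracket1 // add0n.
rewrite /N_kd -/n -W /m_kd -/n.
rewrite B in H3; set S := (\sum_i weight (f i))%N in H2 *.
set a := (\sum_(j < n.+1) (n.+1 - j) * _)%N in H1 H3.
set b := (\sum_(j < n.+1) j * _)%N in H3 *.
set e := (\sum_i (n.+1 - _))%N in H1 H2.
have : (n.+1 * (d - dim_upto k n) + n.+1 * (dim_upto k n).+1 = d.+1 * n.+1)%N.
  by rewrite -mulnDr addnS subnK // mulnC.
lia.
Qed.

Section DetTaylor.
Variables (R : realType) (k d : nat).
Hypotheses (k_gt0 : (0 < k)%N) (kd : (k <= d)%N).
Local Notation V := 'rV[R]_k.

Definition sort_monomial j (s : j.-tuple 'I_k) : monomial k j.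
Proof.
exists (sort_tuple (fun a b : 'I_k => (a <= b)%N) s).
by rewrite sorted_map; apply: sort_sorted => a b; exact: leq_total.
Defined.

(** Words with the same sorted form have the same product of coordinates. Grouping them makes the
    terms of a row indexed by monomials; counting words instead would give a smaller power of the
    radius in the determinant. *)
Lemma sum_by_monomial j (w : V) (F : seq 'I_k -> R) :
  \sum_(s : j.-tuple 'I_k) F s * \prod_(i <- s) w 0 i =
  \sum_(t : monomial k j) (\prod_(i <- sval t) w 0 i) *
     \sum_(s : j.-tuple 'I_k | sort_monomial s == t) F s.
Proof.
rewrite (partition_big (@sort_monomial j) xpredT) //=; apply: eq_bigr => t _.
rewrite mulr_sumr; apply: eq_bigr => s /eqP <-; rewrite mulrC; congr (_ * _).
by apply: perm_big; rewrite perm_sym /= perm_sort.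
Qed.

Variables (c : V) (r C : R) (h : 'I_d.+1 -> seq 'I_k -> V -> R).
Let X := [set u : V | `|c - u| <= r].
Hypothesis hh : forall e, jet_family X (h e).
Hypothesis C_ge0 : 0 <= C.
Hypothesis hC : forall e s y, (size s <= (n_kd k d).+2)%N -> X y -> `|h e s y| <= C.

Lemma det_taylor : exists2 K, 0 < K & forall rho x (u : 'I_d.+1 -> V),
  0 <= rho <= 1 -> `|c - x| < r -> (forall i, `|c - u i| < r) ->
  (forall i, `|u i - x| <= rho) ->
  `|\det (\matrix_(i, e) h e [::] (u i))| <= K * rho ^+ N_kd k d.
Proof.
set n := n_kd k d.
(* Dominates the Taylor remainder constant, the grouped derivative sums and the entries of the unit
   vectors in [rr]. *)
pose Q : R := k%:R ^+ n.+1 * C + 1.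
have k1 : 1 <= k%:R :> R by rewrite ler1n.
have Q1 : 1 <= Q by rewrite lerDr mulr_ge0 ?exprn_ge0.
have Q0 : 0 <= Q by exact: le_trans Q1.
exists (#|{ffun 'I_d.+1 -> column k d n}|%:R * (Q ^+ d.+1 * (d.+1`!%:R * Q ^+ d.+1)) + 1).
  by rewrite ltr_wpDl // !mulr_ge0 ?exprn_ge0 // ler0n.
move=> rho x u hrho hx hu hux; have /andP[rho0 rho1] := hrho.
pose T e i : R := \sum_(j < n.+1) (\sum_(s : j.-tuple 'I_k)
      h e s x * \prod_(a <- s) (u i - x) 0 a) / j`!%:R.
pose cc (t : column k d n) (i : 'I_d.+1) : R := match t with
  | inl p => \prod_(a <- sval (tagged p)) (u i - x) 0 a
  | inr e => h e [::] (u i) - T e i end.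
(* The remainder of each coordinate multiplies a unit vector, so remainders of different coordinates
   are different terms, all of weight [n.+1]. *)
pose rr (t : column k d n) (e : 'I_d.+1) : R := match t with
  | inl p => (\sum_(s : (tag p).-tuple 'I_k | sort_monomial s == tagged p) h e s x) / (tag p)`!%:R
  | inr e' => (e == e')%:R end.
have := @det_small R d.+1 (column k d n) (\matrix_(i, e) h e [::] (u i)) cc rr
  (@weight k d n) Q rho (N_kd k d) Q0 hrho.
move=> H; apply: le_trans (H _ _ _ _) _; last first.
- by rewrite ler_wpM2r ?exprn_ge0 // lerDl.
- by move=> f /weight_inj_sum; exact.
- case=> [p|e'] e /=; last by rewrite (le_trans _ Q1) // normr_nat lern1 leq_b1.
  rewrite normrM normfV normr_nat ler_pdivrMr ?ltr0n ?fact_gt0 //.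
  apply: le_trans (_ : k%:R ^+ n.+1 * C <= _); last first.
    apply: le_trans (_ : Q * 1 <= _); first by rewrite mulr1 lerDl.
    by rewrite ler_wpM2l // ler1n fact_gt0.
  apply: le_trans (ler_norm_sum _ _ _) _.
  apply: le_trans (_ : \sum_(s : (tag p).-tuple 'I_k) C <= _).
    rewrite [leRHS](bigID (fun s => sort_monomial s == tagged p)) /=.
    rewrite -[leLHS]addr0 lerD ?sumr_ge0 //; apply: ler_sum => s _.
    apply: hC; last exact: ltW.
    by rewrite size_tuple (leq_trans (ltnW (ltn_ord (tag p)))).
  rewrite sumr_const card_tuple card_ord -[leLHS]mulr_natl natrX ler_wpM2r //.
  by rewrite ler_weXn2l // ltnW.
- case=> [p|e] i /=.
    apply: le_trans (prod_coord_le _ _) _; rewrite size_tuple -[leLHS]mul1r ler_pM ?exprn_ge0 //.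
    by rewrite lerXn2r ?nnegrE.
  have := @taylor R k c r (h e) (hh e) n.+1 C x (u i) C_ge0 (hC e) hx (hu i).
  move/le_trans; apply; rewrite ler_pM ?mulr_ge0 ?exprn_ge0 //; first by rewrite lerDl.
  by rewrite lerXn2r ?nnegrE.
move=> i e; rewrite mxE big_sumType /=.
rewrite [X in _ = _ + X](bigD1 e) //= eqxx mulr1 [X in _ = _ + (_ + X)]big1 ?addr0; last first.
  by move=> e' /negbTE ne; rewrite eq_sym ne mulr0.
suff -> : T e i = \sum_(p : {j : 'I_n.+1 & monomial k j}) (\prod_(a <- sval (tagged p)) (u i - x) 0 a) *
  ((\sum_(s : (tag p).-tuple 'I_k | sort_monomial s == tagged p) h e s x) / (tag p)`!%:R).
  by rewrite addrC subrK.
rewrite -(sig_big_dep xpredT (fun=> xpredT) (fun (j : 'I_n.+1) (t : monomial k j) =>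
   (\prod_(a <- sval t) (u i - x) 0 a) *
  ((\sum_(s : j.-tuple 'I_k | sort_monomial s == t) h e s x) / j`!%:R))) /=.
apply: eq_bigr => j _; rewrite (sum_by_monomial j (u i - x) (fun s => h e s x)).
by rewrite mulr_suml; apply: eq_bigr => t _; rewrite mulrA.
Qed.

End DetTaylor.

(** * Avoiding zero sets *)

Section Avoidance.
Variables (R : realType) (k : nat) (beta : R).
Hypotheses (k_gt0 : (0 < k)%N) (beta_gt0 : 0 < beta) (beta_le1 : beta <= 1).
Local Notation V := 'rV[R]_k.
Local Notation e_ i := (delta_mx 0 i : V).

(** Alice deletes the zero hyperplane of the linearization of [h s] at the centre. Points within
    [beta * b.2 / 2] of Bob's next ball stay that far from it, so the linearization is at least
    [beta * b.2 * L / 2] there, and the quadratic error is at most half of this. *)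
Lemma linear_move (c : V) (r : R) (h : seq 'I_k -> V -> R) (b : V * R) s i0 C2 L :
  jet_family [set u | `|c - u| <= r] h -> 0 <= C2 -> 0 < b.2 ->
  (forall u, `|u - b.1| <= 2 * b.2 -> `|c - u| <= r) ->
  (forall i j w, `|c - w| <= r -> `|h (i :: j :: s) w| <= C2) ->
  0 < L -> L <= `|h (i0 :: s) b.1| ->
  k%:R ^+ 2 * C2 * (2 * b.2) ^+ 2 <= beta * b.2 * L / 4 ->
  exists2 A, affine_hyperplane A & forall b', legal beta b A b' ->
    forall u' u, cball b' u' -> `|u - u'| <= beta * b.2 / 2 ->
      beta * b.2 * L / 4 <= `|h s u|.
Proof.
move=> hh C20 b0 hb hC L0 hL hsmall.
pose a : 'cV[R]_k := \col_i h (i :: s) b.1.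
pose lin (u : V) := h s b.1 + \sum_i (u 0 i - b.1 0 i) * h (i :: s) b.1.
have ai0 : 0 < `|a i0 0| by rewrite mxE (lt_le_trans L0).
have ai0' : a i0 0 != 0 by rewrite -normr_gt0.
have linE u : lin u = (u *m a) 0 0 - ((b.1 *m a) 0 0 - h s b.1).
  rewrite /lin (_ : \sum_i _ = (u *m a) 0 0 - (b.1 *m a) 0 0); first by ring.
  by rewrite !mxE -sumrB; apply: eq_bigr => i _; rewrite !mxE; ring.
exists [set u | (u *m a) 0 0 = (b.1 *m a) 0 0 - h s b.1].
  exists a, ((b.1 *m a) 0 0 - h s b.1); split=> //.
  by apply: contra_neq ai0' => ->; rewrite mxE.
move=> b' hl u' u hu' huu'.
have hlin : beta * b.2 / 2 * L <= `|lin u|.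
  (* Moving [u] along the coordinate with the large derivative reaches the deleted hyperplane after
     a distance [|lin u| / |a i0 0|]. *)
  pose p : V := u - (lin u / a i0 0) *: e_ i0.
  have Ap : (p *m a) 0 0 = (b.1 *m a) 0 0 - h s b.1.
    rewrite /p mulmxBl -scalemxAl -rowE [LHS]mxE [X in _ + X]mxE [X in _ - X]mxE.
    by rewrite [X in _ - _ * X]mxE divfK // linE; ring.
  have := legal_far beta_gt0 b0 hl hu' Ap => hfar.
  have hp : `|u - p| <= `|lin u| / `|a i0 0|.
    rewrite /p opprB addrC subrK normrZ normrM normfV ler_piMr ?mulr_ge0 ?invr_ge0 //.
    apply/mxnormP => [|x y]; rewrite ?ler01 // mxE.
    by rewrite normr_nat lern1 leq_b1.
  have h2 : beta * b.2 / 2 < `|lin u| / `|a i0 0|.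
    have := ler_normD (u' - u) (u - p); rewrite addrA subrK [`|u' - u|]distrC => h3.
    have := le_lt_trans (le_trans h3 (lerD huu' hp)); lra.
  rewrite ltr_pdivlMr // in h2; apply: le_trans (ltW h2).
  by rewrite ler_wpM2l ?mxE // divr_ge0 // mulr_ge0 // ltW.
have hux : `|u - b.1| <= 2 * b.2.
  have hu'b : `|b.1 - u'| <= b.2 by apply/cballP/(legal_sub hl).
  have -> : u - b.1 = (u - u') - (b.1 - u') by rewrite opprB addrA subrK.
  apply: le_trans (ler_normB _ _) _; apply: le_trans (lerD huu' hu'b) _.
  have : beta * b.2 <= b.2 by rewrite ler_piMl // ltW.
  lra.
have Xb : `|c - b.1| <= r by apply: hb; rewrite subrr normr0 mulr_ge0 // ltW.
have := jet_quad (s := s) hh C20 (hb _ hux) Xb hC.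
have -> : h s u - h s b.1 - \sum_i (u 0 i - b.1 0 i) * h (i :: s) b.1 = h s u - lin u.
  by rewrite /lin opprD addrA.
move=> hq.
have hq' : `|h s u - lin u| <= beta * b.2 * L / 4.
  apply: le_trans hq _; apply: le_trans hsmall.
  by rewrite ler_wpM2l ?mulr_ge0 ?sqr_ge0 // lerXn2r ?nnegrE // mulr_ge0 // ltW.
have := ler_normB (h s u) (h s u - lin u); rewrite opprB addrC subrK.
move: hlin hq'; rewrite [beta * b.2 / 2 * L]mulrAC; lra.
Qed.

Variable D : nat.

(** Zeros are excluded from a neighbourhood of [b'], not only from [b']: a rational point outside
    Bob's ball can still be close to the final point. The same [q] bounds the new radius below, so
    the loss per stage is a fixed factor. *)
Definition avoids (g : V -> R) (b : V * R) (q : R) (b' : V * R) : Prop :=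
  [/\ cball b' `<=` cball b, 0 < b'.2, q <= b'.2 &
    forall u' u, cball b' u' -> `|u - u'| <= q -> g u != 0].

(* Induction on [s]: where [h (i :: s)] is bounded below, the zero set of [h s] in a small
   ball is close to the hyperplane where its linearization vanishes. *)
Lemma avoid_descent (E : R) : 0 <= E -> forall m l mu, 0 < l -> 0 < mu ->
  exists2 gam, 0 < gam & forall (c : V) r (h : seq 'I_k -> V -> R) A0 b s,
   0 < r -> 0 < A0 -> jet_family [set u | `|c - u| <= r] h ->
   (forall t u, (size t <= D.+1)%N -> `|c - u| <= r -> r ^+ size t * `|h t u| <= E * A0) ->
   (size s <= m)%N -> (size s <= D)%N -> cball b `<=` [set u | `|c - u| <= r / 2] ->
   0 < b.2 -> mu * r <= b.2 ->
   (forall u' u, cball b u' -> `|u - u'| <= mu * r -> l * A0 <= r ^+ size s * `|h s u|) ->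
   force beta (avoids (h [::]) b (gam * r)) b.
Proof.
move=> E0; elim=> [|m IH] l mu l0 mu0.
  exists mu => // c r h A0 b [|//] r0 A00 hh hE _ _ hb b0 hmu hl.
  apply: force_now; split=> // u' u hu' hu.
  have := hl u' u hu' hu; rewrite expr0 mul1r => H.
  by rewrite -normr_gt0 (lt_le_trans _ H) // mulr_gt0.
(* The smallness condition of [linear_move] reads [kE * b1.2 <= beta * l * r] after scaling: 16 is
   the square of the 2 in [2 * b.2] times the denominator 4. The bound 1 / 4 on [eps] keeps points
   within [2 * b1.2] of the new centre inside the ball of radius [r]. *)
pose kE : R := 16 * k%:R ^+ 2 * E.
have kE0 : 0 <= kE by rewrite !mulr_ge0 ?exprn_ge0.
have kE1 : 0 < kE + 1 by rewrite ltr_wpDl.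
pose eps := Num.min (1 / 4) (beta * l / (kE + 1)).
have eps0 : 0 < eps by rewrite lt_min !divr_gt0 // mulr_gt0.
have eps4 : eps <= 1 / 4 by rewrite ge_min lexx.
have epsE : kE * eps <= beta * l.
  apply: le_trans (_ : (kE + 1) * eps <= _); first by rewrite ler_wpM2r ?lerDl // ltW.
  by rewrite mulrC -ler_pdivlMr // ge_min lexx orbT.
pose mu1 := Num.min mu (beta * eps).
have mu10 : 0 < mu1 by rewrite lt_min mu0 mulr_gt0.
(* These are what [linear_move] leaves for the shorter word, a lower bound and a margin, when the
   shrunk radius is at least [mu1 * r]. *)
have [||gam gam0 hgam] := IH (beta * mu1 * l / 4) (beta * mu1 / 2).
- by rewrite divr_gt0 // !mulr_gt0.
- by rewrite divr_gt0 // mulr_gt0.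
exists (Num.min mu gam); first by rewrite lt_min mu0.
move=> c r h A0 b s r0 A00 hh hE sm sD hb b0 hmu hl.
case: s sm sD hl => [|i0 s] /= sm sD hl.
  have ler : Num.min mu gam * r <= mu * r by rewrite ler_wpM2r ?ge_min ?lexx // ltW.
  apply: force_now; split=> //; first exact: le_trans hmu.
  move=> u' u hu' hu; have := hl u' u hu' (le_trans hu ler); rewrite expr0 mul1r => H.
  by rewrite -normr_gt0 (lt_le_trans _ H) // mulr_gt0.
apply: (force_bind (force_shrink beta_gt0 k_gt0 (mulr_gt0 eps0 r0) b0)) => b1 [sub1 b10 le1 ge1].
have hmu1 : mu1 * r <= b1.2.
  apply: le_trans ge1; rewrite le_min; apply/andP; split.
    by apply: le_trans hmu; rewrite ler_wpM2r ?ge_min ?lexx // ltW.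
  by rewrite mulrA ler_wpM2r ?ge_min ?lexx ?orbT // ltW.
pose C2 := E * A0 / r ^+ (size s).+2.
pose L := l * A0 / r ^+ (size s).+1.
have rn n : 0 < r ^+ n by rewrite exprn_gt0.
have L0 : 0 < L by rewrite divr_gt0 // mulr_gt0.
have C20 : 0 <= C2 by exact: divr_ge0 (mulr_ge0 E0 (ltW A00)) (ltW (rn _)).
have b1b : cball b b1.1 by apply/sub1/cball_center.
have [|||||A hA hmove] := @linear_move c r h b1 s i0 C2 L hh C20 b10.
- move=> u hu; have h1 : `|c - b1.1| <= r / 2 by apply: hb.
  rewrite -(subrKA b1.1) (le_trans (ler_normD _ _)) // [`|b1.1 - u|]distrC.
  apply: le_trans (lerD h1 hu) _.
  have : eps * r <= 1 / 4 * r by rewrite ler_wpM2r // ltW.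
  by move: le1; lra.
- move=> i j w hw; rewrite ler_pdivlMr // mulrC.
  by have := hE (i :: j :: s) w; apply.
- by [].
- rewrite ler_pdivrMr // [leRHS]mulrC; apply: (hl b1.1) => //.
  by rewrite subrr normr0 mulr_ge0 // ltW.
- have -> : beta * b1.2 * L / 4 = (beta * l * r) * (b1.2 * A0 / (4 * r ^+ (size s).+2)).
    by rewrite /L !exprS; field; rewrite !gt_eqF.
  have -> : k%:R ^+ 2 * C2 * (2 * b1.2) ^+ 2 = (kE * b1.2) * (b1.2 * A0 / (4 * r ^+ (size s).+2)).
    by rewrite /C2 /kE !exprS; field; rewrite !gt_eqF.
  have w0 : 0 <= b1.2 * A0 / (4 * r ^+ (size s).+2).
    by apply/ltW/(divr_gt0 (mulr_gt0 b10 A00)); exact: (mulr_gt0 _ (rn _)).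
  rewrite ler_wpM2r //; apply: le_trans (_ : kE * (eps * r) <= _); first by rewrite ler_wpM2l.
  by rewrite mulrA ler_wpM2r // ltW.
apply: (force_move hA) => b2 b20 hl2.
have sub2 : cball b2 `<=` cball b by move=> u /(legal_sub hl2) /sub1.
have hF : force beta (avoids (h [::]) b2 (gam * r)) b2.
  apply: (hgam c r h A0 b2 s) => //.
  - exact: ltnW.
  - by move=> u /sub2 /hb.
  - apply: le_trans hl2.2; apply: le_trans (_ : beta * (mu1 * r) <= _); last first.
      by rewrite ler_pM2l.
    have : 0 < beta * (mu1 * r) by rewrite !mulr_gt0.
    by rewrite mulrAC -mulrA; lra.
  move=> u' u hu' hu.
  have hu2 : `|u - u'| <= beta * b1.2 / 2.
    apply: le_trans hu _; rewrite mulrAC ler_pM2r ?invr_gt0 // -mulrA ler_pM2l //.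
  have H := hmove b2 hl2 u' u hu' hu2.
  rewrite -(ler_pM2l (rn (size s))) in H; apply: le_trans H.
  have -> : r ^+ size s * (beta * b1.2 * L / 4) = beta * b1.2 * l * A0 / (4 * r).
    by rewrite /L !exprS; field; rewrite !gt_eqF.
  rewrite ler_pdivlMr ?mulr_gt0 //.
  have -> : beta * mu1 * l / 4 * A0 * (4 * r) = (beta * l * A0) * (mu1 * r) by field.
  have -> : beta * b1.2 * l * A0 = (beta * l * A0) * b1.2 by ring.
  by rewrite ler_wpM2l // !mulr_ge0 // ltW.
apply: (force_bind hF) => b3 [s3 b30 le3 hz3].
have lem : Num.min mu gam * r <= gam * r by rewrite ler_wpM2r ?ge_min ?lexx ?orbT // ltW.
apply: force_now; split=> //.
- by move=> u /s3 /sub2.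
- exact: le_trans le3.
- move=> u' u hu' hu; apply: (hz3 u' u hu'); exact: le_trans hu lem.
Qed.

(** Control of derivatives on a ball [Theta] times larger than Bob's makes the dominant derivative
    [s0] nearly constant on the double of Bob's ball. It stays above half its value at [x], and
    [avoid_descent] starts from there. *)
Lemma avoid_zeros : exists Theta gam : R, [/\ 4 <= Theta, 0 < gam &
  forall (x : V) rho (h : seq 'I_k -> V -> R) A0 s0, let r := Theta * rho in
   0 < rho -> 0 < A0 -> jet_family [set u | `|x - u| <= r] h ->
   (forall t, (size t <= D)%N -> r ^+ size t * `|h t x| <= A0) ->
   (forall t u, size t = D.+1 -> `|x - u| <= r -> r ^+ D.+1 * `|h t u| <= A0) ->
   (size s0 <= D)%N -> r ^+ size s0 * `|h s0 x| = A0 ->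
   force beta (avoids (h [::]) (x, rho) (gam * rho)) (x, rho)].
Proof.
(* Integrating from [x] to pass from one order to the order below multiplies the scaled bound by at
   most [1 + k]. *)
pose E : R := (1 + k%:R) ^+ D.+1.
have k1 : 1 <= k%:R :> R by rewrite ler1n.
have E1 : 1 <= E by rewrite exprn_ege1 // lerDl.
have E0 : 0 <= E by exact: le_trans E1.
(* The scaled derivative along [s0] varies by at most [k * E * A0 * (2 * rho / r)], which is
   [A0 / 2] for this ratio [r / rho]. *)
pose Th := 4 * (k%:R * E).
have kE1 : 1 <= k%:R * E by rewrite -[leLHS]mulr1 ler_pM.
have Th4 : 4 <= Th by rewrite /Th; lra.
have Th0 : 0 < Th by apply: lt_le_trans Th4.
have [||gam gam0 hgam] := @avoid_descent E E0 D (1 / 2) (1 / Th); rewrite ?divr_gt0 //.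
exists Th, (gam * Th); split=> //; first exact: mulr_gt0.
move=> x rho h A0 s0 r rho0 A00 hh hx hD s0D hs0.
have r0 : 0 < r by exact: mulr_gt0.
have xx : `|x - x| <= r by rewrite subrr normr0 ltW.
have hE : forall t u, (size t <= D.+1)%N -> `|x - u| <= r -> r ^+ size t * `|h t u| <= E * A0.
  suff H n : (n <= D.+1)%N -> forall t u, size t = (D.+1 - n)%N -> `|x - u| <= r ->
     r ^+ size t * `|h t u| <= (1 + k%:R) ^+ n * A0.
    move=> t u ht hu; have := H (D.+1 - size t)%N (leq_subr _ _) t u.
    rewrite subKn // => /(_ erefl hu) /le_trans; apply.
    by rewrite ler_wpM2r ?(ltW A00) // ler_weXn2l ?lerDl // leq_subr.
  elim: n => [_ t u|n IH nD t u st hu].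
    by rewrite subn0 => st hu; rewrite st expr0 mul1r; exact: hD.
  have nD' := ltnW nD; have {}IH := IH nD'.
  have st' : (size t).+1 = (D.+1 - n)%N by rewrite st subnSK.
  have tD : (size t <= D)%N by rewrite st subSS leq_subr.
  set B := (1 + k%:R) ^+ n * A0 in IH *.
  have B0 : 0 <= B by rewrite mulr_ge0 ?exprn_ge0 ?(ltW A00) // addr_ge0.
  have A0B : A0 <= B by rewrite ler_peMl ?(ltW A00) // exprn_ege1 // lerDl.
  have rt : 0 < r ^+ size t by rewrite exprn_gt0.
  have rt1 : 0 < r ^+ (size t).+1 by rewrite exprn_gt0.
  have hl : `|h t u - h t x| <= k%:R * (B / r ^+ (size t).+1) * `|u - x|.
    apply: (jet_lipschitz hh) => // [|i w hw]; first by rewrite divr_ge0 // ltW.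
    by rewrite ler_pdivlMr // mulrC; have := IH (i :: t) w; apply.
  have : r ^+ size t * `|h t u - h t x| <= k%:R * B.
    rewrite mulrC -ler_pdivlMr //; apply: le_trans hl _.
    apply: le_trans (_ : k%:R * (B / r ^+ (size t).+1) * r <= _).
      have w0 : 0 <= k%:R * (B / r ^+ (size t).+1).
        by apply: mulr_ge0 => //; exact: divr_ge0 B0 (ltW rt1).
      by rewrite ler_wpM2l // distrC.
    rewrite exprS le_eqVlt; apply/orP; left; apply/eqP; field.
    by rewrite !gt_eqF.
  move=> h1; have h2 := hx t tD.
  apply: le_trans (_ : r ^+ size t * (`|h t u - h t x| + `|h t x|) <= _).
    rewrite ler_wpM2l ?(ltW rt) // -{1}(subrK (h t x) (h t u)); exact: ler_normD.
  rewrite mulrDr exprS -mulrA -/B; apply: le_trans (lerD h1 h2) _.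
  by rewrite mulrDl mul1r addrC lerD2r.
have hmu : 1 / Th * r = rho by rewrite /r mul1r mulKf // gt_eqF.
have H := hgam x r h A0 (x, rho) s0 r0 A00 hh hE s0D s0D.
rewrite -mulrA -/r; apply: H => //=.
- move=> u /cballP /= hu; apply: le_trans hu _.
  rewrite ler_pdivlMr // mulrC ler_wpM2r ?(ltW rho0) //; apply: le_trans Th4; lra.
- by rewrite hmu.
move=> u' u /cballP /= hu'; rewrite hmu => huu'.
have hu : `|u - x| <= 2 * rho.
  have -> : u - x = (u - u') - (x - u') by rewrite opprB addrA subrK.
  apply: le_trans (ler_normB _ _) _; apply: le_trans (lerD huu' hu') _; lra.
have Xu : `|x - u| <= r.
  rewrite distrC (le_trans hu) // ler_wpM2r ?(ltW rho0) //; apply: le_trans Th4; lra.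
have rt : 0 < r ^+ size s0 by rewrite exprn_gt0.
have rt1 : 0 < r ^+ (size s0).+1 by rewrite exprn_gt0.
have EA : 0 <= E * A0 by rewrite mulr_ge0 // ltW.
have hl : `|h s0 u - h s0 x| <= k%:R * (E * A0 / r ^+ (size s0).+1) * `|u - x|.
  apply: (jet_lipschitz hh) => // [|i w hw]; first by rewrite divr_ge0 // ltW.
  by rewrite ler_pdivlMr // mulrC; have := hE (i :: s0) w; apply.
have h1 : r ^+ size s0 * `|h s0 u - h s0 x| <= A0 / 2.
  rewrite mulrC -ler_pdivlMr //; apply: le_trans hl _.
  apply: le_trans (_ : k%:R * (E * A0 / r ^+ (size s0).+1) * (2 * rho) <= _).
    apply: (ler_wpM2l _ hu); apply: mulr_ge0 => //.
    exact: divr_ge0 EA (ltW rt1).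
  have -> : k%:R * (E * A0 / r ^+ (size s0).+1) * (2 * rho) =
    (4 * (k%:R * E) * rho) * (A0 / 2 / r ^+ (size s0).+1).
    by field; rewrite gt_eqF.
  rewrite -/Th -/r exprS le_eqVlt; apply/orP; left; apply/eqP; field.
  by rewrite !gt_eqF.
have : r ^+ size s0 * `|h s0 x| <= r ^+ size s0 * `|h s0 u - h s0 x| + r ^+ size s0 * `|h s0 u|.
  rewrite -mulrDr ler_wpM2l ?(ltW rt) // addrC.
  rewrite {1}(_ : h s0 x = h s0 u - (h s0 u - h s0 x)); last by ring.
  exact: ler_normB.
by rewrite hs0; move: h1; lra.
Qed.

End Avoidance.

(** * Hyperplanes and rational points *)

(** Take a matrix with rows in [S] of maximal rank. Rank [n] would give a square selection of rows
    with nonzero determinant. Otherwise every element of [S] lies in the row space, by maximality,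
    and a nonzero column of the cokernel kills it. *)
Lemma common_hyperplane (F : fieldType) n (S : set 'rV[F]_n) :
  (forall f : 'I_n -> 'rV[F]_n, (forall i, S (f i)) -> \det (\matrix_i f i) = 0) ->
  exists2 a : 'cV[F]_n, a != 0 & forall x, S x -> x *m a = 0.
Proof.
move=> hS.
pose P r := exists m (A : 'M[F]_(m, n)), (forall i, S (row i A)) /\ \rank A = r.
have P0 : exists r, `[< P r >].
  by exists 0%N; apply/asboolP; exists 0%N, 0; split=> [[]//|]; rewrite mxrank0.
have Pn r : `[< P r >] -> (r <= n)%N.
  by move=> /asboolP [m [A [_ <-]]]; exact: rank_leq_col.
case: (ex_maxnP P0 Pn) => r /asboolP [m [A [SA rA]]] rmax.
have rn : (r < n)%N.
  rewrite ltn_neqAle Pn ?andbT; last by apply/asboolP; exists m, A.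
  apply/eqP => rn.
  have fA : row_full A by rewrite /row_full rA rn.
  have := fullrowsub_unit fA; rewrite unitmxE.
  rewrite (_ : rowsub _ A = \matrix_i row (fullrankfun fA i) A).
    by rewrite hS ?unitr0.
  by apply/matrixP => i j; rewrite !mxE.
have : cokermx A != 0 by rewrite -mxrank_eq0 mxrank_coker rA subn_eq0 -ltnNge.
case/matrix0Pn => i [j ij]; exists (col j (cokermx A)).
  by apply/eqP => /matrixP /(_ i 0); rewrite mxE [RHS]mxE => /eqP; rewrite (negbTE ij).
move=> x Sx.
have : (x <= A)%MS.
  have sub : (A <= col_mx x A)%MS by rewrite -addsmxE addsmxSr.
  have rk : (\rank (col_mx x A) <= r)%N.
    apply: rmax; apply/asboolP; exists (1 + m)%N, (col_mx x A); split=> // l.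
    case: (split_ordP l) => l' ->; rewrite ?rowKu ?rowKd //.
    by rewrite (_ : row l' x = x) //; apply/rowP => o; rewrite mxE ord1.
  have := (mxrank_leqif_sup sub).2; rewrite eqn_leq rA rk -{1}rA mxrankS //=.
  by move=> /esym; apply: submx_trans; rewrite -addsmxE addsmxSl.
by case/submxP => y ->; rewrite -mulmxA colE (mulmxA A) mulmx_coker mul0mx mulmx0.
Qed.

(** * Representatives of projective points, and heights *)

Section Lines.
Variables (R : realType) (d : nat).
Local Notation W := 'rV[R]_d.+1.

Lemma represents_neq0 (x : W) p : represents x p -> x != 0.
Proof.
rewrite /represents; case: p => L /= /eqP dL E.
by apply/eqP => x0; move: dL; rewrite E x0 dim_vline eqxx.
Qed.

Lemma vline_scale (x : W) c : c != 0 -> <[c *: x]>%VS = <[x]>%VS.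
Proof.
move=> c0; apply/eqP; rewrite eqEsubv -!memvE; apply/andP; split.
  by rewrite memvZ // memv_line.
by rewrite -[X in X \in _](scalerK c0) memvZ // memv_line.
Qed.

Lemma represents_scale (x : W) c p : c != 0 -> represents x p -> represents (c *: x) p.
Proof. by move=> c0; rewrite /represents vline_scale. Qed.

Lemma represents_exists (p : proj_space R d) : exists x : W, represents x p.
Proof.
case: p => L dL; exists (vpick L); rewrite /represents /=.
apply/eqP; rewrite eq_sym eqEdim -memvE memv_pick (eqP dL) dim_vline.
by rewrite vpick0 -dimv_eq0 (eqP dL).
Qed.

Lemma represents_colinear (x y : W) p : represents x p -> represents y p ->
  exists2 c, c != 0 & y = c *: x.
Proof.
move=> hx hy; have y0 := represents_neq0 hy.
have : y \in <[x]>%VS by rewrite -hx hy memv_line.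
case/vlineP => c yE; exists c => //.
by apply: contra_neq y0 => c0; rewrite yE c0 scale0r.
Qed.

Lemma represents_inj (x : W) p q : represents x p -> represents x q -> p = q.
Proof. by rewrite /represents => <- /val_inj. Qed.

Lemma gcd_primitive (z : 'rV[int]_d.+1) : z != 0 ->
  exists2 g : nat, (0 < g)%N & exists2 z' : 'rV[int]_d.+1, primitive z' & z = g%:Z *: z'.
Proof.
move=> z0; set g := \big[gcdn/0%N]_i absz (z 0 i).
have gdvd i : (g %| absz (z 0%R i))%N.
  by rewrite /g (bigD1 i) //= dvdn_gcdl.
have g0 : (0 < g)%N.
  rewrite lt0n; apply: contra_neq z0 => g0; apply/rowP => i.
  by have := gdvd i; rewrite g0 dvd0n absz_eq0 => /eqP ->; rewrite mxE.
exists g => //; exists (\row_i (z 0%R i %/ g%:Z)%Z); last first.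
  apply/rowP => i; rewrite !mxE mulrC divzK //.
  by rewrite dvdzE.
apply/eqP/eqP; rewrite -(eqn_pmul2l g0) muln1.
rewrite (big_morph (muln g) (muln_gcdr g) (muln0 g)) -/g; apply/eqP.
apply: eq_bigr => i _; rewrite mxE -[X in (X * _)%N](absz_nat g) -abszM mulrC divzK //.
by rewrite dvdzE.
Qed.

(** [xget] returns an element of the set of heights once the set is inhabited. A primitive
    representative is obtained by clearing denominators and dividing by the gcd. *)
Lemma rational_height (p : proj_space R d) : rational_points p ->
  exists2 z : 'rV[int]_d.+1, represents (map_mx intr z : W) p &
    H_std p = `|map_mx intr z : W|.
Proof.
move=> [q hq].
suff [z [z1 z2 z3]] : exists z : 'rV[int]_d.+1,
    [/\ primitive z, represents (map_mx intr z : W) p & H_std p = `|map_mx intr z : W|].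
  by exists z.
have q0 : q != 0.
  by apply: contra_neq (represents_neq0 hq) => ->; rewrite map_mx0.
pose N := \prod_i denq (q 0 i).
have N0 : N != 0 by apply/prodf_neq0 => i _; exact: denq_neq0.
pose y : 'rV[int]_d.+1 := \row_i (numq (q 0 i) * \prod_(j | j != i) denq (q 0 j)).
have yE : map_mx intr y = N%:~R *: q.
  apply/rowP => i; rewrite !mxE.
  have -> : N = denq (q 0 i) * \prod_(j | j != i) denq (q 0 j) by rewrite /N (bigD1 i).
  have qd : q 0 i * (denq (q 0 i))%:~R = (numq (q 0 i))%:~R.
    by rewrite -{1}[q 0 i]divq_num_den divfK // intr_eq0 denq_neq0.
  by rewrite !intrM [RHS]mulrC [RHS]mulrA qd.
have y0 : y != 0.
  apply/eqP => yy; move/eqP: yE; rewrite yy map_mx0 eq_sym scaler_eq0 intr_eq0.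
  by rewrite (negbTE N0) (negbTE q0).
have [g g0 [z zp yz]] := gcd_primitive y0.
have zE : (map_mx intr z : W) = (N%:~R / g%:R) *: map_mx ratr q.
  have : map_mx ratr (map_mx intr y) = N%:~R *: (map_mx ratr q : W).
    by rewrite yE map_mxZ rmorph_int.
  rewrite mulrC -scalerA => <-; apply/rowP => i.
  rewrite [LHS]mxE mxE [X in _ * X]mxE [X in ratr X]mxE ratr_int yz mxE intrM.
  by rewrite mulrA mulVf ?mul1r // pnatr_eq0 -lt0n.
have hz : represents (map_mx intr z : W) p.
  rewrite zE; apply: represents_scale => //.
  by rewrite mulf_neq0 ?invr_eq0 ?intr_eq0 // pnatr_eq0 -lt0n.
have := @xgetPex _ 0 [set h | exists z : 'rV[int]_d.+1,
    let zR : 'rV[R]_d.+1 := map_mx intr z in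
    [/\ primitive z, represents zR p & h = `|zR|]].
by move=> /(_ (ex_intro _ _ (ex_intro _ z (And3 zp hz erefl)))).
Qed.

Lemma height_ge1 (p : proj_space R d) : rational_points p -> 1 <= H_std p :> R.
Proof.
move=> /rational_height [z hz ->].
have /matrix0Pn [i [j zij]] := represents_neq0 hz.
apply: le_trans (coord_norm _ i j); rewrite mxE.
move: zij; rewrite mxE intr_eq0 => zij.
by rewrite -intr_norm -[1]/(1%:~R) ler_int -gtz0_ge1 normr_gt0.
Qed.

Lemma det_int_ge1 n (z : 'M[int]_n) : \det (map_mx intr z : 'M[R]_n) != 0 ->
  1 <= `|\det (map_mx intr z : 'M[R]_n)|.
Proof.
rewrite det_map_mx intr_eq0 => zij.
by rewrite -intr_norm -[1]/(1%:~R) ler_int -gtz0_ge1 normr_gt0.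
Qed.

End Lines.

(** * Riemannian distance *)

Section MatrixLimits.
Context (R : realType) (T : Type) (F : set_system T) {FF : Filter F}.

Lemma cvg_bigsum (I : Type) (r : seq I) (f : I -> T -> R) (l : I -> R) :
  (forall i, f i x @[x --> F] --> l i) ->
  (\sum_(i <- r) f i x) @[x --> F] --> \sum_(i <- r) l i.
Proof.
move=> h; elim: r => [|i r IH].
  by under eq_fun do rewrite big_nil; rewrite big_nil; exact: cvg_cst.
under eq_fun do rewrite big_cons; rewrite big_cons.
exact: cvgD.
Qed.

Lemma cvg_entries m n (M : T -> 'M[R]_(m, n)) (L : 'M[R]_(m, n)) :
  (M x @[x --> F] --> L) <-> (forall i j, M x i j @[x --> F] --> L i j).
Proof.
split=> [h i j|h].
  apply: (@cvg_comp _ _ _ M (fun A : 'M[R]_(m, n) => A i j) F (nbhs L) _ h).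
  exact: coord_continuous.
apply/cvgrPdist_le => e e0; near=> x.
apply/mxnormP => [|i j]; first exact: ltW.
rewrite !mxE; move: i j; near: x.
have H (i : 'I_m) : \forall x \near F, forall j, `|L i j - M x i j| <= e.
  by apply: filter_forall => j; exact: ((cvgrPdist_le _ _).1 (h i j)).
exact: filter_forall.
Unshelve. all: by end_near. Qed.

Lemma cvg_mulmx m n p (A : T -> 'M[R]_(m, n)) (B : T -> 'M[R]_(n, p))
    (a : 'M[R]_(m, n)) (b : 'M[R]_(n, p)) :
  A x @[x --> F] --> a -> B x @[x --> F] --> b ->
  (A x *m B x) @[x --> F] --> a *m b.
Proof.
move=> /cvg_entries hA /cvg_entries hB; apply/cvg_entries => i j.
rewrite mxE; under eq_fun do rewrite mxE.
by apply: cvg_bigsum => l; exact: cvgM.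
Qed.

Lemma cvg_trmx m n (A : T -> 'M[R]_(m, n)) (a : 'M[R]_(m, n)) :
  A x @[x --> F] --> a -> (A x)^T @[x --> F] --> a^T.
Proof.
move=> /cvg_entries hA; apply/cvg_entries => i j.
by rewrite mxE; under eq_fun do rewrite mxE; exact: hA.
Qed.

End MatrixLimits.

(** * Orthogonal projectors onto lines *)

Section Projector.
Variables (R : realType) (n : nat).
Local Notation W := 'rV[R]_n.

Definition dot (x y : W) : R := (x *m y^T) 0 0.

Lemma dotE x y : dot x y = \sum_i x 0 i * y 0 i.
Proof. by rewrite /dot mxE; apply: eq_bigr => i _; rewrite mxE. Qed.

Lemma mul_dot x y : x *m y^T = (dot x y)%:M.
Proof. by rewrite [LHS]mx11_scalar. Qed.

Lemma dotC x y : dot x y = dot y x.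
Proof. by rewrite !dotE; apply: eq_bigr => i _; rewrite mulrC. Qed.

Lemma dotZl c x y : dot (c *: x) y = c * dot x y.
Proof. by rewrite /dot -scalemxAl mxE. Qed.

Lemma dotZr c x y : dot x (c *: y) = c * dot x y.
Proof. by rewrite dotC dotZl dotC. Qed.

Lemma dotBr x y z : dot x (y - z) = dot x y - dot x z.
Proof. by rewrite !dotE -sumrB; apply: eq_bigr => i _; rewrite !mxE mulrBr. Qed.

Lemma sqr_norm_le_dot (x : W) i : x 0 i ^+ 2 <= dot x x.
Proof.
by rewrite dotE (bigD1 i) //= -expr2 lerDl sumr_ge0 // => j _; rewrite -expr2 sqr_ge0.
Qed.

Lemma dot_ge0 x : 0 <= dot x x.
Proof. by rewrite dotE sumr_ge0 // => j _; rewrite -expr2 sqr_ge0. Qed.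

Lemma norm_sqr_le_dot (x : W) : `|x| ^+ 2 <= dot x x.
Proof.
rewrite -[leRHS]sqr_sqrtr ?dot_ge0 // lerXn2r ?nnegrE ?sqrtr_ge0 //.
apply/mxnormP => [|i j]; first exact: sqrtr_ge0.
by rewrite ord1 -sqrtr_sqr ler_wsqrtr // sqr_norm_le_dot.
Qed.

Lemma dot_gt0 (x : W) : x != 0 -> 0 < dot x x.
Proof.
by move=> x0; apply: lt_le_trans (norm_sqr_le_dot x); rewrite exprn_gt0 ?normr_gt0.
Qed.

Lemma dot_le_norm (x : W) : dot x x <= n%:R * `|x| ^+ 2.
Proof.
rewrite dotE -[X in X%:R]card_ord mulr_natl -sumr_const; apply: ler_sum => i _.
by rewrite -expr2 -real_normK ?num_real // lerXn2r ?nnegrE // coord_norm.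
Qed.

(* A function of the line spanned by [y] only; its entries separate the points of projective
   space. *)
Definition proj (y : W) : 'M[R]_n := (dot y y)^-1 *: (y^T *m y).

Lemma projE (y : W) i j : proj y i j = y 0 i * y 0 j / dot y y.
Proof. by rewrite /proj mxE mxE big_ord1 mxE mulrC. Qed.

Lemma proj_scale c (y : W) : c != 0 -> proj (c *: y) = proj y.
Proof.
move=> c0; apply/matrixP => i j; rewrite !projE !mxE dotZl dotZr.
by rewrite mulrACA [c * (c * _)]mulrA -mulf_div divff ?mul1r // mulf_neq0.
Qed.

Lemma mul_proj (x y : W) : x *m proj y = (dot x y / dot y y) *: y.
Proof.
by rewrite /proj -scalemxAr mulmxA mul_dot mul_scalar_mx scalerA mulrC.
Qed.

Lemma proj_id (y : W) : y != 0 -> y *m proj y = y.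
Proof. by move=> y0; rewrite mul_proj divff ?scale1r // gt_eqF // dot_gt0. Qed.

Lemma dot_cvg (T : Type) (F : set_system T) (f h : T -> W) (a b : W) : Filter F ->
  f x @[x --> F] --> a -> h x @[x --> F] --> b -> dot (f x) (h x) @[x --> F] --> dot a b.
Proof.
move=> FF hf hh.
have hd : f x *m (h x)^T @[x --> F] --> a *m b^T.
  by apply: cvg_mulmx => //; exact: cvg_trmx.
by move/cvg_entries : hd; apply.
Qed.

Lemma proj_cvg (T : Type) (F : set_system T) (f : T -> W) (a : W) : Filter F -> a != 0 ->
  f x @[x --> F] --> a -> proj (f x) @[x --> F] --> proj a.
Proof.
move=> FF a0 hf; apply/cvg_entries => i j; rewrite projE; under eq_fun do rewrite projE.
have he := (cvg_entries f a).1 hf.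
apply: cvgM; first by apply: cvgM; exact: he.
apply: cvgV; first by rewrite gt_eqF // dot_gt0.
exact: dot_cvg.
Qed.

End Projector.

Lemma represents_proj (R : realType) d (x y : 'rV[R]_d.+1) p :
  represents x p -> represents y p -> proj x = proj y.
Proof. by move=> hx /(represents_colinear hx) [c c0 ->]; rewrite proj_scale. Qed.

Section Metric.
Variables (R : realType) (d : nat) (g : 'rV[R]_d.+1 -> 'M[R]_d.+1).
Hypothesis hg : riemannian g.
Local Notation W := 'rV[R]_d.+1.

Definition quad (y w : W) : R := (w *m g y *m w^T) 0 0.

Lemma g_cont (y : W) : y != 0 -> g x @[x --> y] --> g y.
Proof. by move=> y0; have h := riemannian_smooth hg; have [_] := h [::] y y0. Qed.

Lemma quad_cvg (T : Type) (F : set_system T) (f h : T -> W) (a b : W) : Filter F ->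
  a != 0 -> f x @[x --> F] --> a -> h x @[x --> F] --> b ->
  quad (f x) (h x) @[x --> F] --> quad a b.
Proof.
move=> FF a0 hf hh.
have hg' : g (f x) @[x --> F] --> g a.
  exact: (@cvg_comp _ _ _ f g F (nbhs a) _ hf (g_cont a0)).
have hd : h x *m g (f x) *m (h x)^T @[x --> F] --> b *m g a *m b^T.
  by apply: cvg_mulmx; [exact: cvg_mulmx|exact: cvg_trmx].
by move/cvg_entries : hd; apply.
Qed.

Lemma quad_ge0 y w : y != 0 -> 0 <= quad y w.
Proof.
move=> y0; have [|/(riemannian_pos hg y0)/ltW //] := boolP (w \in <[y]>%VS).
by case/vlineP => c ->; rewrite /quad -scalemxAl riemannian_radical // scaler0 mul0mx mxE.
Qed.

(* On pairs of unit vectors [quad y w + <y, w>^2] is positive, hence bounded below. *)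
Lemma quad_lower : exists2 c : R, 0 < c & forall y w : W, y != 0 -> dot y w = 0 ->
  c * dot w w <= dot y y * quad y w.
Proof.
pose S : set W := [set y | `|y| = 1].
have Sn0 y : S y -> y != 0 by move=> h; rewrite -normr_gt0 h ltr01.
have cS : compact S.
  apply: bounded_closed_compact.
    by exists 1; split; rewrite ?num_real // => M M1 y /= ->; exact: ltW.
  apply: (@preimage_closed _ _ (fun y : W => `|y|) [set 1 : R]).
    by move=> y _; exact: norm_continuous.
  exact: closed_eq.
pose G (p : W * W) := quad p.1 p.2 + dot p.1 p.2 ^+ 2.
have Gpos p : (S `*` S) p -> 0 < G p.
  case: p => y w [/= /Sn0 y0 /Sn0 w0]; rewrite /G /=.
  have [|/(riemannian_pos hg y0) q0] := boolP (w \in <[y]>%VS); last first.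
    by apply: (ltr_pwDl q0); rewrite sqr_ge0.
  case/vlineP => c wE; rewrite ltr_wpDl ?quad_ge0 // wE dotZr.
  rewrite exprn_even_gt0 //=; apply: mulf_neq0; last by rewrite gt_eqF // dot_gt0.
  by apply: contra_neq w0 => c0; rewrite wE c0 scale0r.
have Gc : {within S `*` S, continuous G}.
  apply: continuous_in_subspaceT => -[y w]; rewrite inE => -[/= /Sn0 y0 _].
  have c1 : p.1 @[p --> (y, w)] --> y by exact: cvg_fst.
  have c2 : p.2 @[p --> (y, w)] --> w by exact: cvg_snd.
  apply: cvgD; first exact: quad_cvg.
  have h2 : dot p.1 p.2 @[p --> (y, w)] --> dot y w by exact: dot_cvg.
  rewrite expr2 (_ : (fun p : W * W => _) = (fun p : W * W => dot p.1 p.2 * dot p.1 p.2)).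
    exact: (cvgM h2 h2).
  by apply: funext => p; rewrite expr2.
have S0 : (S `*` S) !=set0.
  have : `|const_mx 1 : W| = 1.
    apply/eqP; rewrite eq_le; apply/andP; split.
      by apply/mxnormP => // i j; rewrite mxE normr1.
    by have := coord_norm (const_mx 1 : W) 0 (0 : 'I_d.+1); rewrite mxE normr1.
  by move=> h; exists (const_mx 1, const_mx 1).
have [p pS pmin] := compact_EVT_min S0 (compact_setX cS cS) Gc.
rewrite inE in pS; have c0 := Gpos p pS.
exists (G p / d.+1%:R); first by rewrite divr_gt0.
move=> y w y0 yw.
have [->|w0] := eqVneq w 0.
  by rewrite /dot trmx0 mulmx0 mxE mulr0 mulr_ge0 ?dot_ge0 ?quad_ge0.
have ny : 0 < `|y| by rewrite normr_gt0.
have nw : 0 < `|w| by rewrite normr_gt0.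
have : G p <= G (`|y|^-1 *: y, `|w|^-1 *: w).
  apply: pmin; rewrite inE; split; rewrite /S /= normrZ normfV normr_id mulVf // gt_eqF //.
have gy : g (`|y|^-1 *: y) = `|y| ^+ 2 *: g y.
  rewrite -(riemannian_dilation hg (a := `|y|^-1) y0) ?invr_eq0 ?gt_eqF //.
  by rewrite scalerA -exprMn mulfV ?gt_eqF // expr1n scale1r.
have qE : quad (`|y|^-1 *: y) (`|w|^-1 *: w) = `|y| ^+ 2 * quad y w / `|w| ^+ 2.
  have tZ : (`|w|^-1 *: w)^T = `|w|^-1 *: w^T by apply/matrixP => a b; rewrite !mxE.
  rewrite /quad gy tZ -scalemxAr -scalemxAl -scalemxAr -!scalemxAl !scalerA [LHS]mxE.
  by field; rewrite gt_eqF.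
rewrite /G /= dotZl dotZr yw !mulr0 expr0n addr0 qE => H.
apply: le_trans (_ : G p / d.+1%:R * (d.+1%:R * `|w| ^+ 2) <= _).
  by rewrite ler_wpM2l ?dot_le_norm // divr_ge0 // ltW.
rewrite mulrA divfK ?pnatr_eq0 // -ler_pdivlMr ?exprn_gt0 //.
apply: le_trans H _.
rewrite ler_wpM2r ?invr_ge0 ?exprn_ge0 //.
by rewrite ler_wpM2r ?quad_ge0 // norm_sqr_le_dot.
Qed.

(** The derivative at [y] in the direction [w] of the entry [y_i y_j / <y, y>] of the projector, by
    the quotient rule. *)
Definition dproj (y w : W) i j : R :=
  (w 0 i * y 0 j + y 0 i * w 0 j) / dot y y - y 0 i * y 0 j * (2 * dot y w) / (dot y y * dot y y).

(** Both sides depend only on the component [v] of [w] orthogonal to [y]: the projector is constant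
    along the line, and the line is the radical of the metric. [quad_lower] compares them on [v]. *)
Lemma dproj_le : exists2 C : R, 0 < C & forall y w i j, y != 0 ->
  `|dproj y w i j| <= C * Num.sqrt (quad y w).
Proof.
have [c c0 hc] := quad_lower.
exists (Num.sqrt (4 / c)); first by rewrite sqrtr_gt0 divr_gt0.
move=> y w i j y0; have N0 := dot_gt0 y0; set N := dot y y in N0.
pose tau := dot y w / N; pose v := w - tau *: y.
have yv : dot y v = 0.
  by rewrite dotBr dotZr -/N divfK ?subrr // gt_eqF.
have qv : quad y v = quad y w.
  have yg : y *m g y = 0 by exact: riemannian_radical.
  have gy : g y *m y^T = 0 by rewrite -[g y]riemannian_sym // -trmx_mul yg trmx0.
  rewrite /quad /v mulmxBl -scalemxAl yg scaler0 subr0 linearB /= linearZ /= mulmxBr.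
  by rewrite -scalemxAr -[w *m _ *m y^T]mulmxA gy mulmx0 scaler0 subr0.
have -> : dproj y w i j = (v 0 i * y 0 j + y 0 i * v 0 j) / N.
  by rewrite /dproj -/N /v /tau !mxE; field; rewrite gt_eqF.
rewrite -sqrtrM ?divr_ge0 ?(ltW c0) // -sqrtr_sqr ler_wsqrtr //.
have := hc y v y0 yv; rewrite -/N qv => H.
have H1 : `|v 0 i * y 0 j + y 0 i * v 0 j| <= 2 * (`|v| * `|y|).
  rewrite (le_trans (ler_normD _ _)) // !normrM mulr_natl mulr2n lerD //.
    by rewrite ler_pM ?coord_norm.
  by rewrite mulrC ler_pM ?coord_norm.
have H2 : (v 0 i * y 0 j + y 0 i * v 0 j) ^+ 2 <= 4 * (dot v v * N).
  rewrite -real_normK ?num_real //.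
  apply: le_trans (_ : (2 * (`|v| * `|y|)) ^+ 2 <= _).
    by rewrite lerXn2r ?nnegrE // !mulr_ge0.
  rewrite !exprMn -natrX ler_pM2l // ler_pM ?exprn_ge0 ?norm_sqr_le_dot //.
rewrite exprMn exprVn ler_pdivrMr ?exprn_gt0 //; apply: le_trans H2 _.
have -> : 4 / c * quad y w * N ^+ 2 = 4 * (N * quad y w / c * N) by field; rewrite gt_eqF.
rewrite ler_pM2l // ler_wpM2r ?(ltW N0) // ler_pdivlMr // mulrC //.
Qed.

Lemma proj_curve_derive (gamma : R -> W) t i j : derivable gamma t 1 -> gamma t != 0 ->
  is_derive t 1 (fun s => proj (gamma s) i j) (dproj (gamma t) (derive1 gamma t) i j).
Proof.
move=> hd g0.
have he l : is_derive t 1 (fun s => gamma s 0 l) (derive1 gamma t 0 l).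
  split; first exact: ((derivable_mxP _ _ _).1 hd).
  by rewrite derive1E derive_mx // mxE.
have N0 := dot_gt0 g0.
under eq_fun do rewrite projE.
have hN : is_derive t 1 (fun s => dot (gamma s) (gamma s)) (2 * dot (gamma t) (derive1 gamma t)).
  under eq_fun do rewrite dotE.
  have -> : 2 * dot (gamma t) (derive1 gamma t) =
    \sum_l (gamma t 0 l * derive1 gamma t 0 l + gamma t 0 l * derive1 gamma t 0 l).
    by rewrite dotE mulr_sumr; apply: eq_bigr => l _; ring.
  by apply: is_derive_bigsum => l; exact: (is_deriveM (he l) (he l)).
have hV : is_derive t 1 (fun s => (dot (gamma s) (gamma s))^-1)
    (- (dot (gamma t) (gamma t)) ^- 2 * (2 * dot (gamma t) (derive1 gamma t))).
  case: hN => hN1 hN2; split; first by apply: derivableV; rewrite ?gt_eqF.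
  by rewrite deriveV ?gt_eqF // hN2.
apply: (is_derive_eq (is_deriveM (is_deriveM (he i) (he j)) hV)); rewrite /dproj -![_ *: _]/(_ * _).
by rewrite fctE; field; rewrite gt_eqF.
Qed.

(** The fundamental theorem of calculus for each entry of the projector along the curve, with
    [dproj_le] under the integral. *)
Lemma curve_length_ge : exists2 C : R, 0 < C & forall gamma : R -> W,
  C1_curve gamma -> (forall t : R, t \in `[0, 1] -> gamma t != 0) ->
  `|proj (gamma 0) - proj (gamma 1)| <= C * curve_length g gamma.
Proof.
have [C C0 hC] := dproj_le; exists C => // gamma [gd gc] gn0.
have gcont t : gamma s @[s --> t] --> gamma t.
  by apply/differentiable_continuous/derivable1_diffP.
have in01 (t : R) : t \in `[0, 1]%classic -> gamma t != 0 by rewrite inE; exact: gn0.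
pose len t := Num.sqrt (quad (gamma t) (derive1 gamma t)).
have cd i j : {within `[0, 1], continuous (fun t => dproj (gamma t) (derive1 gamma t) i j)}.
  apply: continuous_in_subspaceT => t /in01 t0.
  have h1 l : gamma s 0 l @[s --> t] --> gamma t 0 l.
    by have /cvg_entries := gcont t; apply.
  have h2 l : derive1 gamma s 0 l @[s --> t] --> derive1 gamma t 0 l.
    by have /cvg_entries := gc t; apply.
  have h3 : dot (gamma s) (gamma s) @[s --> t] --> dot (gamma t) (gamma t).
    by apply: dot_cvg; exact: gcont.
  have h4 : dot (gamma s) (derive1 gamma s) @[s --> t] --> dot (gamma t) (derive1 gamma t).
    by apply: dot_cvg; [exact: gcont|exact: gc].
  have N0 : dot (gamma t) (gamma t) != 0 by rewrite gt_eqF // dot_gt0.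
  apply: cvgB.
    apply: cvgM; last exact: cvgV.
    by apply: cvgD; apply: cvgM; try exact: h1; exact: h2.
  apply: cvgM; last by apply: cvgV; [exact: mulf_neq0|exact: cvgM].
  apply: cvgM; first by apply: cvgM; exact: h1.
  by apply: cvgM => //; exact: cvg_cst.
have cl : {within `[0, 1], continuous len}.
  apply: continuous_in_subspaceT => t /in01 t0.
  apply: (@continuous_comp _ _ _ (fun t => quad (gamma t) (derive1 gamma t)) Num.sqrt);
    last exact: sqrt_continuous.
  by apply: quad_cvg => //; [exact: gcont|exact: gc].
have i1 i j := continuous_compact_integrable (@segment_compact R 0 1) (cd i j).
have i2 := continuous_compact_integrable (@segment_compact R 0 1) cl.
have m01 : measurable (`[0, 1]%classic : set (measurableTypeR R)) by exact: measurable_itv.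
have lge0 : 0 <= curve_length g gamma by apply: Rintegral_ge0 => t _; exact: sqrtr_ge0.
apply/mxnormP => [|i j]; first by rewrite mulr_ge0 // ltW.
rewrite mxE [X in _ + X]mxE distrC.
have E : proj (gamma 1) i j - proj (gamma 0) i j =
   \int[lebesgue_measure]_(t in `[0, 1]) dproj (gamma t) (derive1 gamma t) i j.
  rewrite /Rintegral (@continuous_FTC2 R _ (fun t => proj (gamma t) i j) 0 1 ltr01 (cd i j)) //.
    have cc (t : R) : t \in `[0, 1]%R -> proj (gamma s) i j @[s --> t] --> proj (gamma t) i j.
      move=> /gn0 t0; have := proj_cvg _ t0 (gcont t).
      by move=> /(_ _) /cvg_entries; apply.
    split.
    - move=> t; rewrite in_itv /= => /andP[/ltW t0 /ltW t1].
      have tn : gamma t != 0 by apply: gn0; rewrite in_itv /= t0.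
      by case: (proj_curve_derive i j (gd t) tn).
    - by apply: cvg_at_right_filter; apply: cc; rewrite in_itv /= lexx ler01.
    - by apply: cvg_at_left_filter; apply: cc; rewrite in_itv /= lexx ler01.
  move=> t; rewrite in_itv /= => /andP[/ltW t0 /ltW t1].
  have tn : gamma t != 0 by apply: gn0; rewrite in_itv /= t0.
  by rewrite derive1E; case: (proj_curve_derive i j (gd t) tn).
rewrite E; apply: le_trans (le_normr_Rintegral m01 (i1 i j)) _.
rewrite /curve_length -RintegralZl //.
apply: le_Rintegral => //.
- exact: integrable_norm (i1 i j).
- by have := integrableZl m01 C i2; exact: eq_integrable.
by move=> t /gn0; exact: hC.
Qed.

Lemma dist_ge_proj : exists2 C : R, 0 < C & forall p q (x y : W),
  represents x p -> represents y q ->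
  `|proj x - proj y| <= C * riemannian_dist g p q.
Proof.
have [C C0 hC] := curve_length_ge; exists C => // p q x y hx hy.
rewrite mulrC -ler_pdivrMr //; apply: lb_le_inf; last first.
  move=> l [gamma [g1 g2 g3 g4 ->]]; rewrite ler_pdivrMr // mulrC.
  by rewrite (represents_proj hx g3) (represents_proj hy g4) hC.
(* [lb_le_inf] asks for a nonempty set of lengths. The segment from [x] to [y] avoids the origin
   unless the two points coincide, and then a constant curve serves. *)
suff [gamma [h1 h2 h3 h4]] : exists gamma : R -> W, [/\ C1_curve gamma,
    forall t : R, t \in `[0, 1] -> gamma t != 0, represents (gamma 0) p & represents (gamma 1) q].
  by exists (curve_length g gamma), gamma.
have [pq|pq] := pselect (p = q).
  exists (fun=> x); split=> //; last by rewrite -pq.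
    split=> [t|]; first exact: derivable_cst.
    rewrite (_ : derive1 _ = fun=> 0); first exact: cst_continuous.
    by apply: funext => t; rewrite derive1_cst.
  by move=> t _; exact: represents_neq0 hx.
have hd (t : R) : is_derive t 1 (fun t : R => x + t *: (y - x)) (y - x).
  apply: is_derive_affine => h.
  by rewrite [h *: 1]mulr1; apply/rowP => l; rewrite !mxE; ring.
exists (fun t => x + t *: (y - x)); split.
- split=> [t|]; first by case: (hd t).
  rewrite (_ : derive1 _ = fun=> y - x); first exact: cst_continuous.
  by apply: funext => t; rewrite derive1E; case: (hd t).
- move=> t _; apply/eqP => E.
  have E' : t *: y = (t - 1) *: x.
    by apply/rowP => l; move/rowP/(_ l): E; rewrite !mxE; lra.
  have [t0|t0] := eqVneq t 0.
    by have := represents_neq0 hx; move: E; rewrite t0 scale0r addr0 => ->; rewrite eqxx.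
  apply: pq; have yx : y = ((t - 1) / t) *: x.
    by rewrite mulrC -scalerA -E' scalerA mulVf // scale1r.
  apply: (@represents_inj _ _ y _ _ _ hy); rewrite yx; apply: represents_scale => //.
  by apply: contra_neq (represents_neq0 hy) => z0; rewrite yx z0 scale0r.
- by rewrite scale0r addr0.
- by rewrite scale1r addrC subrK.
Qed.

End Metric.

(** * Charts *)

Lemma near_closed_ball (R : realType) (V : normedModType R) (v : V) (P : set V) :
  (\forall u \near v, P u) -> exists2 e : R, 0 < e & forall u, `|v - u| <= e -> P u.
Proof.
move=> /nbhs_ballP [e /= e0 he]; exists (e / 2); first by rewrite divr_gt0.
move=> u hu; apply: he; rewrite -ball_normE /ball_ /= (le_lt_trans hu) //.
by rewrite ltr_pdivrMr // mulr_natr mulr2n ltrDl.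
Qed.

Section SmoothFamilies.
Variables (R : realType) (k d : nat).
Local Notation V := 'rV[R]_k.
Local Notation W := 'rV[R]_d.+1.
Variables (X : set V) (Phi : V -> W).
Hypothesis Phi_smooth : smooth_on X Phi.

Lemma is_derive_coord s u i e : X u ->
  is_derive u (delta_mx 0 i) (fun u => partials s Phi u 0 e) (partials (i :: s) Phi u 0 e).
Proof.
move=> Xu; have [/(_ i) hd _] := Phi_smooth s Xu; split.
  exact: ((derivable_mxP _ _ _).1 hd).
by rewrite [partials (i :: s) _ _]/= /partial derive_mx // mxE.
Qed.

Lemma jet_family_coord (Y : set V) e : Y `<=` X ->
  jet_family Y (fun s u => partials s Phi u 0 e).
Proof. by move=> YX s u i /YX; exact: is_derive_coord. Qed.

Lemma jet_family_pairing (Y : set V) (a : 'cV[R]_d.+1) : Y `<=` X ->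
  jet_family Y (fun s u => (partials s Phi u *m a) 0 0).
Proof.
move=> YX s u i /YX Xu; rewrite mxE; under eq_fun do rewrite mxE.
apply: is_derive_bigsum => e; rewrite mulrC; under eq_fun do rewrite mulrC.
exact/is_derive_cmul/is_derive_coord.
Qed.

Lemma pairing_le (a : 'cV[R]_d.+1) s u C : `|partials s Phi u| <= C ->
  `|(partials s Phi u *m a) 0 0| <= d.+1%:R * C * `|a|.
Proof.
move=> hC; apply: le_trans (coord_norm _ 0 0) _; apply: le_trans (mulmx_norm _ _) _.
by rewrite ler_wpM2r // ler_wpM2l.
Qed.

Lemma smooth_bounded v N : open X -> X v ->
  exists e C : R, [/\ 0 < e, 0 < C & forall u, `|v - u| <= e ->
    X u /\ forall s, (size s <= N)%N -> `|partials s Phi u| <= C].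
Proof.
move=> oX Xv.
pose C := \sum_(s : N.-bseq 'I_k) (`|partials s Phi v| + 1).
have [e e0 he] : exists2 e : R, 0 < e & forall u, `|v - u| <= e ->
    X u /\ forall s : N.-bseq 'I_k, `|partials s Phi u| <= `|partials s Phi v| + 1.
  apply: near_closed_ball; near=> u; split.
    by near: u; exact: open_nbhs_nbhs.
  near: u; apply: filter_forall => s.
  have [_ hc] := Phi_smooth s Xv.
  move/cvgrPdist_le: hc => /(_ 1 ltr01); apply: filterS => u hu.
  rewrite -lerBlDl (le_trans (lerB_dist _ _)) // distrC //.
exists e, (C + 1); split=> //; first by rewrite ltr_wpDl // sumr_ge0 // => s _; rewrite addr_ge0.
move=> u /he [Xu hu]; split=> // s sN.
apply: le_trans (hu (Bseq sN)) _; rewrite /C (bigD1 (Bseq sN)) //= -addrA lerDl.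
by rewrite addr_ge0 // sumr_ge0 // => t _; rewrite addr_ge0.
Unshelve. all: by end_near. Qed.

Lemma smooth_cont v : X v -> Phi u @[u --> v] --> Phi v.
Proof. by move=> Xv; have [_] := Phi_smooth [::] Xv. Qed.

End SmoothFamilies.

Section Projection.
Variables (R : realType) (d : nat).
Local Notation W := 'rV[R]_d.+1.

Definition projp (p : proj_space R d) : 'M[R]_d.+1 :=
  proj (sval (cid (represents_exists p))).

Lemma projpE (x : W) p : represents x p -> projp p = proj x.
Proof. by apply: represents_proj; exact: svalP (cid (represents_exists p)). Qed.

Lemma mul_projp (x : W) p : represents x p -> x *m projp p = x.
Proof. by move=> hx; rewrite (projpE hx) proj_id // (represents_neq0 hx). Qed.

End Projection.

(** * Lower Lipschitz bounds for immersions *)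

Section Immersion.
Variables (R : realType) (k d : nat).
Local Notation V := 'rV[R]_k.
Local Notation W := 'rV[R]_d.+1.

Definition jacobian (Phi : V -> W) v : 'M[R]_(k, d.+1) := \matrix_i partial i Phi v.

Lemma mul_jacobian (Phi : V -> W) v (w : V) :
  w *m jacobian Phi v = \sum_i w 0 i *: partial i Phi v.
Proof. by rewrite mulmx_sum_row; apply: eq_bigr => i _; rewrite rowK. Qed.

(** The factor [1 - proj] kills exactly the line of [Phi v]. A relation between partial derivatives
    modulo that line either puts [Phi v] in their span or is a relation between them. *)
Lemma jacobian_free (Phi : V -> W) v :
  free (Phi v :: [seq partial i Phi v | i <- enum 'I_k]) ->
  row_free (jacobian Phi v *m (1%:M - proj (Phi v))).
Proof.
rewrite free_cons => /andP[nin fr].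
rewrite -kermx_eq0; apply/eqP/row_matrixP => l; rewrite row0.
set w := row l _.
have : w *m (jacobian Phi v *m (1%:M - proj (Phi v))) = 0.
  by rewrite /w -row_mul mulmx_ker row0.
rewrite mulmxA mulmxBr mulmx1 mul_proj => /eqP; rewrite subr_eq0 => /eqP.
set tau := _ / _ => E.
have wspan : w *m jacobian Phi v \in <<[seq partial i Phi v | i <- enum 'I_k]>>%VS.
  rewrite mul_jacobian; apply: memv_suml => i _; apply: memvZ; apply: memv_span.
  by apply/mapP; exists i; rewrite ?mem_enum.
have t0 : tau = 0.
  apply/eqP; apply: contraNT nin => t0.
  by rewrite -[Phi v](scalerK t0) memvZ // -E.
rewrite t0 scale0r mul_jacobian in E.
have /freeP fr' : free [tuple of [seq partial i Phi v | i <- ord_tuple k]].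
  exact: fr.
apply/rowP => i; rewrite [RHS]mxE; apply: (fr' (fun i => w 0 i)).
rewrite -[RHS]E; apply: eq_bigr => j _; congr (_ *: _).
by rewrite (nth_map j) ?size_tuple // -tnth_nth tnth_ord_tuple.
Qed.

Lemma first_order (X : set V) (Phi : V -> W) v : open X -> X v -> smooth_on X Phi ->
  exists e K : R, [/\ 0 < e, 0 < K & forall u, `|v - u| <= e ->
    [/\ X u, `|Phi u| <= K, `|Phi u - Phi v| <= K * `|u - v| &
    `|Phi u - Phi v - (u - v) *m jacobian Phi v| <= K * `|u - v| ^+ 2]].
Proof.
move=> oX Xv sm; have [e [C [e0 C0 hC]]] := smooth_bounded sm 2 oX Xv.
exists e, (C + k%:R * C + k%:R ^+ 2 * C); split=> //.
  by rewrite !ltr_wpDr // ?mulr_ge0 ?exprn_ge0 // ltW.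
move=> u hu; have [Xu hb] := hC u hu.
have C1 : 0 <= k%:R * C by rewrite mulr_ge0 // ltW.
have C2 : 0 <= k%:R ^+ 2 * C by rewrite mulr_ge0 ?exprn_ge0 // ltW.
have C0' := ltW C0.
have vv : `|v - v| <= e by rewrite subrr normr0 ltW.
have fam l : jet_family [set u | `|v - u| <= e] (fun s u => partials s Phi u 0 l).
  by apply: (jet_family_coord sm) => w /hC [].
split=> //.
- by apply: le_trans (hb [::] isT) _; lra.
- apply/mxnormP => [|i l]; first by rewrite mulr_ge0 //; lra.
  rewrite ord1 !mxE.
  have := @jet_lipschitz _ _ v e _ (fam l) [::] C u v C0' hu vv.
  move=> /(_ _) H; apply: le_trans (H _) _ => [i' w hw|].
    by apply: le_trans (coord_norm _ 0 l) _; apply: (hC w hw).2.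
  by rewrite ler_wpM2r //; lra.
apply/mxnormP => [|i l]; first by rewrite mulr_ge0 ?exprn_ge0 //; lra.
rewrite ord1 !sub_mxE.
have := @jet_quad _ _ v e _ (fam l) [::] C u v C0' hu vv.
move=> /(_ _) H; apply: le_trans (le_trans _ (H _)) _ => [|i' j' w hw|]; last first.
- by rewrite ler_wpM2r ?exprn_ge0 //; lra.
- by apply: le_trans (coord_norm _ 0 l) _; apply: (hC w hw).2.
rewrite mxE le_eqVlt; apply/orP; left; apply/eqP; congr (`|_ - _|).
by apply: eq_bigr => j _; rewrite !mxE.
Qed.

(** The component of [y] orthogonal to the line [Psi v], relative to [|y|], measures the distance of
    the two lines. For [y = Phi u] its linear part is injective by [jacobian_free], and the
    quadratic error is absorbed near [v]. *)
Lemma immersion_lower (U : set V) (Psi : V -> proj_space R d) v :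
  smooth_immersion U Psi -> U v ->
  exists e c : R, [/\ 0 < e, 0 < c & forall u, `|v - u| <= e -> U u /\
    forall y : W, represents y (Psi u) ->
      c * `|u - v| * `|y| <= `|y *m (1%:M - projp (Psi v))|].
Proof.
move=> im Uv; have [X [Phi [[oX Xv XU sm lf] fr]]] := im v Uv.
have [e [K [e0 K0 hK]]] := first_order oX Xv sm.
rewrite (projpE (lf v Xv)); set Q := 1%:M - proj (Phi v).
have /row_freeP [B hB] := jacobian_free fr; rewrite -/Q in hB.
pose n : R := d.+1%:R; have n0 : 0 < n by rewrite ltr0n.
have B1 : 0 < `|B| + 1 by rewrite ltr_wpDl.
pose M1 := n * (`|B| + 1).
pose M2 := M1 * (n * K * `|Q|).
have M10 : 0 < M1 by rewrite mulr_gt0.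
have M20 : 0 <= M2 by rewrite !mulr_ge0 // ltW.
have M21 : 0 < 2 * (M2 + 1) by rewrite mulr_gt0 // ltr_wpDl.
(* The radius makes the quadratic term at most half of [|u - v|]; [K] bounds [|Phi u|]. *)
exists (Num.min e (2 * (M2 + 1))^-1), (2 * M1 * K)^-1; split.
- by rewrite lt_min e0 invr_gt0.
- by rewrite invr_gt0 !mulr_gt0.
move=> u; rewrite le_min => /andP[hu1 hu2].
have [Xu hb _ hq] := hK u hu1; split; first exact: XU.
set w := u - v in hq *.
have hw : M2 * `|w| <= 1 / 2.
  have : (M2 + 1) * `|w| <= 1 / 2.
    have := hu2; rewrite distrC -/w -[_^-1]mul1r ler_pdivlMr // => h; lra.
  have := normr_ge0 w; lra.
have wE : `|w| <= M1 * `|w *m jacobian Phi v *m Q|.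
  rewrite -{1}[w]mulmx1 -hB mulmxA mulmxA (le_trans (mulmx_norm _ _)) //.
  rewrite -mulrA [_ * `|B|]mulrC mulrA ler_wpM2r // ler_wpM2l ?ler0n // lerDl //.
have pQ : Phi v *m Q = 0.
  by rewrite /Q mulmxBr mulmx1 proj_id ?subrr // (represents_neq0 (lf v Xv)).
have h1 : `|w *m jacobian Phi v *m Q| <= `|Phi u *m Q| + n * (K * `|w| ^+ 2) * `|Q|.
  have -> : w *m jacobian Phi v *m Q = Phi u *m Q - (Phi u - Phi v - w *m jacobian Phi v) *m Q.
    by rewrite !mulmxBl pQ subr0 subKr.
  rewrite (le_trans (ler_normB _ _)) // lerD2l (le_trans (mulmx_norm _ _)) //.
  by rewrite ler_wpM2r // ler_wpM2l ?ler0n.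
have h2 : `|w| <= 2 * M1 * `|Phi u *m Q|.
  have : `|w| <= M1 * `|Phi u *m Q| + M2 * `|w| * `|w|.
    apply: le_trans wE _; apply: le_trans (_ : M1 * (`|Phi u *m Q| + n * (K * `|w| ^+ 2) * `|Q|) <= _).
      by rewrite ler_wpM2l // ltW.
    by rewrite mulrDr lerD2l le_eqVlt; apply/orP; left; apply/eqP; rewrite /M2; ring.
  have : M2 * `|w| * `|w| <= 1 / 2 * `|w| by rewrite ler_wpM2r.
  lra.
move=> y hy; have [lam lam0 ->] := represents_colinear (lf u Xu) hy.
rewrite -scalemxAl !normrZ mulrCA ler_wpM2l // -[leLHS]mulrA [leLHS]mulrC.
rewrite ler_pdivrMr ?mulr_gt0 //.
apply: le_trans (_ : (2 * M1 * `|Phi u *m Q|) * K <= _).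
  by apply: ler_pM.
by rewrite le_eqVlt; apply/orP; left; apply/eqP; ring.
Qed.

End Immersion.

Section Charts.
Variables (R : realType) (k d : nat).
Local Notation V := 'rV[R]_k.
Local Notation W := 'rV[R]_d.+1.
Variable M : set (proj_space R d).

Lemma lift_open (O : set (proj_space R d)) (x : W) p : proj_open O -> O p ->
  represents x p -> exists2 e : R, 0 < e & forall y, `|x - y| <= e ->
    exists2 q, O q & represents y q.
Proof.
move=> oO Op hx; apply: near_closed_ball.
apply: (open_nbhs_nbhs (conj oO _)); by exists p.
Qed.

(* A covector annihilating all derivatives at [v] up to order [D] would vanish to order
   [D + 1] along [M], hence in any other chart, hence annihilate the whole jet there. *)
Lemma nondegenerate_chart (U X : set V) (Psi : V -> proj_space R d) (Phi : V -> W) v D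
    (a : 'cV[R]_d.+1) :
  local_parameterization M U Psi -> open X -> X v -> X `<=` U -> smooth_on X Phi ->
  lifts X Phi Psi -> nondegenerate k D M (Psi v) -> a != 0 ->
  exists2 s, (size s <= D)%N & (partials s Phi v *m a) 0 0 != 0.
Proof.
move=> [oU UM im injP openP] oX Xv XU sm lf nd a0.
apply: contrapT => no.
have flat s : (size s <= D)%N -> (partials s Phi v *m a) 0 0 = 0.
  by move=> sD; apply/eqP; apply: contrapT => /negP h; apply: no; exists s.
have [U' [Phi' [Psi' [v' [[lp' sm' lf' Uv' Pv'] sp]]]]] := nd.
have [oU' U'M _ _ _] := lp'.
have [e1 [C1 [e10 C10 h1]]] := smooth_bounded sm D.+2 oX Xv.
have [e2 [c2 [e20 c20 h2]]] := immersion_lower im (XU v Xv).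
have [e3 [K3 [e30 K30 h3]]] := first_order oU' Uv' sm'.
have [e4 [C4 [e40 C40 h4]]] := smooth_bounded sm' D.+1 oU' Uv'.
have lowPhi (Y : set V) (F : V -> W) z : Y z -> smooth_on Y F -> F z != 0 ->
    exists2 e : R, 0 < e & forall u, `|z - u| <= e -> `|F z| / 2 <= `|F u|.
  move=> Yz smY Fz; apply: near_closed_ball.
  have Fz0 : 0 < `|F z| / 2 by rewrite divr_gt0 // normr_gt0.
  have /cvgrPdist_le /(_ _ Fz0) := smooth_cont smY Yz.
  by apply: filterS => u hu; have := le_trans (lerB_dist _ _) hu; lra.
have Fv : Phi v != 0 := represents_neq0 (lf v Xv).
have Fv' : Phi' v' != 0 := represents_neq0 (lf' v' Uv').
have [e5 e50 h5] := lowPhi X Phi v Xv sm Fv.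
have [e6 e60 h6] := lowPhi U' Phi' v' Uv' sm' Fv'.
pose e := Num.min (Num.min e1 e2) e5.
have e0 : 0 < e by rewrite !lt_min e10 e20.
pose B := [set u : V | `|v - u| < e].
have oB : open (B `&` X).
  apply: openI => //.
  have -> : B = ball v e by rewrite -ball_normE.
  exact: ball_open.
(* The image of a small ball is open in [M], so points of the other chart near [v'] come from points
   [u] of this ball. Embeddedness enters here. *)
have [G oG GE] := openP (B `&` X) oB (fun u h => XU u h.2).
have Op : (M `&` G) (Psi v).
  by rewrite -GE; exists v => //; split; rewrite /B /= ?subrr ?normr0.
have Pv'' : represents (Phi' v') (Psi v) by rewrite -Pv'; exact: lf'.
have [e7 e70 h7] : exists2 e : R, 0 < e & forall u', `|v' - u'| <= e ->
    exists2 q, G q & represents (Phi' u') q.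
  have [r r0 hr] := lift_open oG Op.2 Pv''.
  apply: near_closed_ball.
  have /cvgrPdist_le /(_ _ r0) := smooth_cont sm' Uv'.
  by apply: filterS => u /hr.
pose Q := 1%:M - projp (Psi v).
pose n : R := d.+1%:R.
(* A Lipschitz constant at [v'] for the transition map from [u'] to [u]: [K3] bounds the
   displacement of [Phi'], and [immersion_lower] converts it into a bound on [|u - v|]. *)
pose L := n * K3 * `|Q| / (c2 * (`|Phi' v'| / 2)).
have m0 : 0 < `|Phi v| by rewrite normr_gt0.
have m0' : 0 < `|Phi' v'| by rewrite normr_gt0.
have L0 : 0 <= L by rewrite divr_ge0 // !mulr_ge0 // ltW.
pose r := Num.min (Num.min e3 e4) (Num.min e6 e7).
have r0 : 0 < r by rewrite !lt_min e30 e40 e60.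
(* [Phi' u' = lam *: Phi u] with [|lam|] bounded by [|Phi' u'| / |Phi u|], so the order of vanishing
   passes from one chart to the other. *)
have main u' : `|v' - u'| <= r -> `|(Phi' u' *m a) 0 0| <=
    K3 / (`|Phi v| / 2) * (k%:R ^+ D.+1 * (n * C1 * `|a|)) * L ^+ D.+1 * `|u' - v'| ^+ D.+1.
  rewrite !le_min => /andP[/andP[r3 r4] /andP[r6 r7]].
  have [Xu' hb' hlip _] := h3 u' r3.
  have [q Oq hq] := h7 u' r7.
  have qE : q = Psi' u' by apply: represents_inj hq _; exact: lf'.
  have : (M `&` G) q by split=> //; rewrite qE; apply: U'M; exists u'.
  rewrite -GE => -[u [Bu Xu] Pu].
  have := Bu; rewrite /B /= !lt_min => /andP[/andP[u1 u2] u5].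
  have [_ low] := h2 u (ltW u2).
  have hPu : represents (Phi' u') (Psi u) by rewrite Pu.
  have uL : `|u - v| <= L * `|u' - v'|.
    have H := low _ hPu; rewrite -/Q in H.
    have QE : Phi' u' *m Q = (Phi' u' - Phi' v') *m Q.
      by rewrite mulmxBl [X in _ = _ - X]mulmxBr mulmx1 (mul_projp Pv'') subrr subr0.
    have H2 : `|Phi' u' *m Q| <= n * (K3 * `|u' - v'|) * `|Q|.
      rewrite QE (le_trans (mulmx_norm _ _)) // ler_wpM2r // ler_wpM2l //.
    have H3 : c2 * `|u - v| * (`|Phi' v'| / 2) <= c2 * `|u - v| * `|Phi' u'|.
      by rewrite ler_wpM2l ?h6 // mulr_ge0 // ltW.
    rewrite /L mulrAC ler_pdivlMr; last by rewrite mulr_gt0 // divr_gt0.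
    apply: le_trans (_ : n * (K3 * `|u' - v'|) * `|Q| <= _); last first.
      by rewrite le_eqVlt; apply/orP; left; apply/eqP; ring.
    apply: le_trans (le_trans H3 (le_trans H H2)); rewrite le_eqVlt; apply/orP; left.
    by apply/eqP; ring.
  have [lam lam0 lamE] := represents_colinear (lf u Xu) hPu.
  have lamle : `|lam| <= K3 / (`|Phi v| / 2).
    rewrite ler_pdivlMr; last by rewrite divr_gt0.
    apply: le_trans hb'; rewrite lamE normrZ ler_wpM2l // h5 //; exact: ltW.
  have T : `|(Phi u *m a) 0 0| <= k%:R ^+ D.+1 * (n * C1 * `|a|) * `|u - v| ^+ D.+1.
    have fam : jet_family [set u | `|v - u| <= e1] (fun s u => (partials s Phi u *m a) 0 0).
      by apply: (jet_family_pairing sm) => w /h1 [].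
    have := @taylor R k v e1 _ fam D.+1 (n * C1 * `|a|) v u.
    rewrite big1 ?subr0; last first.
      move=> j _; rewrite big1 ?mul0r // => s _.
      by rewrite flat ?mul0r // size_tuple -ltnS.
    apply=> //; first by rewrite !mulr_ge0 // ltW.
      by move=> s y sD /h1 [_ hy]; apply: pairing_le; exact: hy.
    by rewrite subrr normr0.
  rewrite lamE -scalemxAl mxE normrM; apply: le_trans (ler_pM _ _ lamle T) _ => //.
  rewrite [leLHS]mulrA -[leRHS]mulrA -exprMn; apply: ler_wpM2l.
    apply: mulr_ge0; first by rewrite divr_ge0 // ltW // divr_gt0.
    by rewrite !mulr_ge0 ?exprn_ge0 // ltW.
  by rewrite lerXn2r ?nnegrE // mulr_ge0.
have rr4 u : `|v' - u| <= r -> `|v' - u| <= e4.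
  by rewrite !le_min => /andP[/andP[_ ->]].
have flat' s : (size s <= D)%N -> (partials s Phi' v' *m a) 0 0 = 0.
  have fam : jet_family [set u | `|v' - u| <= r] (fun s u => (partials s Phi' u *m a) 0 0).
    by apply: (jet_family_pairing sm') => w /rr4 /h4 [].
  apply: (@flat_jet0 R k v' r _ fam D _ (n * C4 * `|a|) r0 _ _ _ main).
  - rewrite !mulr_ge0 ?exprn_ge0 ?invr_ge0 // ?mulr_ge0 ?invr_ge0 //; exact: ltW.
  - by rewrite !mulr_ge0 // ltW.
  - by move=> t y tD /rr4 /h4 [_ hy]; apply: pairing_le; exact: hy.
have sub : (<<jet D Phi' v'>> <= lker (linfun (mulmxr a : W -> 'M[R]_1)))%VS.
  apply/span_subvP => x /mapP [al]; rewrite mem_filter => /andP[hal _] ->.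
  rewrite memv_ker lfunE /=; apply/eqP/matrixP => i j; rewrite !ord1 flat' ?mxE //.
  rewrite size_flatten /shape -map_comp sumnE big_map big_enum /=.
  apply: leq_trans hal; apply: eq_leq; apply: eq_bigr => l _; exact: size_nseq.
move/eqP: a0; apply; apply/matrixP => i j; rewrite [RHS]mxE (ord1 j).
have : (delta_mx 0 i : W) \in lker (linfun (mulmxr a : W -> 'M[R]_1)).
  by apply: (subvP sub); rewrite sp memvf.
rewrite memv_ker lfunE /= => /eqP /matrixP /(_ 0 0).
by rewrite -rowE mxE => ->; rewrite mxE.
Qed.

(** The matrix of all derivatives of order at most [D] has full column rank at [v], and a left
    inverse bounds [|a|] by its image. Near [v] the perturbation costs at most [|a| / 2], for all
    covectors at once. *)
Lemma nondegenerate_uniform (X : set V) (Phi : V -> W) v D :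
  open X -> X v -> smooth_on X Phi ->
  (forall a : 'cV[R]_d.+1, a != 0 ->
    exists2 s, (size s <= D)%N & (partials s Phi v *m a) 0 0 != 0) ->
  exists e C : R, [/\ 0 < e, 0 < C & forall u (a : 'cV[R]_d.+1) b, `|v - u| <= e ->
    (forall s, (size s <= D)%N -> `|(partials s Phi u *m a) 0 0| <= b) -> `|a| <= C * b].
Proof.
move=> oX Xv sm nd.
pose T : finType := D.-bseq 'I_k.
pose J u : 'M[R]_(#|T|, d.+1) := \matrix_i partials (enum_val i : D.-bseq 'I_k) Phi u.
have JE u (a : 'cV[R]_d.+1) i : (J u *m a) i 0 = (partials (enum_val i : D.-bseq 'I_k) Phi u *m a) 0 0.
  by rewrite /J mxE [RHS]mxE; apply: eq_bigr => j _; rewrite mxE.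
have full : row_full (J v).
  rewrite -[row_full _]/(\rank (J v) == d.+1) -mxrank_tr -[_ == _]/(row_free (J v)^T).
  rewrite -kermx_eq0; apply/eqP/row_matrixP => l; rewrite row0.
  set w := row l _; apply: contrapT => /eqP w0.
  have wJ : w *m (J v)^T = 0 by rewrite /w -row_mul mulmx_ker row0.
  have [|s sD] := nd w^T; first by rewrite trmx_eq0.
  have -> : (partials s Phi v *m w^T) 0 0 = (J v *m w^T) (enum_rank (Bseq sD : T)) 0.
    by rewrite JE enum_rankK.
  by rewrite -[J v]trmxK -trmx_mul wJ trmx0 mxE eqxx.
have [L hL] := row_fullP full.
pose m : R := #|T|%:R * (`|L| + 1); pose n : R := d.+1%:R.
have L1 : 0 < `|L| + 1 by rewrite ltr_wpDl.
have T0 : (0 < #|T|)%N by apply/card_gt0P; exists [bseq].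
have m0 : 0 < m by rewrite mulr_gt0 // ltr0n.
have n0 : 0 < n by rewrite ltr0n.
pose eta := (2 * m * n)^-1.
have eta0 : 0 < eta by rewrite invr_gt0; do 2![apply: mulr_gt0 => //].
have [e e0 he] : exists2 e : R, 0 < e & forall u, `|v - u| <= e -> `|J v - J u| <= eta.
  apply: near_closed_ball.
  have : \forall u \near v, forall s : D.-bseq 'I_k, `|partials s Phi v - partials s Phi u| <= eta.
    have H (s : D.-bseq 'I_k) : \forall u \near v, `|partials s Phi v - partials s Phi u| <= eta.
      by have [_ hc] := sm s v Xv; move/cvgrPdist_le: hc => /(_ _ eta0).
    exact: filter_forall H.
  apply: filterS => u hu; apply/mxnormP => [|i j]; first exact: ltW.
  rewrite !mxE; apply: le_trans (hu (enum_val i)).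
  set t := (enum_val i : D.-bseq 'I_k).
  by have := coord_norm (partials t Phi v - partials t Phi u) 0 j; rewrite !mxE.
exists e, (2 * m); split=> //; first by rewrite mulr_gt0.
move=> u a b hu hb.
have b0 : 0 <= b by apply: le_trans (hb [::] _).
have h1 : `|J u *m a| <= b.
  apply/mxnormP => // i j; rewrite (ord1 j) JE; apply: hb; exact: size_bseq.
have h2 : `|(J v - J u) *m a| <= n * eta * `|a|.
  by rewrite (le_trans (mulmx_norm _ _)) // ler_wpM2r // ler_wpM2l ?he // ltW.
have aE : a = L *m (J u *m a + (J v - J u) *m a).
  by rewrite -mulmxDl addrC subrK mulmxA hL mul1mx.
have h3 : `|a| <= m * (b + n * eta * `|a|).
  rewrite {1}aE (le_trans (mulmx_norm _ _)) //; apply: ler_pM => //.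
    by rewrite ler_wpM2l // lerDl.
  by rewrite (le_trans (ler_normD _ _)) // lerD.
have h4 : m * (n * eta * `|a|) = `|a| / 2.
  by rewrite /eta; field; rewrite !gt_eqF.
move: h3; rewrite mulrDr h4; lra.
Qed.

(** Rational points of [M] outside the chart count too. The image of a small ball is [M] intersected
    with an open set, so the remaining points of [M] have projectors away from that of [Psi v];
    [immersion_lower] deals with those in the image. *)
Lemma dist_chart_lower (g : W -> 'M[R]_d.+1) (U : set V) (Psi : V -> proj_space R d) v (e : R) :
  riemannian g -> local_parameterization M U Psi -> U v -> 0 < e ->
  exists2 c : R, 0 < c & forall q, M q ->
    (exists w, [/\ U w, `|v - w| < e, Psi w = q & c * `|w - v| <= riemannian_dist g q (Psi v)]) \/
    c <= riemannian_dist g q (Psi v).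
Proof.
move=> hg [oU UM im injP openP] Uv e0.
have [C C0 hC] := dist_ge_proj hg.
have [e2 [c2 [e20 c20 h2]]] := immersion_lower im Uv.
pose r := Num.min e e2.
have r0 : 0 < r by rewrite lt_min e0.
pose B := [set u : V | `|v - u| < r].
have oB : open (B `&` U).
  apply: openI => //.
  have -> : B = ball v r by rewrite -ball_normE.
  exact: ball_open.
have [G oG GE] := openP (B `&` U) oB (fun u h => h.2).
have Op : (M `&` G) (Psi v).
  by rewrite -GE; exists v => //; split; rewrite /B /= ?subrr ?normr0.
have [y0 hy0] := represents_exists (Psi v).
have [e3 e30 h3] := lift_open oG Op.2 hy0.
have y00 := represents_neq0 hy0.
have ny0 : 0 < `|y0| by rewrite normr_gt0.
pose n : R := d.+1%:R; have n0 : 0 < n by rewrite ltr0n.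
pose c := Num.min (c2 / (n * C)) (e3 / (n * `|y0| * C)).
have c0 : 0 < c by rewrite lt_min !divr_gt0 ?mulr_gt0.
exists c => // q Mq.
have [y hy] := represents_exists q.
have yn0 : 0 < `|y| by rewrite normr_gt0 (represents_neq0 hy).
have hd := hC q (Psi v) y y0 hy hy0.
set D := riemannian_dist _ _ _ in hd *.
have [far|near] := ltP e3 (n * `|y0| * `|proj y - proj y0|).
  right; apply: le_trans (_ : e3 / (n * `|y0| * C) <= _); first by rewrite ge_min lexx orbT.
  rewrite ler_pdivrMr ?mulr_gt0 //; apply: le_trans (ltW far) _.
  by rewrite [leRHS]mulrC -[leRHS]mulrA ler_wpM2l // mulr_ge0 // ltW.
left.
(* The orthogonal projection of [y0] to the line of [y]: a vector of that line close to [y0] when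
   the projectors are close. *)
have [q' Oq' hq'] : exists2 q', G q' & represents (y0 *m proj y) q'.
  apply: h3; have -> : y0 - y0 *m proj y = y0 *m (proj y0 - proj y).
    by rewrite mulmxBr proj_id.
  apply: le_trans (mulmx_norm _ _) _; rewrite distrC //.
have qq : q' = q.
  have z0 := represents_neq0 hq'; rewrite mul_proj in hq' z0.
  apply: represents_inj hq' _; apply: represents_scale => //.
  by apply: contra_neq z0 => ->; rewrite scale0r.
have : (M `&` G) q by split=> //; rewrite -qq.
rewrite -GE => -[w [Bw Uw] Pw].
have := Bw; rewrite /B /= lt_min => /andP[w1 w2].
exists w; split=> //.
have [_ /(_ y)] := h2 w (ltW w2); rewrite Pw => /(_ hy).
have -> : y *m (1%:M - projp (Psi v)) = y *m (proj y - proj y0).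
  by rewrite (projpE hy0) !mulmxBr mulmx1 proj_id // (represents_neq0 hy).
move=> h; have h' := le_trans h (mulmx_norm _ _).
have h4 : c2 * `|w - v| <= n * `|proj y - proj y0|.
  rewrite -(ler_pM2r yn0) (le_trans h') // le_eqVlt; apply/orP; left; apply/eqP.
  by rewrite /n; ring.
apply: le_trans (_ : c2 / (n * C) * `|w - v| <= _).
  by rewrite ler_wpM2r // ge_min lexx.
rewrite mulrAC ler_pdivrMr ?mulr_gt0 // (le_trans h4) //.
by rewrite [leRHS]mulrCA ler_wpM2l ?(ltW n0) // mulrC.
Qed.

End Charts.

(** * Winning near a point *)

Lemma guarantees_sub (R : realType) (k : nat) (beta : R) (G G' : set (nat -> 'rV[R]_k * R)) b :
  (forall B : nat -> 'rV[R]_k * R, B 0%N = b -> (forall n, 0 < (B n).2) ->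
    (forall n, cball (B n.+1) `<=` cball (B n)) -> G B -> G' B) ->
  guarantees beta G b -> guarantees beta G' b.
Proof.
move=> GG' [s [s1 s2]]; exists s; split=> // B B0 Bf; apply: GG' (s2 B B0 Bf) => //.
  exact: Bf.1.
by move=> n; exact: legal_sub (Bf.2 n).
Qed.

Lemma expr_half_small (R : realType) (theta e : R) : 0 <= theta <= 1 / 2 -> 0 < e ->
  exists t, theta ^+ t <= e.
Proof.
move=> /andP[t0 t1] e0.
have i0 : 0 <= e^-1 by rewrite invr_ge0 ltW.
have := archi_boundP i0; set n := Num.bound _ => hn; exists n.
apply: le_trans (_ : (2^-1) ^+ n <= _).
  by rewrite lerXn2r ?nnegrE ?invr_ge0 // -[2^-1]mul1r.
rewrite exprVn invf_ple ?posrE ?exprn_gt0 // (le_trans (ltW hn)) //.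
by rewrite -natrX ler_nat ltnW // ltn_expl.
Qed.

Section LocalWin.
Variables (R : realType) (k d : nat).
Hypotheses (hk : (1 <= k)%N) (hkd : (k <= d)%N).
Local Notation V := 'rV[R]_k.
Local Notation W := 'rV[R]_d.+1.
Local Notation N := (N_kd k d).

Lemma N_gt0 : (0 < N)%N.
Proof. by rewrite /N_kd -addnA addn_gt0 hk. Qed.

(* Simplex lemma: [det_taylor] against the fact that the determinant of [d + 1] independent
   integer vectors is at least 1 in absolute value. *)
Lemma simplex (X : set V) (Phi : V -> W) (Psi : V -> proj_space R d) v :
  open X -> X v -> smooth_on X Phi -> lifts X Phi Psi ->
  exists e kap : R, [/\ 0 < e, 0 < kap & forall x rho, 0 < rho -> 2 * rho <= 1 ->
    `|v - x| + 2 * rho < e ->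
    exists2 a : 'cV[R]_d.+1, a != 0 & forall w, rational_points (Psi w) ->
      `|w - x| <= 2 * rho -> H_std (Psi w) ^+ d.+1 * rho ^+ N <= kap ->
      (Phi w *m a) 0 0 = 0].
Proof.
move=> oX Xv sm lf.
have [e1 [C [e10 C0 hC]]] := smooth_bounded sm (n_kd k d).+2 oX Xv.
have Fv : 0 < `|Phi v| / 2 by rewrite divr_gt0 // normr_gt0 (represents_neq0 (lf v Xv)).
have [e2 e20 h2] : exists2 e : R, 0 < e & forall u, `|v - u| <= e -> `|Phi v| / 2 <= `|Phi u|.
  apply: near_closed_ball.
  have /cvgrPdist_le /(_ _ Fv) := smooth_cont sm Xv.
  by apply: filterS => u hu; have := le_trans (lerB_dist _ _) hu; lra.
set m := `|Phi v| / 2 in Fv h2.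
have [K K0 hK] := @det_taylor R k d hk hkd v e1 C (fun e s u => partials s Phi u 0 e)
  (fun e => jet_family_coord sm e (fun w hw => (hC w hw).1)) (ltW C0)
  (fun e s y sN hy => le_trans (coord_norm _ 0 e) ((hC y hy).2 s sN)).
have K2 : 0 < 2 * (K * 2 ^+ N) by rewrite !mulr_gt0 ?exprn_gt0.
(* [2 ^+ N] because the points lie within [2 * rho] of [x]; the other 2 leads to the contradiction
   [m ^+ d.+1 <= m ^+ d.+1 / 2]. *)
have kap0 : 0 < m ^+ d.+1 / (2 * (K * 2 ^+ N)) by rewrite divr_gt0 ?exprn_gt0.
exists (Num.min e1 e2), (m ^+ d.+1 / (2 * (K * 2 ^+ N))); split=> //.
  by rewrite lt_min e10.
set kap := _ / _ in kap0 *.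
move=> x rho rho0 rho2; rewrite lt_min => /andP[hx1 hx2].
have near w : `|w - x| <= 2 * rho -> `|v - w| <= `|v - x| + 2 * rho.
  move=> hw; rewrite -(subrKA x) (le_trans (ler_normD _ _)) // lerD2l distrC //.
pose S : set W := [set y | exists w (z : 'rV[int]_d.+1), [/\ `|w - x| <= 2 * rho,
  y = map_mx intr z, represents y (Psi w) & `|y| ^+ d.+1 * rho ^+ N <= kap]].
have [f fS|a a0 ha] := @common_hyperplane R d.+1 S; last first.
  exists a => // w rw hw hH.
  have [z hz hHz] := rational_height rw.
  have Xw : X w by apply: (hC w _).1; rewrite (le_trans (near w hw)) // ltW.
  have [lam _ ->] := represents_colinear hz (lf w Xw).
  rewrite -scalemxAl ha ?scaler0 ?mxE //.
  by exists w, z; split=> //; rewrite -hHz.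
have [wz hwz] := choice_ex fS.
have [zz hzz] := choice_ex hwz.
apply: contrapT => /eqP det0.
have Xw i : X (wz i).
  by case: (hzz i) => hw _ _ _; apply: (hC _ _).1; rewrite (le_trans (near _ hw)) // ltW.
have hlam i : exists lam : R, Phi (wz i) = lam *: f i.
  by case: (hzz i) => _ _ hr _; have [lam _ E] := represents_colinear hr (lf _ (Xw i)); exists lam.
have [lam lamE] := choice_ex hlam.
have detE : \det (\matrix_(i, e) Phi (wz i) 0 e) = (\prod_i lam i) * \det (\matrix_i f i).
  pose dg : W := \row_i lam i.
  have -> : \prod_i lam i = \prod_i dg 0 i by apply: eq_bigr => i _; rewrite mxE.
  rewrite -det_diag -det_mulmx; congr (\det _); apply/matrixP => i e.
  by rewrite mul_diag_mx !mxE lamE !mxE.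
have det1 : 1 <= `|\det (\matrix_i f i)|.
  have fE : \matrix_i f i = map_mx intr (\matrix_i zz i).
    by apply/matrixP => i j; rewrite !mxE; case: (hzz i) => _ -> _ _; rewrite mxE.
  by rewrite fE det_int_ge1 // -fE.
have low : m ^+ d.+1 <= \prod_i (`|lam i| * `|f i|).
  rewrite -[X in _ ^+ X]card_ord -prodr_const; apply: ler_prod => i _.
  rewrite (ltW Fv) /= -normrZ -lamE h2 //.
  by case: (hzz i) => hw _ _ _; rewrite (le_trans (near _ hw)) // ltW.
(* The product of the d + 1 height conditions, followed by a (d + 1)-th root. *)
have up : (\prod_i `|f i|) * rho ^+ N <= kap.
  rewrite -(@ler_pXn2r _ d.+1) ?nnegrE //; last 2 first.
  - by rewrite mulr_ge0 ?exprn_ge0 ?(ltW rho0) // prodr_ge0.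
  - exact: ltW.
  have cst (y : R) : y ^+ d.+1 = \prod_(i < d.+1) y by rewrite prodr_const card_ord.
  rewrite exprMn -prodrXl [in X in _ * X]cst [leRHS]cst -big_split /=.
  apply: ler_prod => i _.
  by case: (hzz i) => _ _ _ ->; rewrite mulr_ge0 ?exprn_ge0 // ltW.
have hdet : `|\det (\matrix_(i, e) Phi (wz i) 0 e)| <= K * (2 * rho) ^+ N.
  have rho01 : 0 <= 2 * rho <= 1 by rewrite rho2 mulr_ge0 // ltW.
  apply: (hK (2 * rho) x wz rho01).
  - by apply: le_lt_trans hx1; rewrite lerDl mulr_ge0 // ltW.
  - by move=> i; case: (hzz i) => hw _ _ _; exact: le_lt_trans (near _ hw) hx1.
  - by move=> i; case: (hzz i).
have : m ^+ d.+1 <= K * (2 * rho) ^+ N * \prod_i `|f i|.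
  apply: le_trans low _; rewrite big_split /=; apply: ler_wpM2r; first by apply: prodr_ge0 => i _.
  apply: le_trans hdet; rewrite detE normrM normr_prod -[leLHS]mulr1.
  by apply: ler_wpM2l => //; apply: prodr_ge0 => i _.
rewrite [(2 * rho) ^+ _]exprMn => h.
have : m ^+ d.+1 <= (K * 2 ^+ N) * kap.
  apply: le_trans h _.
  have -> : K * (2 ^+ N * rho ^+ N) * \prod_i `|f i| = (K * 2 ^+ N) * ((\prod_i `|f i|) * rho ^+ N).
    by ring.
  by rewrite ler_wpM2l // mulr_ge0 ?exprn_ge0 // ltW.
have -> : K * 2 ^+ N * kap = m ^+ d.+1 / 2.
  by rewrite /kap; field; rewrite !gt_eqF ?exprn_gt0.
have : 0 < m ^+ d.+1 by rewrite exprn_gt0.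
lra.
Qed.

Variables (beta : R) (D : nat).
Hypotheses (beta_gt0 : 0 < beta) (beta_le1 : beta <= 1).

Lemma psi_le1 (H : R) : 1 <= H -> 0 < psi (c_kd R k d) H <= 1.
Proof.
move=> H1; rewrite /psi powR_gt0 ?(lt_le_trans ltr01) //=.
have := @ler_powR R H H1 (- c_kd R k d) 0; rewrite powRr0; apply.
by rewrite oppr_le0 divr_ge0.
Qed.

Lemma psi_expr (H : R) : 1 <= H -> psi (c_kd R k d) H ^+ N * H ^+ d.+1 = 1.
Proof.
move=> H1; have H0 : 0 < H by exact: lt_le_trans H1.
rewrite /psi -powR_mulrn ?powR_ge0 // -powRrM -[H ^+ _]powR_mulrn ?(ltW H0) //.
rewrite -powRD; last by apply/implyP => _; rewrite gt_eqF.
rewrite mulNr /c_kd divfK ?addNr ?powRr0 //.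
by rewrite pnatr_eq0 -lt0n N_gt0.
Qed.

Variables (g : W -> 'M[R]_d.+1) (M : set (proj_space R d)).
Hypothesis hg : riemannian g.
Variables (U : set V) (Psi : V -> proj_space R d).
Hypothesis hPsi : local_parameterization M U Psi.

(** For a point of height [H], take the first stage with [H ^ (d+1) * eta t ^ N <= kap]. Failure at
    the stage before and [psi_expr] bound [eta t] below by a multiple of [psi H]. If [t = 0], or if
    the point is far from the chart, [psi H <= 1] suffices. *)
Lemma far_rational_BA (u : V) (eta : nat -> R) (theta gam kap rho0 : R) : U u ->
  0 < theta <= 1 / 2 -> 0 < gam -> 0 < kap -> 0 < rho0 ->
  (forall t, eta t = theta ^+ t * rho0) ->
  (forall t w, rational_points (Psi w) -> H_std (Psi w) ^+ d.+1 * eta t ^+ N <= kap ->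
     gam * eta t <= `|w - u|) ->
  BA (riemannian_dist g) M (psi (c_kd R k d)) (Psi u).
Proof.
move=> Uu /andP[th0 th1] gam0 kap0 rho00 etaE hfar.
have [_ UM _ _ _] := hPsi; split; first by apply: UM; exists u.
have [c c0 hc] := dist_chart_lower hg hPsi Uu ltr01.
(* The cap at 1 gives [kap' ^+ N <= kap' <= kap], which replaces an N-th root of [kap]. *)
pose kap' := Num.min kap 1.
have kap'0 : 0 < kap' by rewrite lt_min kap0 ltr01.
exists (c * Num.min 1 (gam * Num.min rho0 (theta * kap'))).
  by rewrite mulr_gt0 // lt_min ltr01 mulr_gt0 // lt_min rho00 mulr_gt0.
set eps' := Num.min 1 _ => q rq Mq.
have H1 := height_ge1 rq; have H0 : 0 < H_std q :> R by exact: lt_le_trans H1.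
have /andP[p0 p1] := psi_le1 H1; set p := psi _ _ in p0 p1 *.
have e0 : 0 < eps' by rewrite lt_min ltr01 mulr_gt0 // lt_min rho00 mulr_gt0.
have [[w [Uw _ wq hd]]|far] := hc q Mq; last first.
  apply: le_trans far; rewrite -mulrA ler_piMr ?(ltW c0) //.
  apply: le_trans (_ : 1 * 1 <= _); last by rewrite mulr1.
  by rewrite ler_pM ?(ltW e0) ?(ltW p0) // ge_min lexx.
apply: le_trans hd; rewrite -mulrA ler_wpM2l ?(ltW c0) //.
apply: le_trans (_ : gam * Num.min rho0 (theta * kap') * p <= _).
  by rewrite ler_wpM2r ?(ltW p0) // ge_min lexx orbT.
rewrite -mulrA.
have eta0 t : 0 < eta t by rewrite etaE mulr_gt0 ?exprn_gt0.
pose small t := H_std q ^+ d.+1 * eta t ^+ N <= kap.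
have ex_small : exists t, small t.
  have Hd : 0 < H_std q ^+ d.+1 :> R by rewrite exprn_gt0.
  pose z := Num.min 1 (kap / H_std q ^+ d.+1) / rho0.
  have z0 : 0 < z by rewrite divr_gt0 // lt_min ltr01 divr_gt0.
  have [|t ht] := @expr_half_small R theta z _ z0; first by rewrite (ltW th0).
  exists t; rewrite /small mulrC -ler_pdivlMr //.
  have het : eta t <= Num.min 1 (kap / H_std q ^+ d.+1).
    by rewrite etaE -ler_pdivlMr.
  move: het; rewrite le_min => /andP[h1 h2]; apply: le_trans h2.
  rewrite -[leRHS]expr1; apply: ler_wiXn2l => //; [exact: ltW|exact: N_gt0].
case: (ex_minnP ex_small) => t st tmin.
have h : gam * eta t <= `|w - u| by apply: hfar; rewrite wq.
apply: le_trans h; rewrite ler_wpM2l ?(ltW gam0) //.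
case: t st tmin => [|t] st tmin.
  rewrite etaE expr0 mul1r.
  apply: le_trans (_ : rho0 * 1 <= _); last by rewrite mulr1.
  by rewrite ler_pM ?(ltW p0) // ?ge_min ?lexx // le_min (ltW rho00) mulr_ge0 // ltW.
have nst : kap < H_std q ^+ d.+1 * eta t ^+ N.
  by rewrite ltNge; apply/negP => /tmin; rewrite ltnn.
have ht : kap' * p <= eta t.
  rewrite -(@ler_pXn2r _ N) ?nnegrE ?N_gt0 ?(ltW (eta0 _)) //; last by rewrite mulr_ge0 // ltW.
  have -> : eta t ^+ N = p ^+ N * (H_std q ^+ d.+1 * eta t ^+ N).
    by rewrite mulrA psi_expr // mul1r.
  rewrite exprMn mulrC ler_wpM2l ?exprn_ge0 ?(ltW p0) //; apply: le_trans (ltW nst).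
  apply: le_trans (_ : kap' <= _); last by rewrite ge_min lexx.
  rewrite -[leRHS]expr1; apply: ler_wiXn2l; [exact: ltW|by rewrite ge_min lexx orbT|exact: N_gt0].
apply: le_trans (_ : theta * (kap' * p) <= _).
  by rewrite mulrA ler_wpM2r ?(ltW p0) // ge_min lexx orbT.
by rewrite etaE exprS -mulrA -etaE ler_wpM2l // ltW.
Qed.

Hypothesis hnd : forall p, M p -> nondegenerate k D M p.

(** One stage is [simplex] for the covector, [avoid_zeros] to leave its zero set, and [force_shrink]
    to bring the radius back between [beta * eta] and [eta]. *)
Lemma local_win v : U v -> exists2 delta : R, 0 < delta &
  forall b : V * R, 0 < b.2 -> b.2 <= delta -> `|v - b.1| <= delta ->
  guarantees beta [set B | exists u, (U `&` Psi @^-1` BA (riemannian_dist g) M (psi (c_kd R k d))) u /\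
     forall n, cball (B n) u] b.
Proof.
move=> Uv; have [oU UM im _ _] := hPsi.
have [X [Phi [[oX Xv XU sm lf] _]]] := im v Uv.
have Mv : M (Psi v) by apply: UM; exists v.
have nd := nondegenerate_chart hPsi oX Xv XU sm lf (hnd Mv).
have [e1 [C1 [e10 C10 h1]]] := smooth_bounded sm D.+1 oX Xv.
have [e3 [C3 [e30 C30 h3]]] := nondegenerate_uniform oX Xv sm nd.
have [e4 [kap [e40 kap0 h4]]] := simplex oX Xv sm lf.
have [Th [gam [Th4 gam0 hav]]] := @avoid_zeros R k beta hk beta_gt0 beta_le1 D.
have Th0 : 0 < Th by exact: lt_le_trans Th4.
pose e := Num.min (Num.min e1 e3) e4.
have e0 : 0 < e by rewrite !lt_min e10 e30.
pose n : R := d.+1%:R; have n0 : 0 < n by rewrite ltr0n.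
have nC0 : 0 < n * C1 * C3 by rewrite !mulr_gt0.
(* For every later ball of radius [rho], with [r = Th * rho]: the ball of radius [r] stays where all
   estimates hold; [r <= 1]; and the scaled derivatives of order D + 1 do not exceed the largest one
   of lower order at the centre. *)
pose delta := Num.min (Num.min (e / (2 * (Th + 4))) (1 / Th)) (1 / (Th * (n * C1 * C3))).
have delta0 : 0 < delta by rewrite !lt_min !divr_gt0 // ?mulr_gt0 // addr_gt0.
have de1 : delta * (Th + 4) < e.
  apply: le_lt_trans (_ : e / (2 * (Th + 4)) * (Th + 4) < _).
    by rewrite ler_wpM2r ?addr_ge0 ?(ltW Th0) // !ge_min lexx.
  have -> : e / (2 * (Th + 4)) * (Th + 4) = e / 2 by field; rewrite gt_eqF // addr_gt0.
  lra.
have de2 : delta * Th <= 1 by rewrite -ler_pdivlMr // !ge_min lexx orbT.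
have de3 : delta * Th * (n * C1 * C3) <= 1.
  by rewrite -mulrA -ler_pdivlMr ?mulr_gt0 // !ge_min lexx orbT.
exists delta => // b b0 bd vb.
(* [gam * beta]: the ball left by [avoid_zeros] is not yet smaller than the next [eta]. [beta / 2]:
   the radius windows of successive stages are disjoint, which gives [P_excl]. *)
pose theta := Num.min (gam * beta) (beta / 2).
pose gam' := Num.min (gam * beta) beta.
have th0 : 0 < theta by rewrite lt_min mulr_gt0 // divr_gt0.
have th2 : theta <= beta / 2 by rewrite ge_min lexx orbT.
have th12 : theta <= 1 / 2 by apply: le_trans th2 _; rewrite ler_pM2r ?invr_gt0.
have th1 : theta <= 1 by apply: le_trans th12 _; lra.
have gam'0 : 0 < gam' by rewrite lt_min mulr_gt0.
pose eta t := theta ^+ t * b.2.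
have eta0 t : 0 < eta t by rewrite mulr_gt0 ?exprn_gt0.
have etaS t : eta t.+1 = theta * eta t by rewrite /eta exprS mulrA.
have etab t : eta t <= b.2.
  elim: t => [|t IH]; first by rewrite /eta expr0 mul1r.
  by rewrite etaS (le_trans _ IH) // ler_piMl ?(ltW (eta0 _)).
pose far t (b' : V * R) := forall w, rational_points (Psi w) ->
  H_std (Psi w) ^+ d.+1 * eta t ^+ N <= kap -> forall u, cball b' u -> gam' * eta t <= `|w - u|.
(* Only the last stage is recorded: the final point lies in the balls that ended all earlier
   stages. *)
pose P t (b' : V * R) := [/\ cball b' `<=` cball b, 0 < b'.2, beta * eta t <= b'.2, b'.2 <= eta t &
  if t is t'.+1 then far t' b' else True].
have P_force t b' : P t b' -> force beta (P t.+1) b'.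
  case: b' => x rho [/= sub rho00 rho1 rho2 _].
  have rhod : rho <= delta by rewrite (le_trans rho2) // (le_trans (etab t)).
  have vx : `|v - x| <= 2 * delta.
    have : cball b x by apply: sub; exact: (cball_center (b := (x, rho))).
    move=> /cballP hbx; rewrite -(subrKA b.1) (le_trans (ler_normD _ _)) //.
    by have := lerD vb (le_trans hbx bd); lra.
  have Thd : Th * rho <= delta * Th by rewrite mulrC ler_wpM2r // ltW.
  have d4 : 4 * delta <= delta * Th by rewrite mulrC ler_wpM2l // ltW.
  have [||a a0 ha] := h4 x rho rho00; [lra| |].
    have : e <= e4 by rewrite ge_min lexx orbT.
    by move: de1; rewrite mulrDr; lra.
  pose r := Th * rho.
  have r0 : 0 < r by rewrite mulr_gt0.
  have r1 : r <= 1 by apply: le_trans de2.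
  pose h s u := (partials s Phi u *m a) 0 0.
  have ball u : `|x - u| <= r -> `|v - u| <= e.
    move=> hu; rewrite -(subrKA x) (le_trans (ler_normD _ _)) //.
    apply: le_trans (lerD vx hu) _; move: de1 Thd; rewrite /r mulrDr; lra.
  have ee1 u : `|v - u| <= e -> `|v - u| <= e1 by rewrite !le_min => /andP[/andP[]].
  have ee3 u : `|v - u| <= e -> `|v - u| <= e3 by rewrite !le_min => /andP[/andP[]].
  have fam : jet_family [set u | `|x - u| <= r] h.
    by apply: (jet_family_pairing sm) => u /ball /ee1 /h1 [].
  have [s0 _ hs0] := @arg_maxP _ R (D.-bseq 'I_k) [bseq] xpredT (fun s => r ^+ size s * `|h s x|) isT.
  set A0 := r ^+ size s0 * `|h s0 x|.
  have rn j : 0 < r ^+ j by rewrite exprn_gt0.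
  have hA0 s : (size s <= D)%N -> r ^+ size s * `|h s x| <= A0.
    by move=> sD; exact: (hs0 (Bseq sD) isT).
  have xx : `|v - x| <= e by apply: ball; rewrite subrr normr0 ltW.
  (* As [r <= 1], each derivative of order at most [D] at [x] is at most [A0 / r ^+ D];
     nondegeneracy converts this into a bound on [a]. *)
  have aA : `|a| * r ^+ D <= C3 * A0.
    rewrite -ler_pdivlMr // -mulrA; apply: (h3 x a) => // [|s sD]; first exact: ee3.
    rewrite ler_pdivlMr // mulrC; apply: le_trans (hA0 s sD).
    by rewrite ler_wpM2r // ler_wiXn2l // ltW.
  have A00 : 0 < A0.
    rewrite -(pmulr_rgt0 _ C30); apply: lt_le_trans aA.
    by rewrite mulr_gt0 // normr_gt0.
  have := hav x rho h A0 s0 rho00 A00 fam hA0; rewrite -/r.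
  move=> /(_ _ (size_bseq s0) erefl) H.
  apply: force_bind (H _) _ => [s u sD hu|b2 [s2 b20 le2 av2]].
    have [_ hb] := h1 u (ee1 u (ball u hu)).
    have hp : `|h s u| <= n * C1 * `|a| by apply: pairing_le; apply: hb; rewrite sD.
    apply: le_trans (_ : r ^+ D.+1 * (n * C1 * `|a|) <= _).
      by rewrite ler_wpM2l // ltW.
    have -> : r ^+ D.+1 * (n * C1 * `|a|) = r * (n * C1) * (`|a| * r ^+ D) by rewrite exprS; ring.
    apply: le_trans (_ : r * (n * C1) * (C3 * A0) <= _).
      by rewrite ler_wpM2l // !mulr_ge0 // ltW.
    have -> : r * (n * C1) * (C3 * A0) = r * (n * C1 * C3) * A0 by ring.
    rewrite ler_piMl ?(ltW A00) //; apply: le_trans de3.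
    by rewrite ler_wpM2r // ltW.
  have hgb : gam' * eta t <= gam * rho.
    apply: le_trans (_ : gam * beta * eta t <= _).
      by rewrite ler_wpM2r ?(ltW (eta0 _)) // ge_min lexx.
    by rewrite -mulrA ler_wpM2l // ltW.
  have hthb : eta t.+1 <= b2.2.
    rewrite etaS; apply: le_trans le2; apply: le_trans (_ : gam * beta * eta t <= _).
      by rewrite ler_wpM2r ?(ltW (eta0 _)) // ge_min lexx.
    by rewrite -mulrA ler_wpM2l // ltW.
  apply: force_bind (force_shrink beta_gt0 hk (eta0 t.+1) b20) _ => b3 [s3 b30 le3 ge3].
  apply: force_now; split=> //.
  - by move=> u /s3 /s2 /sub.
  - apply: le_trans ge3; rewrite le_min lexx andbT; apply: le_trans hthb.
    by rewrite ler_piMl // ltW.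
  move=> w rw hH u hu.
  (* Within [2 * rho] the point lies on the zero set just avoided; beyond, it is at least [rho] away
     from every point of the ball. *)
  have [wx|wx] := leP `|w - x| (2 * rho).
    have hw0 : h [::] w = 0.
      apply: ha => //; apply: le_trans hH; rewrite ler_wpM2l ?exprn_ge0 //.
        by apply: le_trans (height_ge1 rw).
      by rewrite lerXn2r ?nnegrE // ltW.
    apply: le_trans hgb _; rewrite leNgt; apply/negP => wu.
    have := av2 u w (s3 _ hu) (ltW wu); by rewrite hw0 eqxx.
  have /cballP /= hux : cball (x, rho) u by apply/s2/s3.
  have : rho <= `|w - u|.
    have := ler_normB (w - u) (x - u); rewrite opprB addrA subrK; lra.
  apply: le_trans; apply: le_trans rho1.
  by rewrite ler_wpM2r ?(ltW (eta0 _)) // ge_min lexx orbT.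
have P_excl t b' : P t b' -> ~ P t.+1 b'.
  move=> [_ _ h5 _ _] [_ _ _ h6 _].
  have := le_trans h5 h6; rewrite etaS ler_pM2r ?eta0 //; lra.
have P0 : P 0%N b.
  by split=> //; rewrite /eta expr0 mul1r // ler_piMl // ltW.
have HG := stages hk P_force P_excl P0.
apply: (guarantees_sub _ HG) => B B0 Bpos Bsub HB.
have [u hu] := nested_balls Bpos Bsub.
exists u; split=> //.
have Uu : U u.
  apply/XU/(h1 u _).1.
  have := hu 0%N; rewrite B0 => /cballP hbu.
  rewrite -(subrKA b.1) (le_trans (ler_normD _ _)) // (le_trans (lerD vb (le_trans hbu bd))) //.
  have : e <= e1 by rewrite !ge_min lexx.
  have : 0 < delta * Th by rewrite mulr_gt0.
  by move: de1; rewrite mulrDr; lra.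
split=> //; apply: (@far_rational_BA u eta theta gam' kap b.2) => //.
  by rewrite th0.
move=> t w rw hH; have [m [_ _ _ _ hf]] := HB t.+1.
exact: (hf w rw hH u (hu m)).
Qed.

End LocalWin.

Theorem theorem5p2 (R : realType) (k d : nat)
    (hk : (1 <= k)%N) (hkd : (k <= d)%N)
    (g : 'rV[R]_d.+1 -> 'M[R]_d.+1) (hg : riemannian g)
    (M : set (proj_space R d)) (hM : submanifold k M)
    (D : nat) (hD : forall p, M p -> nondegenerate k D M p) :
  hyperplane_winning_rel k M (BA (riemannian_dist g) M (psi (c_kd R k d))).
Proof.
move=> U Psi K hPsi cK KU beta beta0.
apply: hyperplane_winning_guarantees => // b b0.
have [beta1|beta1] := leP beta 1; last first.
  (* For [beta > 1] Bob's radius would have to grow, whereas a central hyperplane halves it: no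
     infinite play exists. *)
  exists (fun h => central (last b h).1); split; first by move=> h; exact: central_hyperplane.
  move=> B B0 [Bpos Bleg]; exfalso.
  have := Bleg 0%N; rewrite /= => hl; have [_ h2] := hl.
  have h3 := legal_central beta0 (Bpos 0%N) (Bpos 1%N) hl.
  have : 1 * (B 0%N).2 < beta * (B 0%N).2 by rewrite ltr_pM2r.
  have := Bpos 0%N; lra.
set S := (U `&` _).
(* Stated for a tail of the play, so that it survives prefixing a ball as [force_guarantees]
   demands; nestedness recovers all balls. *)
pose G := [set B : nat -> 'rV[R]_k * R | exists m u, (S `|` ~` K) u /\ forall n, cball (B (m + n)%N) u].
apply: (@guarantees_sub _ _ _ G) => [B B0 Bpos Bsub [m [u [Su hu]]]|].
  exists u; split=> // n _.
  have sub j : cball (B (n + j)%N) `<=` cball (B n).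
    by elim: j => [|j IH]; rewrite ?addn0 // addnS => x /Bsub /IH.
  by apply: (sub m); rewrite addnC.
pose Q (b' : 'rV[R]_k * R) := (forall u, cball b' u -> ~ K u) \/
  guarantees beta [set B | exists u, S u /\ forall n, cball (B n) u] b'.
apply: (@force_guarantees _ _ _ Q).
(* The radius [delta] depends on the point, so the common point [u] of the balls decides: if it is
   in [K], some ball is small enough for its [delta]; if not, some ball misses the closed set
   [K]. *)
- apply: (@force_bar _ _ _ beta0 hk) => // B B0 Bpos Bsub Brad.
  have [u hu] := nested_balls Bpos Bsub.
  have small (e : R) : 0 < e -> exists n, (B n).2 <= e.
    move=> e0; have [||n hn] := @expr_half_small R (1 / 2) (e / b.2).
    - by rewrite lexx divr_ge0.
    - exact: divr_gt0.
    exists n; apply: le_trans (Brad n) _; rewrite mulrC -ler_pdivlMr //.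
    by rewrite -exprVn -[2^-1]mul1r.
  have [Ku|nKu] := pselect (K u).
    have [delta delta0 hd] := local_win hk hkd beta0 beta1 hg hPsi hD (KU u Ku).
    have [n hn] := small delta delta0.
    exists n; right; apply: hd => //.
    by have /cballP := hu n; rewrite distrC => /le_trans; apply.
  have oK : open (~` K) by apply: closed_openC; apply: compact_closed => //; exact: norm_hausdorff.
  have [e e0 he] := near_closed_ball (open_nbhs_nbhs (conj oK nKu)).
  have [n hn] := small (e / 2) (divr_gt0 e0 (ltr0Sn _ 1)).
  exists n; left=> w /cballP hw; apply: he.
  have /cballP hun := hu n.
  rewrite -(subrKA (B n).1) (le_trans (ler_normD _ _)) // distrC.
  by have := lerD (le_trans hun hn) (le_trans hw hn); lra.
- by move=> B c [m [u [Su hu]]]; exists m.+1, u.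
move=> b' [nK|].
  exists (fun h => central (last b h).1); split; first by move=> h; exact: central_hyperplane.
  move=> B B0 [Bpos Bleg].
  have [u hu] := nested_balls Bpos (fun n => legal_sub (Bleg n)).
  exists 0%N, u; split; last by move=> n; exact: hu.
  by right; apply: nK; rewrite -B0.
apply: guarantees_sub => B _ _ _ [u [Su hu]].
by exists 0%N, u; split; [left|].
Qed.
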